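(* Let $n\ge2$, $1<\mathscr{P}\le n-1$, $N=\binom{n}{\mathscr{P}}$, let $0\le l<k\le N$ be integers, $q=k+1$, $p=q-l>1$, and let $\varepsilon>0$. Let $\varphi\in C^2(\mathbb{S}^n)$ be positive and let $u\in C^4(\mathbb{S}^n)$ be a positive admissible solution of $$\frac{\sigma_k(\Lambda(\nabla^2u+uI))}{\sigma_l(\Lambda(\nabla^2u+uI))}=u^{p-1+\varepsilon}(u^2+|\nabla u|^2)^{\frac{k+1-q}{2}}\varphi\quad\text{on }\mathbb{S}^n.$$ Define $\widetilde u=u/\min_{\mathbb{S}^n}u$. Then there exists a positive constant $C''$, depending only on $n,k,l,\mathscr{P}$, $\min_{\mathbb{S}^n}\varphi$ and $\|\varphi\|_{C^2}$, such that $|\nabla^2\widetilde u(x)|\le C''$ for all $x\in\mathbb{S}^n$.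
   Context: $\mathbb{S}^n$ is the unit sphere with its standard metric; $\nabla u$, $\nabla^2u$ are the gradient and covariant Hessian in a local orthonormal frame; $I$ is the identity. Let $\mathbf{I}_1,\dots,\mathbf{I}_N$ enumerate the multi-indices $1\le i_1<\dots<i_{\mathscr{P}}\le n$. For a symmetric matrix $A$ with eigenvalues $\lambda$, $\Lambda(A)=(\Lambda_{\mathbf{I}_1},\dots,\Lambda_{\mathbf{I}_N})$ with $\Lambda_{\mathbf{I}}=\lambda_{i_1}+\dots+\lambda_{i_{\mathscr{P}}}$. $\sigma_m$ is the $m$-th elementary symmetric polynomial, $\sigma_0=1$; $\Gamma_k=\{\mu\in\mathbb{R}^N:\sigma_j(\mu)>0,\ 1\le j\le k\}$. A function $u\in C^2(\mathbb{S}^n)$ is admissible if $\Lambda(\nabla^2u+uI)\in\Gamma_k$ at every point. *)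

(* Defs.v *)
From HB Require Import structures.
From mathcomp Require Import all_boot all_order all_algebra.
From mathcomp Require Import all_classical all_reals all_analysis.
Set Implicit Arguments. Unset Strict Implicit. Unset Printing Implicit Defensive.
Import Order.TTheory GRing.Theory Num.Theory.
Import numFieldNormedType.Exports.
Local Open Scope ring_scope.
Local Open Scope classical_set_scope.

Definition dotv (R : realType) (m : nat) (x y : 'rV[R]_m) : R :=
  \sum_(i < m) x 0 i * y 0 i.

Definition sphere (R : realType) (n : nat) : set 'rV[R]_n.+1 :=
  [set x | dotv x x = 1].
Arguments sphere {R} n _.

(* degree-0 homogeneous extension of a function given on S^n *)
Definition hext (R : realType) (m : nat) (f : 'rV[R]_m -> R) (x : 'rV[R]_m) : R :=
  f ((Num.sqrt (dotv x x))^-1 *: x).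

Fixpoint isCk (R : realType) (m : nat) (k : nat) (f : 'rV[R]_m -> R)
    (U : set 'rV[R]_m) : Prop :=
  match k with
  | 0 => forall x, U x -> {for x, continuous f}
  | k'.+1 => (forall x v, U x -> derivable f x v) /\
             (forall v, isCk k' ('D_v f) U)
  end.

Definition CkS (R : realType) (n k : nat) (u : 'rV[R]_n.+1 -> R) : Prop :=
  isCk k (hext u) [set x | x != 0].

Definition tframe (R : realType) (n : nat) (x : 'rV[R]_n.+1)
    (e : 'I_n -> 'rV[R]_n.+1) : Prop :=
  (forall i j, dotv (e i) (e j) = (i == j)%:R) /\ (forall i, dotv (e i) x = 0).

Definition utan (R : realType) (n : nat) (x v : 'rV[R]_n.+1) : Prop :=
  dotv v v = 1 /\ dotv v x = 0.

(* second directional derivative; for the 0-homogeneous extension of u, at a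
   point of S^n and tangent v, w this is the covariant Hessian
   nabla^2 u (v, w) (since x . D(hext u)(x) = 0). *)
Definition hess (R : realType) (m : nat) (f : 'rV[R]_m -> R) (x v w : 'rV[R]_m) : R :=
  'D_v ('D_w f) x.

Definition sphA (R : realType) (n : nat) (u : 'rV[R]_n.+1 -> R)
    (x : 'rV[R]_n.+1) (e : 'I_n -> 'rV[R]_n.+1) : 'M[R]_n :=
  \matrix_(i, j) (hess (hext u) x (e i) (e j) + (i == j)%:R * u x).

Definition grad2 (R : realType) (n : nat) (u : 'rV[R]_n.+1 -> R)
    (x : 'rV[R]_n.+1) (e : 'I_n -> 'rV[R]_n.+1) : R :=
  \sum_(i < n) ('D_(e i) (hext u) x) ^+ 2.

Definition eigvals (R : realType) (n : nat) (A : 'M[R]_n) (lam : 'I_n -> R) : Prop :=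
  char_poly A = \prod_(i < n) ('X - (lam i)%:P).

Definition esym (R : realType) (I : finType) (A : {set I}) (m : nat) (mu : I -> R) : R :=
  \sum_(T : {set I} | (T \subset A) && (#|T| == m)%N) \prod_(i in T) mu i.

(* multi-indices 1 <= i_1 < ... < i_P <= n, i.e. P-subsets of 'I_n *)
Definition PSets (n P : nat) : {set {set 'I_n}} := [set S : {set 'I_n} | #|S| == P].

Definition LambdaP (R : realType) (n : nat) (lam : 'I_n -> R) (S : {set 'I_n}) : R :=
  \sum_(i in S) lam i.

Definition sigmaL (R : realType) (n P m : nat) (lam : 'I_n -> R) : R :=
  esym (PSets n P) m (LambdaP lam).

Definition inGamma (R : realType) (n P k : nat) (lam : 'I_n -> R) : Prop :=
  forall j, (1 <= j <= k)%N -> 0 < sigmaL P j lam.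

Definition admissible (R : realType) (n P k : nat) (u : 'rV[R]_n.+1 -> R) : Prop :=
  forall x, sphere n x -> forall e, tframe x e -> forall lam,
    eigvals (sphA u x e) lam -> inGamma P k lam.

Definition solves (R : realType) (n P k l q p : nat) (eps : R)
    (phi u : 'rV[R]_n.+1 -> R) : Prop :=
  forall x, sphere n x -> forall e, tframe x e -> forall lam,
    eigvals (sphA u x e) lam ->
    sigmaL P k lam / sigmaL P l lam =
      powR (u x) (p%:R - 1 + eps)
      * powR (u x ^+ 2 + grad2 u x e) ((k.+1%:R - q%:R) / 2)
      * phi x.

(* ||phi||_{C^2(S^n)} <= M, with the norm
   max(sup |phi|, sup |nabla phi|, sup |nabla^2 phi|) (operator norms) *)
Definition C2bound (R : realType) (n : nat) (phi : 'rV[R]_n.+1 -> R) (M : R) : Prop :=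
  forall x, sphere n x ->
    `|phi x| <= M /\
    (forall v, utan x v -> `|'D_v (hext phi) x| <= M) /\
    (forall v w, utan x v -> utan x w -> `|hess (hext phi) x v w| <= M).

(* Main.v *)
(** Let [U] be the 1-homogeneous extension of [u]; on the tangent space at a point
    of the sphere its Euclidean Hessian is [nabla^2 u + u I], and the point spans
    the kernel, so Euclidean derivatives of [U] replace covariant ones.  As
    [q = k + 1], the equation is
    [(sigma_k / sigma_l)(Lambda) = u^(k - l + eps) phi].

    The Marcus-Lopes recursion writes [sigma_{j+1} / sigma_j] on [Gamma_j] as a sum
    of linear and quadratic-over-linear terms and produces nonnegative
    supergradients; multiplying over [l <= j < k] (AM-GM) bounds the operator along
    any path by a linear functional of the diagonal in a principal frame.

    Maximum principles then give the bound, with constants independent of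
    [eps].  At a maximum of [u] the equation bounds [u^eps phi], which bounds below
    the total weight of the supergradient.  At a maximum [K] of [|nabla u| / u]
    the first derivative of the equation gives [K (eps + c) <= C]; here [1 < P]
    prevents a single direction from carrying all the weight.  Integrating gives
    [max u <= C min u].  At a maximum of the largest eigenvalue of the Hessian of
    [U] the second derivative of the equation bounds it by [C u], and positivity of
    the trace bounds the remaining eigenvalues from below. *)

Require Import Defs.
From mathcomp Require Import all_boot all_order all_fingroup all_algebra.
From mathcomp Require Import all_classical all_reals all_analysis.
From mathcomp Require Import complex.
From mathcomp Require Import ring lra.
From mathcomp Require Import finset.
Import Order.TTheory GRing.Theory Num.Theory.
Import numFieldNormedType.Exports.
Local Open Scope ring_scope.
Set Implicit Arguments. Unset Strict Implicit. Unset Printing Implicit Defensive.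
Local Notation esym := Defs.esym.

(** * Elementary symmetric functions and Newton's inequality *)

(** Eigenvalues need not depend differentiably on the point, so the operator is never
    differentiated. Once the weights [g] are fixed at an extremal point [x], the equation gives an
    inequality between differentiable functions of [t] along [x + t w], with equality at [t = 0]:
    first derivatives agree there and second derivatives compare. The extremal quantities are
    treated alike: maximality of [K] or of the top eigenvalue is an inequality along lines through
    [x], tight at [x], and its second-order part controls the third and fourth derivatives of [U].
    The comparison sees the diagonal in an orthonormal frame at the moving point, so the frame is
    rotated along explicitly. Uniformity in [eps] comes from logarithms, which turn the exponent
    into a coefficient [d + eps] with [d = k - l]. In the gradient estimate [d K] cancels and
    [K eps] stays on the good side, so [K eps] is bounded even for large [eps]. That controls the
    term [(d + eps) K^2] of the Hessian estimate; the other term with [eps],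
    [(d + eps) (L - u) / u], has a favourable sign as soon as the top eigenvalue [L] exceeds [u]. *)

Lemma esym0 (R : realType) (I : finType) (A : {set I}) (mu : I -> R) :
  esym A 0 mu = 1.
Proof.
rewrite /esym (big_pred1 set0) ?big_set0 // => T; rewrite /= cards_eq0.
by apply/andP/eqP => [[_ /eqP]|->]; rewrite ?sub0set.
Qed.

Lemma esym_mem (R : realType) (I : finType) (A : {set I}) (mu : I -> R) m i :
  i \in A -> mu i * esym (A :\ i) m mu =
  \sum_(T : {set I} | [&& T \subset A, #|T| == m.+1 & i \in T])
     \prod_(j in T) mu j.
Proof.
move=> iA; rewrite /esym big_distrr /=.
rewrite [RHS](reindex_onto (fun T => i |: T) (fun T => T :\ i)) /=; last first.
  by move=> T /and3P[_ _ iT]; rewrite setD1K.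
apply: eq_big => [T|T /andP[TA _]]; last first.
  rewrite big_setU1 //=; apply/negP => iT.
  by have /setD1P[/eqP] := fintype.subsetP TA _ iT.
have [iT|iT] := boolP (i \in T).
  rewrite [T \subset _](_ : _ = false); last first.
    by apply/negP => /fintype.subsetP/(_ _ iT); rewrite !inE eqxx.
  rewrite [_ == T](_ : _ = false) ?andbF //.
  by apply/negP => /eqP/setP/(_ i); rewrite !inE eqxx iT.
rewrite setU1K // eqxx andbT cardsU1 iT eqSS setU11 andbT subUset sub1set iA /=.
congr (_ && _); apply/fintype.subsetP/fintype.subsetP => TA j jT.
  by have /setD1P[] := TA j jT.
by rewrite !inE TA // andbT; apply: contraNneq iT => <-.
Qed.

Lemma esym_rec (R : realType) (I : finType) (A : {set I}) (mu : I -> R) m i :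
  i \in A ->
  esym A m.+1 mu = mu i * esym (A :\ i) m mu + esym (A :\ i) m.+1 mu.
Proof.
move=> iA; rewrite esym_mem // /esym (bigID (fun T : {set I} => i \in T)) /=.
congr (_ + _); apply: eq_bigl => T; first by rewrite -andbA.
by rewrite subsetD1 andbAC.
Qed.

Lemma esym_sum (R : realType) (I : finType) (A : {set I}) (mu : I -> R) m :
  \sum_(i in A) mu i * esym (A :\ i) m mu = m.+1%:R * esym A m.+1 mu.
Proof.
under eq_bigr => i iA do rewrite esym_mem //.
rewrite (exchange_big_dep (fun T : {set I} => (T \subset A) && (#|T| == m.+1))) /=.
  rewrite /esym big_distrr /=; apply: eq_bigr => T /andP[TA /eqP Tm].
  rewrite (eq_bigl [in T]) ?sumr_const ?Tm ?mulr_natl // => i /=.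
  rewrite TA eqxx /=; apply/andP/idP => [[]//|iT]; split=> //.
  exact: (fintype.subsetP TA).
by move=> i T _ /and3P[-> ->].
Qed.

Lemma esym1 (R : realType) (I : finType) (A : {set I}) (mu : I -> R) :
  esym A 1 mu = \sum_(i in A) mu i.
Proof.
rewrite -[LHS]mul1r -(esym_sum A mu 0); apply: eq_bigr => i _.
by rewrite esym0 mulr1.
Qed.

Lemma esym_set0 (R : realType) (I : finType) (mu : I -> R) m :
  esym set0 m mu = (m == 0%N)%:R.
Proof.
case: m => [|m]; first by rewrite esym0.
rewrite /esym big1 // => T /andP[]; rewrite subset0 => /eqP ->.
by rewrite cards0.
Qed.

(** Through this generating product, inequalities between symmetric functions become statements
    about polynomials with real roots, and a relabelling of the variables becomes the reindexing of
    a product. *)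
Lemma coef_prod_esym (R : realType) (I : finType) (A : {set I}) (mu : I -> R) m :
  (\prod_(i in A) (1 + mu i *: 'X))`_m = esym A m mu.
Proof.
have [n An] := ubnP #|A|; elim: n A An m => // n IHn A An m.
have [->|[i iA]] := set_0Vmem A; first by rewrite big_set0 coef1 esym_set0.
have Ai : (#|A :\ i| < n)%N by rewrite (cardsD1 i) iA in An.
rewrite (big_setD1 i) //= mulrDl mul1r -scalerAl coefD coefZ coefXM IHn //.
case: m => [|m]; first by rewrite !esym0 mulr0 addr0.
by rewrite IHn // (esym_rec mu m iA) addrC.
Qed.

(** The scalar [c] may vanish and [s] may be empty, so zero and constants count as real-rooted and
    differentiation never leaves the class. *)
Definition real_rooted (R : realType) (p : {poly R}) : Prop :=
  exists (c : R) (s : seq R), p = c *: \prod_(r <- s) ('X - r%:P).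

Lemma real_rootedM (R : realType) (p q : {poly R}) :
  real_rooted p -> real_rooted q -> real_rooted (p * q).
Proof.
move=> [c [s ->]] [d [t ->]]; exists (c * d), (s ++ t).
by rewrite big_cat /= -scalerAl -scalerAr scalerA.
Qed.

Lemma real_rooted_prod (R : realType) (I : finType) (A : {set I}) (mu : I -> R) :
  real_rooted (\prod_(i in A) (1 + mu i *: 'X)).
Proof.
apply: (big_ind (@real_rooted R)) => [||i _].
- by exists 1, [::]; rewrite big_nil scale1r.
- exact: real_rootedM.
have [->|mi0] := eqVneq (mu i) 0.
  by exists 1, [::]; rewrite big_nil scale0r scale1r addr0.
exists (mu i), [:: - (mu i)^-1]; rewrite big_seq1 scalerBr addrC.
by rewrite scale_polyC mulrN divff // polyCN opprK.
Qed.

Lemma logarithmic_derivative (F : fieldType) (s : seq F) (z : F) :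
  all (fun r => z != r) s ->
  (\prod_(r <- s) ('X - r%:P))^`().[z] =
  (\prod_(r <- s) ('X - r%:P)).[z] * \sum_(r <- s) (z - r)^-1.
Proof.
elim: s => [|r s IHs]; first by rewrite !big_nil derivC horner0 mulr0.
move=> /= /andP[zr /IHs IH]; rewrite !big_cons derivM hornerD !hornerM IH.
rewrite derivXsubC hornerXsubC hornerC; have : z - r != 0 by rewrite subr_eq0.
by move=> zr0; field.
Qed.

(** Each term [1 / (z - r)] has imaginary part of sign opposite to that of [z], so nothing cancels
    in the sum. *)
Lemma Im_sum_inv_sign (R : realType) (s : seq R) (z : R[i]) :
  complex.Im z != 0 -> s != [::] ->
  complex.Im z * complex.Im (\sum_(r <- s) (z - r%:C)^-1)%C < 0.
Proof.
case: z => a b /= b0.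
have term r : b * complex.Im ((a +i* b - r%:C)^-1)%C < 0.
  rewrite /= oppr0 addr0; have b2 : 0 < b ^+ 2 by rewrite exprn_even_gt0.
  have D : 0 < (a - r) ^+ 2 + b ^+ 2 by rewrite ltr_wpDl ?sqr_ge0.
  by rewrite mulrN mulrA -expr2 oppr_lt0 divr_gt0.
case: s => // r s _; elim: s r => [|q s IHs] r; first by rewrite big_seq1.
by rewrite big_cons raddfD /= mulrDr (lt_le_trans (ltr_leD (term r) (ltW (IHs q)))) ?addr0.
Qed.

(* Gauss-Lucas: [p' / p = sum 1 / (z - r)] has nonzero imaginary part off the
   real axis. *)
Lemma real_rooted_deriv (R : realType) (p : {poly R}) :
  real_rooted p -> real_rooted p^`().
Proof.
move=> [c [s ps]]; have [->|q0] := eqVneq p^`() 0.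
  by exists 0, [::]; rewrite scale0r.
have c0 : c != 0 by apply: contraNneq q0 => c0; rewrite ps c0 scale0r derivC.
have s0 : s != [::].
  by apply: contraNneq q0 => s0; rewrite ps s0 big_nil alg_polyC derivC.
set f := real_complex R; pose q := map_poly f p^`().
have [zs qz] := closed_field_poly_normal q.
have lq : lead_coef q != 0 by rewrite lead_coef_eq0 map_poly_eq0.
have pC : map_poly f p = f c *: \prod_(r <- map f s) ('X - r%:P).
  rewrite ps map_polyZ rmorph_prod big_map; congr (_ *: _).
  by apply: eq_bigr => r _; rewrite /= map_polyXsubC.
have zreal z : z \in zs -> complex.Im z = 0.
  move=> zzs; apply/eqP; apply: contraT => z0.
  have : q.[z] = 0.
    by apply/eqP; rewrite -[_ == _]/(root q z) qz rootZ // root_prod_XsubC.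
  have zs' : all (fun r => z != r) (map f s).
    apply/allP => w /mapP[r _ ->]; apply: contraNneq z0 => ->.
    by rewrite /f /= eqxx.
  rewrite /q -deriv_map pC derivZ hornerZ logarithmic_derivative // [\sum_(_ <- _) _]big_map.
  move=> /eqP; rewrite !mulf_eq0 fmorph_eq0 (negPf c0) /= => /orP[].
    rewrite -[_ == _]/(root _ z) root_prod_XsubC => /mapP[r _ zr].
    by move: z0; rewrite zr /= eqxx.
  move=> /eqP S0; have := @Im_sum_inv_sign R s z z0 s0.
  by rewrite [\sum_(_ <- _) _]S0 /= mulr0 ltxx.
exists (lead_coef p^`()), (map (@complex.Re R) zs).
apply: (map_inj_poly (f := f)) => //; first exact: fmorph_inj.
rewrite -/q {1}qz map_polyZ /= /q lead_coef_map rmorph_prod big_map.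
congr (_ *: _); apply: eq_big_seq => z zzs /=.
rewrite map_polyXsubC; congr (_ - _%:P).
by have := zreal z zzs; case: z {zzs} => a b /= ->.
Qed.

(** For [p = (X - r) q] the defect [p'^2 - p p''] equals [q^2 + (x - r)^2 (q'^2 - q q'')], so the
    induction over the roots is free of division and covers the roots themselves. *)
Lemma laguerre (R : realType) (p : {poly R}) (x : R) :
  real_rooted p -> p.[x] * p^`()^`().[x] <= p^`().[x] ^+ 2.
Proof.
move=> [c [s ->]]; rewrite !derivZ !hornerZ exprMn mulrACA -expr2.
rewrite ler_wpM2l ?sqr_ge0 //.
elim: s => [|r s IHs]; first by rewrite big_nil derivC deriv0 !horner0 mulr0 sqr_ge0.
rewrite big_cons !derivM derivXsubC !derivD !derivM derivXsubC.
have -> : (1 : {poly R})^`() = 0 by rewrite -polyC1 derivC.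
rewrite !(hornerXsubC, hornerC, horner0, hornerM, hornerD).
set q := \prod_(_ <- s) _ in IHs *.
set a := q.[x] in IHs *; set b := q^`().[x] in IHs *.
set d := q^`()^`().[x] in IHs *.
have -> : (x - r) * a * (0 * a + 1 * b + (1 * b + (x - r) * d)) =
  (a + (x - r) * b) ^+ 2 - a ^+ 2 - (x - r) ^+ 2 * (b ^+ 2 - a * d) by ring.
rewrite -subr_ge0.
rewrite mul1r.
have -> : (a + (x - r) * b) ^+ 2 - ((a + (x - r) * b) ^+ 2 - a ^+ 2 -
  (x - r) ^+ 2 * (b ^+ 2 - a * d)) = a ^+ 2 + (x - r) ^+ 2 * (b ^+ 2 - a * d).
  by ring.
by rewrite addr_ge0 ?sqr_ge0 // mulr_ge0 ?sqr_ge0 // subr_ge0.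
Qed.

Lemma real_rooted_derivn (R : realType) (p : {poly R}) m :
  real_rooted p -> real_rooted p^`(m).
Proof. by move=> hp; elim: m => // m; rewrite derivnS; apply: real_rooted_deriv. Qed.

(** This is Laguerre's inequality at [0] for the [m]-th derivative of the generating product, whose
    value and first two derivatives there are factorial multiples of the three symmetric
    functions. *)
Lemma newton (R : realType) (I : finType) (A : {set I}) (mu : I -> R) m :
  esym A m mu * esym A m.+2 mu <= esym A m.+1 mu ^+ 2.
Proof.
have := @laguerre R _ 0 (real_rooted_derivn m (real_rooted_prod A mu)).
rewrite -!derivnS !horner_coef0 !coef_derivn !addn0 !coef_prod_esym.
rewrite !ffactnn -!(mulr_natr (esym _ _ _)).
set a := esym _ _ _; set b := esym _ _ _; set c := esym _ _ _ => H.
have [ab|ab] := lerP (a * b) 0; first exact: le_trans ab (sqr_ge0 _).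
(* The factorials leave the factor [(m+2)/(m+1) >= 1], which may be dropped because [a * b] is
   positive in this case. *)
have F : (m`!%:R * m.+2`!%:R : R) = m.+1`!%:R ^+ 2 * (m.+2%:R / m.+1%:R).
  rewrite !factS !natrM; have : (m.+1%:R : R) != 0 by rewrite pnatr_eq0.
  by move=> ?; field.
have G : 0 < (m.+1`!%:R : R) ^+ 2 by rewrite exprn_gt0 // ltr0n fact_gt0.
have : m.+1`!%:R ^+ 2 * (a * b * (m.+2%:R / m.+1%:R)) <= m.+1`!%:R ^+ 2 * c ^+ 2.
  by rewrite mulrCA -F [leRHS]mulrC -exprMn; apply: le_trans H; rewrite mulrACA.
rewrite ler_pM2l //; apply: le_trans.
by rewrite ler_peMr ?(ltW ab) // ler_pdivlMr ?ltr0n // mul1r ler_nat.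
Qed.

(** * Concavity of quotients of elementary symmetric functions *)

Definition garding_cone (R : realType) (I : finType) (A : {set I}) (k : nat)
  (x : I -> R) : Prop := forall j, (1 <= j <= k)%N -> 0 < esym A j x.

Lemma garding_cone_gt0 (R : realType) (I : finType) (A : {set I}) k j (x : I -> R) :
  garding_cone A k x -> (j <= k)%N -> 0 < esym A j x.
Proof. by case: j => [|j] xk jk; [rewrite esym0|apply: xk]. Qed.

Lemma garding_coneW (R : realType) (I : finType) (A : {set I}) k j (x : I -> R) :
  (j <= k)%N -> garding_cone A k x -> garding_cone A j x.
Proof.
move=> jk xk i /andP[i1 ij]; apply: xk.
by rewrite i1 (leq_trans ij).
Qed.

(** Omitting [i], let [a > 0], [b], [c] be the symmetric functions of degrees [k], [k+1], [k+2], and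
    suppose [b <= 0]. Positivity of [x_i a + b] and [x_i b + c] gives [a c > b^2], against Newton's
    inequality. *)
Lemma garding_coneD1 (R : realType) (I : finType) (A : {set I}) k (x : I -> R) i :
  i \in A -> garding_cone A k.+1 x -> garding_cone (A :\ i) k x.
Proof.
move=> iA; elim: k => [|k IHk] xk; first by case.
have xk' : garding_cone (A :\ i) k x.
  by apply: IHk; apply: garding_coneW xk.
move=> j /andP[j1]; rewrite leq_eqVlt => /orP[/eqP->|jk]; last first.
  by apply: xk'; rewrite j1.
have := garding_cone_gt0 xk (leqnn _); have := garding_cone_gt0 xk (leqnSn _).
have := garding_cone_gt0 xk' (leqnn k); have := newton (A :\ i) x k.
rewrite !(esym_rec x _ iA); set a := esym _ _ _; set b := esym _ k.+1 _.
set c := esym _ k.+2 _ => N a0 P1 P2; rewrite ltNge; apply/negP => b0.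
have H1 : a * (- x i * b) < a * c by rewrite ltr_pM2l //; lra.
have H2 : - b * - b <= (x i * a) * - b by rewrite ler_wpM2r; lra.
nra.
Qed.

Definition esym_quot (R : realType) (I : finType) (A : {set I}) (k : nat)
  (x : I -> R) : R := esym A k.+1 x / esym A k x.

(** With [q = esym_quot (A :\ i) k y], the sum [y_i + q] is the ratio of [esym A k.+1 y] to
    [esym (A :\ i) k y], and the summand is [y_i q / (y_i + q)]. Written as [y_i] minus a square
    over a positive quantity, it is monotone in [q] and easily bounded above by linear functions. *)
Lemma esym_quot_rec (R : realType) (I : finType) (A : {set I}) k (y : I -> R) :
  garding_cone A k.+1 y ->
  k.+2%:R * esym_quot A k.+1 y =
  \sum_(i in A) (y i - y i ^+ 2 / (y i + esym_quot (A :\ i) k y)).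
Proof.
move=> yk; rewrite /esym_quot mulrA -esym_sum mulr_suml; apply: eq_bigr => i iA.
have := garding_cone_gt0 yk (leqnn _).
have := garding_cone_gt0 (garding_coneD1 iA yk) (leqnn _).
rewrite (esym_rec y k iA); set a := esym _ _ _; set b := esym _ _ _ => a0 b0.
have -> : y i + b / a = (y i * a + b) / a by field; rewrite gt_eqF.
by field; rewrite !gt_eqF.
Qed.

Lemma esym_quot_shift_gt0 (R : realType) (I : finType) (A : {set I}) k (y : I -> R) i :
  i \in A -> garding_cone A k.+1 y -> 0 < y i + esym_quot (A :\ i) k y.
Proof.
move=> iA yk; have := garding_cone_gt0 yk (leqnn _).
have := garding_cone_gt0 (garding_coneD1 iA yk) (leqnn _).
rewrite /esym_quot (esym_rec y k iA); set a := esym _ _ _; set b := esym _ _ _.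
move=> a0 b0; have -> : y i + b / a = (y i * a + b) / a by field; rewrite gt_eqF.
exact: divr_gt0.
Qed.

(* The weights come from the recursion [esym_quot_rec] and the tangent bound
   [y^2 / s >= 2 a y - a^2 s], an equality for [a = y / s]. *)
Lemma esym_quot_supergradient (R : realType) (I : finType) k (A : {set I})
  (x : I -> R) : garding_cone A k x ->
  exists g : I -> R, [/\ forall i, 0 <= g i,
    \sum_(i in A) g i * x i = esym_quot A k x &
    forall y, garding_cone A k y ->
      esym_quot A k y <= \sum_(i in A) g i * y i].
Proof.
elim: k A x => [|k IHk] A x xk.
  have E y : esym_quot A 0 y = \sum_(i in A) 1 * y i.
    rewrite /esym_quot esym0 divr1 esym1.
    by apply: eq_bigr => i _; rewrite mul1r.
  by exists (fun=> 1); split => // [|y _]; rewrite E.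
have /boolp.choice[g gP] : forall i, exists g : I -> R, i \in A ->
    [/\ forall j, 0 <= g j,
     \sum_(j in A :\ i) g j * x j = esym_quot (A :\ i) k x &
     forall y, garding_cone (A :\ i) k y ->
       esym_quot (A :\ i) k y <= \sum_(j in A :\ i) g j * y j].
  move=> i; have [iA|iA] := boolP (i \in A); last by exists (fun=> 0).
  by have [g] := IHk (A :\ i) x (garding_coneD1 iA xk); exists g.
pose s i (y : I -> R) : R := y i + esym_quot (A :\ i) k y.
pose a i := x i / s i x.
(* Inserting the tangent bound into [y - y^2 / (y + q)] leaves [(1 - a)^2 y + a^2 q]. The first term
   goes to the coefficient of its own variable; the second is spread over the other variables by the
   weights [g i] of the smaller quotient. *)
pose G j : R := ((1 - a j) ^+ 2 + \sum_(i in A | i != j) a i ^+ 2 * g i j) / k.+2%:R.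
have GE (y : I -> R) : k.+2%:R * \sum_(j in A) G j * y j =
    \sum_(i in A) ((1 - a i) ^+ 2 * y i +
                   a i ^+ 2 * \sum_(j in A :\ i) g i j * y j).
  rewrite big_split /= mulr_sumr.
  under [LHS]eq_bigr => j jA.
    rewrite /G mulrA [_ * (_ / _)]mulrC divfK ?pnatr_eq0 // mulrDl mulr_suml.
    over.
  rewrite big_split /=; congr (_ + _).
  under [RHS]eq_bigr => i iA do rewrite mulr_sumr.
  rewrite (exchange_big_dep (fun i => i \in A)) /=; last by move=> i j _ /andP[].
  apply: eq_bigr => i iA; apply: eq_big => j; first by rewrite !inE iA eq_sym andbC.
  by move=> _; rewrite mulrA.
exists G; split => [j||y yk].
- rewrite divr_ge0 // addr_ge0 ?sqr_ge0 // sumr_ge0 // => i /andP[iA _].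
  by rewrite mulr_ge0 ?sqr_ge0 //; have [] := gP i iA.
- apply: (mulfI (x := k.+2%:R)); first by rewrite pnatr_eq0.
  rewrite GE esym_quot_rec //; apply: eq_bigr => i iA.
  have [_ -> _] := gP i iA; have := esym_quot_shift_gt0 iA xk.
  have -> : esym_quot (A :\ i) k x = s i x - x i by rewrite /s addrC addKr.
  rewrite addrCA subrr addr0 => s0; rewrite /a; field.
  by rewrite gt_eqF.
rewrite -(ler_pM2l (x := k.+2%:R)) ?ltr0n // GE esym_quot_rec //.
apply: ler_sum => i iA; have [_ _ /(_ y (garding_coneD1 iA yk)) gy] := gP i iA.
have := esym_quot_shift_gt0 iA yk; set t := y i + _ => t0.
have : t <= y i + \sum_(j in A :\ i) g i j * y j by rewrite lerD2l.
set z := \sum_(_ in _) _ => tz.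
have : a i ^+ 2 * t <= a i ^+ 2 * (y i + z) by rewrite ler_wpM2l ?sqr_ge0.
have : 2 * a i * y i - a i ^+ 2 * t <= y i ^+ 2 / t.
  rewrite ler_pdivlMr // -subr_ge0.
  have -> : y i ^+ 2 - (2 * a i * y i - a i ^+ 2 * t) * t = (y i - a i * t) ^+ 2.
    by ring.
  exact: sqr_ge0.
nra.
Qed.

Definition esym_ratio (R : realType) (I : finType) (A : {set I}) (k l : nat)
  (x : I -> R) : R := esym A k x / esym A l x.

Lemma esym_ratio_prod (R : realType) (I : finType) (A : {set I}) k l (x : I -> R) :
  (l <= k)%N -> garding_cone A k x ->
  esym_ratio A k l x = \prod_(j < k - l) esym_quot A (l + j) x.
Proof.
move=> lk; rewrite -{1 2}(subnKC lk); elim: (k - l)%N => [|d IHd] xk.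
  by rewrite big_ord0 /esym_ratio addn0 divff // gt_eqF // (garding_cone_gt0 xk) ?addn0.
rewrite big_ord_recr /= -IHd; last by apply: garding_coneW xk; rewrite addnS.
rewrite /esym_quot /esym_ratio addnS.
have H1 := garding_cone_gt0 xk (leq_addr _ _ : (l <= l + d.+1)%N).
have H2 : 0 < esym A (l + d) x by apply: (garding_cone_gt0 xk); rewrite leq_add2l.
by field; rewrite !gt_eqF.
Qed.

Lemma esym_quot_gt0 (R : realType) (I : finType) (A : {set I}) k (x : I -> R) :
  garding_cone A k.+1 x -> 0 < esym_quot A k x.
Proof.
by move=> xk; rewrite divr_gt0 // (garding_cone_gt0 xk).
Qed.

(** The ratio telescopes into [d = k - l] consecutive quotients. Their supergradients, each divided
    by the value of its quotient at [x], are averaged, and AM-GM compares the product with the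
    [d]-th power of the average. The exponent matches the homogeneity, and equality holds at
    [y = x]. *)
Lemma esym_ratio_supergradient (R : realType) (I : finType) (A : {set I}) k l
  (x : I -> R) : (l < k)%N -> garding_cone A k x ->
  exists g : I -> R, [/\ forall i, 0 <= g i,
    \sum_(i in A) g i * x i = 1 &
    forall y, garding_cone A k y -> 0 < \sum_(i in A) g i * y i /\
      esym_ratio A k l y <= esym_ratio A k l x *
        (\sum_(i in A) g i * y i) ^+ (k - l)].
Proof.
move=> lk xk; pose d := (k - l)%N; have d0 : (0 < d)%N by rewrite subn_gt0.
have jk (j : 'I_d) : (l + j < k)%N by rewrite -ltn_subRL.
have /boolp.choice[g gP] : forall j : 'I_d, exists g : I -> R,
    [/\ forall i, 0 <= g i,
     \sum_(i in A) g i * x i = esym_quot A (l + j) x &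
     forall y, garding_cone A (l + j) y ->
       esym_quot A (l + j) y <= \sum_(i in A) g i * y i].
  by move=> j; apply: esym_quot_supergradient; apply: garding_coneW xk; apply: ltnW.
have q0 (y : I -> R) (j : 'I_d) : garding_cone A k y -> 0 < esym_quot A (l + j) y.
  by move=> yk; apply: esym_quot_gt0; apply: garding_coneW yk.
pose G i := (\sum_j g j i / esym_quot A (l + j) x) / d%:R.
have GE (y : I -> R) : \sum_(i in A) G i * y i =
    (\sum_j (\sum_(i in A) g j i * y i) / esym_quot A (l + j) x) / d%:R.
  under [in RHS]eq_bigr => j _ do rewrite mulr_suml.
  rewrite exchange_big /= mulr_suml; apply: eq_bigr => i iA.
  rewrite /G mulrAC mulr_suml; congr (_ / _); apply: eq_bigr => j _.
  by rewrite mulrAC.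
exists G; split => [i||y yk].
- rewrite divr_ge0 // sumr_ge0 // => j _; rewrite divr_ge0 //; last exact: ltW (q0 _ _ xk).
  by have [] := gP j.
- rewrite GE; under eq_bigr => j _.
    have [_ -> _] := gP j; rewrite divff ?gt_eqF ?q0 //.
    over.
  by rewrite sumr_const card_ord divff // pnatr_eq0 -lt0n.
have le1 (j : 'I_d) : esym_quot A (l + j) y / esym_quot A (l + j) x <=
    (\sum_(i in A) g j i * y i) / esym_quot A (l + j) x.
  rewrite ler_pM2r ?invr_gt0 ?q0 //; have [_ _] := gP j; apply.
  by apply: garding_coneW yk; apply: ltnW.
have le2 : (\sum_(j < d) esym_quot A (l + j) y / esym_quot A (l + j) x) / d%:R <=
    \sum_(i in A) G i * y i.
  by rewrite GE ler_pM2r ?invr_gt0 ?ltr0n //; apply: ler_sum => j _; apply: le1.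
have pos : 0 < (\sum_(j < d) esym_quot A (l + j) y / esym_quot A (l + j) x) / d%:R.
  rewrite divr_gt0 ?ltr0n // (bigD1 (Ordinal d0)) //= ltr_pwDl //.
    exact: divr_gt0 (q0 y (Ordinal d0) yk) (q0 x (Ordinal d0) xk).
  by apply: sumr_ge0 => j _; rewrite divr_ge0 // ltW ?q0.
split; first exact: lt_le_trans pos le2.
rewrite !esym_ratio_prod ?(ltnW lk) // -/d.
have -> : \prod_(j < d) esym_quot A (l + j) y =
    \prod_(j < d) esym_quot A (l + j) x *
    \prod_(j < d) (esym_quot A (l + j) y / esym_quot A (l + j) x).
  rewrite -big_split /=; apply: eq_bigr => j _.
  by rewrite mulrCA divff ?mulr1 // gt_eqF ?q0.
rewrite ler_pM2l; last by apply: prodr_gt0 => j _; apply: q0.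
have := @leif_AGM R 'I_d predT
  (fun j => esym_quot A (l + j) y / esym_quot A (l + j) x).
rewrite cardT size_enum_ord => /(_ _)[]; first by move=> j _; rewrite divr_ge0 // ltW ?q0.
move=> + _; move=> /le_trans; apply.
by rewrite lerXn2r // nnegrE ltW // (lt_le_trans pos).
Qed.

(** * Rearrangement by doubly stochastic matrices *)

(* [v] interpolates a concave function with slope [g i] at [m i]. *)
Lemma antitone_potential (R : realType) (T : finType) (g m : T -> R) :
  (forall i j, (g i - g j) * (m i - m j) <= 0) ->
  exists v : T -> R, forall i j, v j - v i <= g i * (m j - m i).
Proof.
move=> anti.
suff H (A : {set T}) : exists v : T -> R,
    {in A &, forall i j, v j - v i <= g i * (m j - m i)}.
  by have [v vP] := H [set: T]; exists v => i j; apply: vP; rewrite inE.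
have [n An] := ubnP #|A|; elim: n A An => // n IHn A An.
have [->|[i0 i0A]] := set_0Vmem A; first by exists (fun=> 0) => i j; rewrite inE.
(* Since [g] and [m] are oppositely ordered, maximizing [m - g] finds an index with both the largest
   [m] and the smallest [g]. It is split off, and its value will be the lowest of the other tangent
   lines at [m w]. *)
have [w wA wmax] := arg_maxP (fun i => m i - g i) i0A.
have mw i : i \in A -> m i <= m w.
  by move=> iA; have := wmax i iA; have := anti i w => /=; nra.
have gw i : i \in A -> g w <= g i.
  by move=> iA; have := wmax i iA; have := anti i w => /=; nra.
have [v vP] : exists v : T -> R,
    {in A :\ w &, forall i j, v j - v i <= g i * (m j - m i)}.
  by apply: IHn; rewrite (cardsD1 w) [w \in A]wA in An.
have [A0|[i1 i1A]] := set_0Vmem (A :\ w).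
  have Aw i : i \in A -> i = w.
    move=> iA; apply/eqP; apply: contraT => iw.
    by have := in_set0 i; rewrite -A0 !inE iw iA.
  by exists (fun=> 0) => i j /Aw -> /Aw ->; rewrite !subrr mulr0.
have [i2 i2A i2min] := arg_minP (fun i => v i + g i * (m w - m i)) i1A.
exists (fun i => if i == w then v i2 + g i2 * (m w - m i2) else v i) => i j iA jA.
have inD x : x \in A -> x != w -> x \in A :\ w by rewrite !inE => -> ->.
have /setD1P[_ i2A'] := i2A.
have [->|iw] := eqVneq i w; have [->|jw] := eqVneq j w.
- by rewrite !subrr mulr0.
- have := vP i2 j i2A (inD _ jA jw); have := gw _ i2A'; have := mw _ jA; nra.
- by have := i2min i (inD _ iA iw); rewrite lerBlDl.
- exact: vP (inD _ iA iw) (inD _ jA jw).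
Qed.

(** A permutation minimizing the left side orders [g] and [mu \o s] oppositely, as transpositions
    show. The potential [v] is then a dual certificate: its differences bound the increments
    [g i * (m j - m i)] from below, and they cancel against the row and column sums of [D]. *)
Lemma doubly_stochastic_perm (R : realType) (T : finType) (g mu : T -> R)
  (D : T -> T -> R) :
  (forall i j, 0 <= D i j) -> (forall i, \sum_j D i j = 1) ->
  (forall j, \sum_i D i j = 1) ->
  exists s : {perm T},
    \sum_i g i * mu (s i) <= \sum_i g i * \sum_j D i j * mu j.
Proof.
move=> D0 Drow Dcol.
have [s _ smin] :=
  @arg_minP _ _ _ (1%g : {perm T}) predT (fun s => \sum_i g i * mu (s i)) isT.
exists s; pose m i := mu (s i).
have anti i j : (g i - g j) * (m i - m j) <= 0.
  have [->|ij] := eqVneq i j; first by rewrite !subrr mulr0.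
  have := smin (tperm i j * s)%g isT; rewrite /= -/(m _).
  rewrite (bigD1 i) //= [X in _ + X](bigD1 j) 1?eq_sym //=.
  rewrite [X in _ <= X -> _](bigD1 i) //= [X in _ <= _ + X -> _](bigD1 j) 1?eq_sym //=.
  rewrite !permM tpermL tpermR -!/(m _).
  rewrite [X in _ <= _ + (_ + X)](eq_bigr (fun k => g k * mu (s k))); last first.
    move=> k /andP[ki kj]; rewrite permM tpermD // eq_sym //.
  by set S := \sum_(_ | _) _; nra.
have [v vP] := antitone_potential anti.
have Ds i : \sum_j D i (s j) = 1 by rewrite -(Drow i) [RHS](reindex_perm s).
rewrite -subr_ge0 -sumrB.
have -> : \sum_i (g i * (\sum_j D i j * mu j) - g i * mu (s i)) =
    \sum_i \sum_j D i (s j) * (g i * (m j - m i)).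
  apply: eq_bigr => i _; rewrite (reindex_perm s) /= -mulrBr.
  under [RHS]eq_bigr => j _ do rewrite mulrCA.
  rewrite -mulr_sumr; congr (_ * _).
  under [RHS]eq_bigr => j _ do rewrite mulrBr.
  rewrite sumrB -mulr_suml; congr (_ - _).
  by rewrite Ds mul1r.
have vv : \sum_i \sum_j D i (s j) * (v j - v i) = 0.
  under eq_bigr => i _.
    under eq_bigr => j _ do rewrite mulrBr.
    rewrite sumrB -mulr_suml Ds mul1r.
    over.
  rewrite sumrB exchange_big /=.
  under eq_bigr => j _ do rewrite -mulr_suml Dcol mul1r.
  by rewrite subrr.
apply: (@le_trans _ _ (\sum_i \sum_j D i (s j) * (v j - v i))); first by rewrite vv.
apply: ler_sum => i _; apply: ler_sum => j _.
by rewrite ler_wpM2l.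
Qed.

(** * The operator in terms of eigenvalues *)

Lemma esym_gt0 (R : realType) (I : finType) (A : {set I}) m (mu : I -> R) :
  {in A, forall i, 0 < mu i} -> (m <= #|A|)%N -> 0 < esym A m mu.
Proof.
move=> mu0 mA; have : (0 < #|[set T : {set I} | T \subset A & #|T| == m]|)%N.
  by rewrite cards_draws bin_gt0.
move=> /card_gt0P[T]; rewrite inE => TP; rewrite /esym (bigD1 T) //=.
have pos (S : {set I}) : S \subset A -> 0 < \prod_(i in S) mu i.
  by move=> /fintype.subsetP SA; apply: prodr_gt0 => i /SA/mu0.
rewrite ltr_pwDl ?pos //; first by case/andP: TP.
by apply: sumr_ge0 => S /andP[/andP[/pos/ltW]].
Qed.

(** Both sides are coefficients of one product over the [P]-subsets, reindexed by [S |-> s @: S]. *)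
Lemma sigmaL_perm (R : realType) n P m (lam : 'I_n -> R) (s : {perm 'I_n}) :
  sigmaL P m (fun i => lam (s i)) = sigmaL P m lam.
Proof.
rewrite /sigmaL -!coef_prod_esym.
rewrite [in RHS](reindex (fun S : {set 'I_n} => s @: S)) /=; last first.
  exists (fun S : {set 'I_n} => (s^-1)%g @: S) => S _; rewrite -imset_comp.
    by rewrite (eq_imset (g := id)) ?imset_id // => i /=; rewrite permK.
  by rewrite (eq_imset (g := id)) ?imset_id // => i /=; rewrite permKV.
set p := \prod_(_ in _) _; set q := \prod_(_ | _) _; suff -> : p = q by [].
apply: eq_big => S; first by rewrite !inE card_imset //; apply: perm_inj.
move=> _; rewrite /LambdaP [in RHS]big_imset //=.
by move=> i j _ _; apply: perm_inj.
Qed.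

Lemma inGamma_perm (R : realType) n P k (lam : 'I_n -> R) (s : {perm 'I_n}) :
  inGamma P k lam -> inGamma P k (fun i => lam (s i)).
Proof. by move=> lk j jk; rewrite sigmaL_perm; apply: lk. Qed.

Lemma card_PSets n P : #|PSets n P| = 'C(n, P).
Proof. by rewrite /PSets card_draws card_ord. Qed.

Lemma LambdaP1 (R : realType) n P (S : {set 'I_n}) :
  S \in PSets n P -> LambdaP (fun=> 1 : R) S = P%:R.
Proof. by rewrite inE /LambdaP sumr_const => /eqP ->. Qed.

Lemma sigmaL1_gt0 (R : realType) n P m : (0 < P)%N -> (m <= 'C(n, P))%N ->
  0 < sigmaL P m (fun _ : 'I_n => 1 : R).
Proof.
move=> P0 mN; apply: esym_gt0; last by rewrite card_PSets.
by move=> S SP; rewrite (LambdaP1 _ SP) ltr0n.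
Qed.

Lemma inGamma1 (R : realType) n P k : (0 < P)%N -> (k <= 'C(n, P))%N ->
  inGamma P k (fun _ : 'I_n => 1 : R).
Proof.
by move=> P0 kN j /andP[_ jk]; apply: sigmaL1_gt0 => //; apply: leq_trans kN.
Qed.

Definition ratioL (R : realType) n P k l (lam : 'I_n -> R) : R :=
  sigmaL P k lam / sigmaL P l lam.

Lemma ratioL_gt0 (R : realType) n P k l (lam : 'I_n -> R) :
  (l <= k)%N -> inGamma P k lam -> 0 < ratioL P k l lam.
Proof.
by move=> lk lamk; rewrite divr_gt0 //; apply: (garding_cone_gt0 lamk).
Qed.

(** The weight of a coordinate is the total weight of the multi-indices containing it. Summed over
    all coordinates, each multi-index is counted [P >= 2] times, but for a single coordinate at most
    once; hence the third clause. *)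
Lemma ratioL_supergradient (R : realType) n P k l (lam : 'I_n -> R) :
  (1 < P)%N -> (l < k)%N -> inGamma P k lam ->
  exists g : 'I_n -> R, [/\ forall i, 0 <= g i, \sum_i g i * lam i = 1,
    forall j, 2 * g j <= \sum_i g i &
    forall mu, inGamma P k mu -> 0 < \sum_i g i * mu i /\
      ratioL P k l mu <= ratioL P k l lam * (\sum_i g i * mu i) ^+ (k - l)].
Proof.
move=> P1 lk lamk.
have [G [G0 Glam Gmu]] := esym_ratio_supergradient (A := PSets n P) lk lamk.
pose g i : R := \sum_(S in PSets n P | i \in S) G S.
have gE (mu : 'I_n -> R) :
    \sum_i g i * mu i = \sum_(S in PSets n P) G S * LambdaP mu S.
  under eq_bigr => i _ do rewrite mulr_suml.
  rewrite (exchange_big_dep (fun S => S \in PSets n P)) /=; last by move=> ? ? _ /andP[].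
  by apply: eq_bigr => S SP; rewrite /LambdaP mulr_sumr; apply: eq_bigl => i; rewrite SP.
exists g; split => [i|||mu muk].
- exact: sumr_ge0.
- by rewrite gE.
- move=> j; have -> : \sum_i g i = \sum_(S in PSets n P) P%:R * G S.
    transitivity (\sum_i g i * 1); first by apply: eq_bigr => i _; rewrite mulr1.
    rewrite (gE (fun=> 1)); apply: eq_bigr => S SP.
    by rewrite (LambdaP1 _ SP) mulrC.
  rewrite /g mulr_sumr [leRHS](bigID (fun S : {set _} => j \in S)) /= ler_wpDr //.
    by apply: sumr_ge0 => S _; rewrite mulr_ge0.
  by apply: ler_sum => S _; rewrite ler_wpM2r // ler_nat.
- by rewrite gE; apply: Gmu.
Qed.

(** Intended for [mu] the eigenvalues and [b] the diagonal of a symmetric matrix. Some reordering of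
    [mu] pairs with [g] to at most what [b] does, and the operator is blind to the ordering. *)
Lemma ratioL_doubly_stochastic (R : realType) n P k l (lam : 'I_n -> R) :
  (1 < P)%N -> (l < k)%N -> inGamma P k lam ->
  exists g : 'I_n -> R, [/\ forall i, 0 <= g i, \sum_i g i * lam i = 1,
    forall j, 2 * g j <= \sum_i g i &
    forall (mu b : 'I_n -> R) (D : 'I_n -> 'I_n -> R),
      inGamma P k mu ->
      (forall i j, 0 <= D i j) -> (forall i, \sum_j D i j = 1) ->
      (forall j, \sum_i D i j = 1) -> (forall i, b i = \sum_j D i j * mu j) ->
      0 < \sum_i g i * b i /\
      ratioL P k l mu <= ratioL P k l lam * (\sum_i g i * b i) ^+ (k - l)].
Proof.
move=> P1 lk lamk; have [g [g0 glam g2 gmu]] := ratioL_supergradient P1 lk lamk.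
exists g; split => // mu b D muk D0 Dr Dc bE.
have [s sP] := doubly_stochastic_perm g mu D0 Dr Dc.
have [s0 sle] := gmu _ (inGamma_perm s muk).
have le : \sum_i g i * mu (s i) <= \sum_i g i * b i.
  by apply: le_trans sP _; apply: ler_sum => i _; rewrite bE.
split; first exact: lt_le_trans s0 le.
rewrite /ratioL -!(sigmaL_perm P _ mu s); apply: le_trans sle _.
rewrite ler_wpM2l ?(ltW (ratioL_gt0 (ltnW lk) lamk)) //.
by rewrite lerXn2r // nnegrE ltW // (lt_le_trans s0).
Qed.

(** * Euclidean geometry and the real spectral theorem *)

Lemma dotvC (R : realType) m (x y : 'rV[R]_m) : dotv x y = dotv y x.
Proof. by apply: eq_bigr => i _; rewrite mulrC. Qed.

Lemma dotvDl (R : realType) m (x y z : 'rV[R]_m) :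
  dotv (x + y) z = dotv x z + dotv y z.
Proof. by rewrite -big_split; apply: eq_bigr => i _; rewrite mxE mulrDl. Qed.

Lemma dotvZl (R : realType) m (a : R) (x z : 'rV[R]_m) :
  dotv (a *: x) z = a * dotv x z.
Proof. by rewrite /dotv mulr_sumr; apply: eq_bigr => i _; rewrite mxE mulrA. Qed.

Lemma dotvDr (R : realType) m (x y z : 'rV[R]_m) :
  dotv z (x + y) = dotv z x + dotv z y.
Proof. by rewrite dotvC dotvDl !(dotvC z). Qed.

Lemma dotvZr (R : realType) m (a : R) (x z : 'rV[R]_m) :
  dotv z (a *: x) = a * dotv z x.
Proof. by rewrite dotvC dotvZl (dotvC z). Qed.

Lemma dotvNl (R : realType) m (x z : 'rV[R]_m) : dotv (- x) z = - dotv x z.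
Proof. by rewrite -scaleN1r dotvZl mulN1r. Qed.

Lemma dotvNr (R : realType) m (x z : 'rV[R]_m) : dotv z (- x) = - dotv z x.
Proof. by rewrite dotvC dotvNl (dotvC z). Qed.

Lemma dotv_delta (R : realType) m (x : 'rV[R]_m) i : dotv (delta_mx 0 i) x = x 0 i.
Proof.
rewrite /dotv (bigD1 i) //= big1 ?addr0; last first.
  by move=> j ji; rewrite mxE (negPf ji) andbF mul0r.
by rewrite mxE !eqxx mul1r.
Qed.

Lemma dotv_ge0 (R : realType) m (x : 'rV[R]_m) : 0 <= dotv x x.
Proof. by apply: sumr_ge0 => i _; rewrite -expr2 sqr_ge0. Qed.

Lemma dotv_eq0 (R : realType) m (x : 'rV[R]_m) : (dotv x x == 0) = (x == 0).
Proof.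
apply/eqP/eqP => [/eqP|->]; last by rewrite -(scale0r 0) dotvZl mul0r.
rewrite psumr_eq0; last by move=> i _; rewrite -expr2 sqr_ge0.
move=> /allP H; apply/rowP => i; rewrite mxE.
by have := H i (mem_index_enum _); rewrite -expr2 sqrf_eq0 => /eqP.
Qed.

Lemma dotv_gt0 (R : realType) m (x : 'rV[R]_m) : (0 < dotv x x) = (x != 0).
Proof. by rewrite lt0r dotv_ge0 andbT dotv_eq0. Qed.

Lemma mulmx_trE (R : realType) m p q (A : 'M[R]_(p, m)) (B : 'M[R]_(q, m)) i j :
  (A *m B^T) i j = dotv (row i A) (row j B).
Proof. by rewrite mxE; apply: eq_bigr => k _; rewrite !mxE. Qed.

Lemma sphere_neq0 (R : realType) n (x : 'rV[R]_n.+1) : sphere n x -> x != 0.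
Proof. by rewrite /sphere /= -dotv_gt0 => ->; exact: ltr01. Qed.

(* The images of the coordinate vectors under the reflection that exchanges
   [x] and the first coordinate vector. *)
Lemma tframe_exists (R : realType) n (x : 'rV[R]_n.+1) :
  sphere n x -> exists e, tframe x e.
Proof.
rewrite /sphere /= => xx; pose d (i : 'I_n.+1) : 'rV[R]_n.+1 := delta_mx 0 i.
have dd i j : dotv (d i) (d j) = (i == j)%:R by rewrite dotv_delta mxE eqxx.
have l0 (i : 'I_n) : (lift ord0 i == ord0) = false by rewrite -(inj_eq val_inj).
have [x0|x0] := eqVneq x (d ord0).
  exists (fun i => d (lift ord0 i)); split => [i j|i].
    by rewrite dd (inj_eq lift_inj).
  by rewrite x0 dd l0.
have [v vE] : exists v : 'rV[R]_n.+1, v = x - d ord0 by exists (x - d ord0).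
have vv : 0 < dotv v v by rewrite dotv_gt0 vE subr_eq0.
have xd : dotv x (d ord0) = x 0 ord0 by rewrite dotvC /d dotv_delta.
have vvE : dotv v v = 2 - 2 * x 0 ord0.
  rewrite vE !(dotvDl, dotvDr, dotvNl, dotvNr) xx dd eqxx (dotvC _ x) xd.
  by rewrite mulr1n; lra.
pose h (y : 'rV[R]_n.+1) := y - (2 * dotv v y / dotv v v) *: v.
have hh (y z : 'rV[R]_n.+1) : dotv (h y) (h z) = dotv y z.
  rewrite /h !(dotvDl, dotvDr, dotvNl, dotvNr, dotvZl, dotvZr) (dotvC y v).
  by field; rewrite gt_eqF.
have hx : h (d ord0) = x.
  rewrite /h; have -> : 2 * dotv v (d ord0) / dotv v v = -1.
    rewrite vvE vE dotvDl dotvNl dd eqxx xd mulr1n.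
    by field; move: vv; rewrite vvE => /gt_eqF/negbT.
  by rewrite scaleN1r opprK vE addrC subrK.
exists (fun i => h (d (lift ord0 i))); split => [i j|i].
  by rewrite hh dd (inj_eq lift_inj).
by rewrite -hx hh dd l0.
Qed.

(** * Continuity of scalar products and compactness of the sphere *)

Lemma continuous_sum_for (R : realType) (T : topologicalType) (I : finType)
  (F : I -> T -> R) (t : T) : (forall i, {for t, continuous (F i)}) ->
  {for t, continuous (fun s => \sum_i F i s)}.
Proof.
move=> cF; rewrite /prop_for /continuous_at.
by apply: cvg_big => [|i _]; [exact: add_continuous|exact: cF].
Qed.

Lemma continuousM_for (R : realType) (T : topologicalType) (f g : T -> R) (t : T) :
  {for t, continuous f} -> {for t, continuous g} ->
  {for t, continuous (fun s => f s * g s)}.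
Proof. exact: cvgM. Qed.

Lemma continuous_dotv (R : realType) (T : topologicalType) m
  (f g : T -> 'rV[R]_m) (t : T) :
  {for t, continuous f} -> {for t, continuous g} ->
  {for t, continuous (fun s => dotv (f s) (g s))}.
Proof.
move=> cf cg; apply: continuous_sum_for => i; apply: cvgM.
  exact: (cvg_comp _ _ cf (@coord_continuous _ _ _ 0 i (f t))).
exact: (cvg_comp _ _ cg (@coord_continuous _ _ _ 0 i (g t))).
Qed.

Lemma continuous_dotvv (R : realType) m : continuous (fun x : 'rV[R]_m => dotv x x).
Proof. by move=> x; apply: continuous_dotv. Qed.

Lemma sphere_compact (R : realType) n : compact (@sphere R n).
Proof.
apply: bounded_closed_compact.
  exists 1; split => // M M1 x /= xx; apply: le_trans (ltW M1).
  rewrite /Num.norm /= mx_normrE; apply: bigmax_le => // -[i j] _ /=.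
  rewrite -(ler_pXn2r (n := 2)) ?nnegrE // expr1n real_normK ?num_real //.
  rewrite ord1 -xx /dotv (bigD1 j) //= -expr2 lerDl.
  by apply: sumr_ge0 => k _; rewrite -expr2 sqr_ge0.
apply: (@closed_comp _ _ (fun x : 'rV[R]_n.+1 => dotv x x) [set 1 : R]%classic).
  by move=> x _; apply: continuous_dotvv.
by apply: accessible_closed_set1; apply: hausdorff_accessible; exact: Rhausdorff.
Qed.

Lemma sphere_nonempty (R : realType) n : (@sphere R n !=set0)%classic.
Proof. by exists (delta_mx 0 ord0); rewrite /sphere /= dotv_delta mxE !eqxx. Qed.

(** * The real spectral theorem *)

Lemma mulmx_tr_dotv (R : realType) m (A : 'M[R]_m) (x y : 'rV[R]_m) :
  A^T = A -> dotv (x *m A) y = dotv x (y *m A).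
Proof.
move=> As; suff E (a b : 'rV[R]_m) : dotv a b = (a *m b^T) 0 0.
  by rewrite !E -mulmxA trmx_mul As.
by rewrite mulmx_trE; congr dotv; apply/rowP => i; rewrite !mxE.
Qed.

(* At a maximum of the Rayleigh quotient, [t |-> f (x + t e) / |x + t e|^2]
   is stationary. *)
Lemma rayleigh_eigenvector (R : realType) n (A : 'M[R]_n.+1) :
  A^T = A -> exists2 x, sphere n x &
    forall e, dotv e x = 0 -> dotv (x *m A) e = 0.
Proof.
move=> As; pose f (x : 'rV[R]_n.+1) := dotv (x *m A) x.
have cf : continuous f.
  have -> : f = fun y => \sum_j dotv y (row j A) * y 0 j.
    apply/boolp.funext => y; apply: eq_bigr => j _; congr (_ * _).
    by rewrite -{1}As mxE; apply: eq_bigr => k _; rewrite !mxE.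
  move=> x; apply: (@continuous_sum_for R 'rV[R]_n.+1 _
    (fun j y => dotv y (row j A) * y 0 j) x) => j.
  apply: (@continuousM_for R 'rV[R]_n.+1 (fun y => dotv y (row j A)) (fun y => y 0 j)).
    apply: (@continuous_dotv R 'rV[R]_n.+1 _ (fun y => y) (fun=> row j A) x).
      exact: cvg_id.
    exact: cst_continuous.
  exact: coord_continuous.
have [x xS xmax] := compact_EVT_max (@sphere_nonempty R n) (@sphere_compact R n)
  (continuous_subspaceT cf).
move/set_mem: xS => xS; exists x => // e ex.
have fmax y : f y <= f x * dotv y y.
  have [->|y0] := eqVneq y 0; first by rewrite /f mul0mx -(scale0r 0) !dotvZl !mul0r mulr0.
  pose r := Num.sqrt (dotv y y).
  have yy : 0 < dotv y y by rewrite dotv_gt0.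
  have r2 : r ^+ 2 = dotv y y by rewrite sqr_sqrtr ?dotv_ge0.
  have r0 : 0 < r by rewrite sqrtr_gt0.
  have /xmax : (r^-1 *: y) \in @sphere R n.
    apply: mem_set; rewrite /sphere /= dotvZl dotvZr -r2; field.
    by rewrite gt_eqF.
  rewrite {1}/f -scalemxAl dotvZl dotvZr -/(f y) mulrA -invfM -expr2 r2 mulrC.
  by rewrite ler_pdivrMr.
set b := dotv (x *m A) e.
have quad t : 2 * t * b <= t ^+ 2 * (f x * dotv e e - f e).
  have := fmax (x + t *: e); rewrite {1}/f mulmxDl -scalemxAl.
  rewrite !(dotvDl, dotvDr, dotvZl, dotvZr) [dotv x e]dotvC ex xS.
  rewrite [dotv (e *m A) x]mulmx_tr_dotv // [dotv e _]dotvC -/b -/(f x) -/(f e).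
  by rewrite !mulr0; nra.
set c := f x * dotv e e - f e in quad.
(* At [t = b / (|c| + 1)] the quadratic inequality reads [2 t^2 (|c| + 1) <= t^2 c], which forces
   [t = 0] and so [b = 0]. *)
have := quad (b / (`|c| + 1)); have c1 : 0 < `|c| + 1 by rewrite ltr_wpDl.
have cc : c <= `|c| by rewrite ler_norm.
set u := b / _; have bu : b = u * (`|c| + 1) by rewrite mulfVK // gt_eqF.
move=> H; have u0 : u ^+ 2 <= 0 by rewrite bu in H; nra.
have /eqP : u ^+ 2 = 0 by apply/le_anti; rewrite u0 sqr_ge0.
by rewrite sqrf_eq0 => /eqP u00; rewrite bu u00 mul0r.
Qed.

Lemma tframe_orthogonal (R : realType) n (x : 'rV[R]_n.+1) e :
  sphere n x -> tframe x e ->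
  let Q : 'M[R]_(1 + n, 1 + n) := col_mx x (\matrix_i e i) in Q *m Q^T = 1%:M.
Proof.
move=> xS [ee ex] Q; rewrite tr_col_mx mul_col_row (scalar_mx_block 1 n 1).
congr block_mx.
- by apply/matrixP => i j; rewrite !ord1 mulmx_trE !row_id xS mxE eqxx.
- apply/matrixP => i j; rewrite mulmx_trE rowK ord1 row_id dotvC ex.
  by rewrite mxE.
- by apply/matrixP => i j; rewrite mulmx_trE rowK ord1 row_id ex mxE.
- by apply/matrixP => i j; rewrite mulmx_trE !rowK ee mxE.
Qed.

Lemma tframe_expand (R : realType) n (x v : 'rV[R]_n.+1) e :
  sphere n x -> tframe x e -> dotv v x = 0 -> v = \sum_i dotv (e i) v *: e i.
Proof.
move=> xS xe vx; have := mulmx1C (tframe_orthogonal xS xe).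
set E := \matrix_i e i => QQ; rewrite -[LHS]mulmx1 -QQ mulmxA tr_col_mx.
rewrite mul_mx_row mul_row_col.
have -> : v *m x^T = 0.
  by apply/matrixP => i j; rewrite !ord1 mulmx_trE !row_id vx mxE.
rewrite mul0mx add0r mulmx_sum_row; apply: eq_bigr => i _.
by rewrite rowK mulmx_trE row_id rowK dotvC.
Qed.

(** Deflation: the compression of [A] to the orthogonal complement of a Rayleigh maximizer is
    symmetric and one size smaller, and its diagonalization is completed by the maximizer. *)
Lemma real_spectral (R : realType) n (A : 'M[R]_n) : A^T = A ->
  exists (Q : 'M[R]_n) (d : 'rV[R]_n),
    Q *m Q^T = 1%:M /\ A = Q^T *m diag_mx d *m Q.
Proof.
elim: n A => [|n IHn] A As.
  exists 1%:M, 0; split; first by rewrite trmx1 mul1mx.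
  by apply/matrixP => -[].
have [x xS xA] := rayleigh_eigenvector As.
have [e xe] := tframe_exists xS; have [ee ex] := xe.
pose E : 'M[R]_(n, n.+1) := \matrix_i e i.
pose Q0 : 'M[R]_(1 + n, 1 + n) := col_mx x E.
have Q0Q : Q0 *m Q0^T = 1%:M := tframe_orthogonal xS xe.
have Q0Q' : Q0^T *m Q0 = 1%:M by apply: mulmx1C.
pose A' : 'M[R]_n := E *m A *m E^T.
have A's : A'^T = A' by rewrite /A' !trmx_mul trmxK As mulmxA.
have [Q' [d' [Q'Q AE]]] := IHn A' A's.
pose lam : 'M[R]_(1, 1) := x *m A *m x^T.
have xAE : x *m A *m E^T = 0.
  by apply/matrixP => i j; rewrite mulmx_trE rowK ord1 row_id xA ?ex // mxE.
have QAQ : Q0 *m A *m Q0^T = block_mx lam 0 0 A'.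
  rewrite tr_col_mx mul_col_mx mul_col_row; congr block_mx => //.
  by apply: trmx_inj; rewrite !trmx_mul trmxK As mulmxA xAE trmx0.
pose S : 'M[R]_(1 + n, 1 + n) := block_mx 1%:M 0 0 Q'.
have SS : S *m S^T = 1%:M.
  rewrite tr_block_mx !trmx0 trmx1 mulmx_block !(mulmx0, mul0mx) addr0 add0r.
  by rewrite mulmx1 Q'Q !add0r -(scalar_mx_block 1 n 1).
exists (S *m Q0), (row_mx lam d'); split.
  by rewrite trmx_mul mulmxA -(mulmxA S) Q0Q mulmx1.
have : A = Q0^T *m (Q0 *m A *m Q0^T) *m Q0.
  by rewrite !mulmxA Q0Q' mul1mx -mulmxA Q0Q' mulmx1.
move=> {1}->; rewrite QAQ trmx_mul -!mulmxA; congr (_ *m _).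
rewrite !mulmxA; congr (_ *m _).
have DE : diag_mx (row_mx lam d') =
    block_mx (diag_mx lam) 0 0 (diag_mx d') :> 'M[R]_(1 + n) := diag_mx_row _ _.
have ST : S^T = block_mx 1%:M 0 0 Q'^T by rewrite tr_block_mx !trmx0 trmx1.
have : S^T *m block_mx (diag_mx lam) 0 0 (diag_mx d') *m S = block_mx lam 0 0 A'.
  rewrite ST !mulmx_block !(mulmx0, mul0mx, mulmx1, mul1mx, addr0, add0r) -AE.
  by congr block_mx; apply/matrixP => i j; rewrite !ord1 !mxE.
by move=> <-; rewrite -DE.
Qed.

Lemma orthogonal_eigvals (R : realType) n (Q : 'M[R]_n) (d : 'rV[R]_n) :
  Q *m Q^T = 1%:M -> eigvals (Q^T *m diag_mx d *m Q) (d 0).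
Proof.
move=> QQ; have QQ' : Q^T *m Q = 1%:M by apply: mulmx1C.
rewrite /eigvals /char_poly /char_poly_mx.
have -> : 'X%:M - map_mx polyC (Q^T *m diag_mx d *m Q) =
    map_mx polyC Q^T *m ('X%:M - map_mx polyC (diag_mx d)) *m map_mx polyC Q.
  rewrite mulmxBr mulmxBl -!map_mxM; congr (_ - _).
  by rewrite scalar_mxC -mulmxA -map_mxM QQ' map_mx1 mulmx1.
rewrite !det_mulmx mulrAC -det_mulmx -map_mxM QQ' map_mx1 det1 mul1r.
have := @char_poly_trig R n (diag_mx d) (diag_mx_is_trig d).
rewrite /char_poly /char_poly_mx => ->.
by apply: eq_bigr => i _; rewrite mxE eqxx mulr1n.
Qed.

(** The squared entries of an orthogonal matrix form a doubly stochastic matrix, so the diagonal of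
    [B] is a doubly stochastic average of its eigenvalues. The fourth clause is the same comparison
    at the identity matrix; it will bound the total weight from below. *)
Lemma ratioL_matrix (R : realType) n P k l (lam : 'I_n -> R) :
  (1 < P)%N -> (l < k <= 'C(n, P))%N -> inGamma P k lam ->
  exists g : 'I_n -> R, [/\ forall i, 0 <= g i, \sum_i g i * lam i = 1,
    forall j, 2 * g j <= \sum_i g i,
    ratioL P k l (fun _ : 'I_n => 1) <= ratioL P k l lam * (\sum_i g i) ^+ (k - l) &
    forall B : 'M[R]_n, B^T = B ->
      (forall mu, eigvals B mu -> inGamma P k mu) ->
      exists mu, [/\ eigvals B mu, 0 < \sum_i g i * B i i &
        ratioL P k l mu <= ratioL P k l lam * (\sum_i g i * B i i) ^+ (k - l)]].
Proof.
move=> P1 /andP[lk kN] lamk.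
have [g [g0 glam g2 gmu]] := ratioL_doubly_stochastic P1 lk lamk.
exists g; split => //.
  have sum_delta (i : 'I_n) : \sum_j (i == j)%:R = 1 :> R.
    rewrite (bigD1 i) //= eqxx big1 ?addr0 // => j.
    by rewrite eq_sym => /negPf ->.
  have [] := gmu (fun=> 1) (fun=> 1) (fun i j => (i == j)%:R).
  - exact: inGamma1 (ltnW P1) kN.
  - by move=> i j; rewrite ler0n.
  - exact: sum_delta.
  - by move=> j; under eq_bigr => i _ do rewrite eq_sym; apply: sum_delta.
  - by move=> i; under eq_bigr => j _ do rewrite mulr1; rewrite sum_delta.
  by move=> _; under [in X in X -> _]eq_bigr => i _ do rewrite mulr1.
move=> B Bs Bk; have [Q [d [QQ BE]]] := real_spectral Bs.
have QQ' : Q^T *m Q = 1%:M by apply: mulmx1C.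
have dB : eigvals B (d 0) by rewrite BE; apply: orthogonal_eigvals.
exists (d 0); have [] // := gmu (d 0) (fun i => B i i) (fun i j => Q j i ^+ 2) (Bk _ dB).
- by move=> i j; apply: sqr_ge0.
- move=> i; have : (Q^T *m Q) i i = 1 by rewrite QQ' mxE eqxx.
  rewrite mxE => <-.
  by apply: eq_bigr => j _; rewrite !mxE expr2.
- move=> j; have : (Q *m Q^T) j j = 1 by rewrite QQ mxE eqxx.
  rewrite mxE => <-.
  by apply: eq_bigr => i _; rewrite !mxE expr2.
move=> i; rewrite BE mul_mx_diag mxE; apply: eq_bigr => j _; rewrite !mxE.
by rewrite mulrAC expr2.
Qed.

(** * Directional derivatives of [C^k] functions *)

Lemma continuousD_for (R : realType) (T : topologicalType) (f g : T -> R) (t : T) :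
  {for t, continuous f} -> {for t, continuous g} ->
  {for t, continuous (fun s => f s + g s)}.
Proof. exact: cvgD. Qed.

Lemma continuous_for_dist (R : realType) (T : topologicalType) (f : T -> R) (t : T) :
  (forall eps : R, 0 < eps -> \forall s \near t, `|f t - f s| < eps) ->
  {for t, continuous f}.
Proof. by move=> H; apply/cvgrPdist_lt. Qed.

Lemma eq_continuous_for (R : realType) (T : topologicalType) (f g : T -> R) (t : T) :
  (\forall s \near t, f s = g s) -> {for t, continuous f} -> {for t, continuous g}.
Proof.
move=> fg cf; rewrite /prop_for /continuous_at -(nbhs_singleton fg).
by apply: cvg_trans cf; apply: near_eq_cvg.
Qed.

Lemma growth_rate_line (R : realType) m (f : 'rV[R]_m -> R) (x v : 'rV[R]_m) (t : R) :
  (fun h : R => h^-1 *: (((fun s : R => f (x + s *: v)) \o shift t) (h *: (1 : R)) -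
     f (x + t *: v))) =
  (fun h : R => h^-1 *: ((f \o shift (x + t *: v)) (h *: v) - f (x + t *: v))).
Proof.
apply/boolp.funext => h /=; congr (_ *: (f _ - _)).
by rewrite /shift /= scalerDl addrCA; congr (_ + _); rewrite /GRing.scale /= mulr1.
Qed.

Lemma is_derive_line (R : realType) m (f : 'rV[R]_m -> R) (x v : 'rV[R]_m) (t : R) :
  derivable f (x + t *: v) v ->
  is_derive t 1 (fun s : R => f (x + s *: v)) ('D_v f (x + t *: v)).
Proof.
move=> df; apply: DeriveDef.
  by rewrite /derivable growth_rate_line.
by rewrite /derive growth_rate_line.
Qed.

Lemma derivable_line (R : realType) m (f : 'rV[R]_m -> R) (x v : 'rV[R]_m) :
  derivable (fun s : R => f (x + s *: v)) 0 1 -> derivable f x v.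
Proof. by rewrite /derivable growth_rate_line scale0r addr0. Qed.

Lemma is_derive_of_line (R : realType) m (f : 'rV[R]_m -> R) (x v : 'rV[R]_m) (a : R) :
  is_derive (0 : R) 1 (fun s : R => f (x + s *: v)) a -> is_derive x v f a.
Proof.
move=> [df Df]; apply: DeriveDef; first exact: derivable_line.
by rewrite -Df /derive growth_rate_line scale0r addr0.
Qed.

Lemma nbhs_square (R : realType) m (x v w : 'rV[R]_m) (W : set 'rV[R]_m) :
  nbhs x W -> exists2 d : R, 0 < d &
    forall a b : R, `|a| <= d -> `|b| <= d -> W (x + a *: v + b *: w).
Proof.
move=> /nbhs_ballP[e /= e0 eW]; pose M := `|v| + `|w| + 1.
have M0 : 0 < M by rewrite ltr_wpDl // addr_ge0.
exists (e / 2 / M); first by rewrite !divr_gt0.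
move=> a b ad bd; apply: eW; rewrite -ball_normE /ball_ /=.
rewrite opprD addrA opprD addrA subrr sub0r -opprD normrN.
apply: le_lt_trans (ler_normD _ _) _; rewrite !normrZ.
apply: (@le_lt_trans _ _ (e / 2 / M * `|v| + e / 2 / M * `|w|)).
  by apply: lerD; apply: ler_wpM2r.
rewrite -mulrDr; apply: (@le_lt_trans _ _ (e / 2 / M * M)).
  by rewrite ler_wpM2l ?ltW ?divr_gt0 // /M ltrDl.
by rewrite divfK ?gt_eqF //; lra.
Qed.

Lemma nbhs_segment (R : realType) m (x v : 'rV[R]_m) (W : set 'rV[R]_m) :
  nbhs x W -> \forall t \near (0 : R), W (x + t *: v).
Proof.
move=> /(@nbhs_square R m x v 0)[d d0 dW]; near=> t.
have := dW t 0; rewrite scaler0 addr0; apply; last by rewrite normr0 ltW.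
by rewrite ltW //; near: t; exact: nbhs0_lt.
Unshelve. all: by end_near.
Qed.

Lemma isCk_derivable (R : realType) m k (f : 'rV[R]_m -> R) (U : set 'rV[R]_m) x v :
  isCk k.+1 f U -> U x -> derivable f x v.
Proof. by case=> df _ Ux; apply: df. Qed.

Lemma isCk_derive (R : realType) m k (f : 'rV[R]_m -> R) (U : set 'rV[R]_m) v :
  isCk k.+1 f U -> isCk k ('D_v f) U.
Proof. by case=> _; apply. Qed.

Lemma MVT_line (R : realType) m (f : 'rV[R]_m -> R) (x v : 'rV[R]_m) (t : R) :
  0 < t -> (forall s, 0 <= s <= t -> derivable f (x + s *: v) v) ->
  exists2 s, 0 < s < t & f (x + t *: v) - f x = t * 'D_v f (x + s *: v).
Proof.
move=> t0 df.
have [||s] := @MVT R (fun s => f (x + s *: v)) (fun s => 'D_v f (x + s *: v)) 0 t t0.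
- move=> s /itvP s0t; apply: is_derive_line; apply: df.
  by rewrite !(ltW, s0t).
- apply: derivable_within_continuous => s /itvP s0t.
  by have [] := is_derive_line (df s _); rewrite ?s0t.
move=> /itvP s0t E; exists s; first by rewrite !s0t.
by rewrite scale0r addr0 subr0 mulrC in E; rewrite -E.
Qed.

Lemma MVT_line_le (R : realType) m (f : 'rV[R]_m -> R) (x v : 'rV[R]_m) (t M : R) :
  (forall s, `|s| <= `|t| -> derivable f (x + s *: v) v) ->
  (forall s, `|s| <= `|t| -> `|'D_v f (x + s *: v)| <= M) ->
  `|f (x + t *: v) - f x| <= `|t| * M.
Proof.
have H (y : 'rV[R]_m) s : 0 < s ->
    (forall r, 0 <= r <= s -> derivable f (y + r *: v) v) ->
    (forall r, 0 <= r <= s -> `|'D_v f (y + r *: v)| <= M) ->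
    `|f (y + s *: v) - f y| <= s * M.
  move=> s0 df Df; have [r /andP[r0 rs] ->] := MVT_line s0 df.
  by rewrite normrM gtr0_norm // ler_pM2l // Df // !ltW.
move=> df Df; have [t0|t0|->] := ltgtP t 0; last first.
- by rewrite scale0r addr0 subrr !normr0 mul0r.
- rewrite (gtr0_norm t0); apply: H => // r /andP[r0 rt].
    by apply: df; rewrite !ger0_norm // ltW.
  by apply: Df; rewrite !ger0_norm // ltW.
rewrite (ltr0_norm t0) distrC.
have E r : x + t *: v + r *: v = x + (t + r) *: v by rewrite scalerDl addrA.
have := H (x + t *: v) (- t); rewrite E subrr scale0r addr0; apply.
- by rewrite oppr_gt0.
- move=> r /andP[r0 rt]; rewrite E; apply: df.
  by rewrite !ler0_norm //; lra.
- move=> r /andP[r0 rt]; rewrite E; apply: Df.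
  by rewrite !ler0_norm //; lra.
Qed.

(** [isCk] speaks only of derivatives along lines. Passing from [x] to [z] one coordinate at a time,
    the mean value theorem bounds each increment by locally bounded partial derivatives. *)
Lemma isC1_continuous (R : realType) m (f : 'rV[R]_m -> R) (U : set 'rV[R]_m) x :
  open U -> isCk 1 f U -> U x -> {for x, continuous f}.
Proof.
move=> oU [df cDf] Ux; pose d (i : 'I_m) : 'rV[R]_m := delta_mx 0 i.
pose M : R := \sum_i (`|'D_(d i) f x| + 1).
have M0 : 0 <= M by apply: sumr_ge0 => i _; rewrite addr_ge0.
have near_bound : \forall y \near x, U y /\ forall i, `|'D_(d i) f y| <= M.
  near=> y; split; first by near: y; apply: open_nbhs_nbhs.
  move=> i; apply: (@le_trans _ _ (`|'D_(d i) f x| + 1)); last first.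
    by rewrite /M (bigD1 i) //= lerDl sumr_ge0 // => j _; rewrite addr_ge0.
  rewrite -[in leLHS](subrK ('D_(d i) f x) ('D_(d i) f y)) addrC.
  apply: le_trans (ler_normD _ _) _; rewrite lerD2l distrC ltW //.
  move: i; near: y; apply: filter_forall => i.
  by have /cvgrPdist_lt := cDf (d i) x Ux; apply.
have /nbhs_ballP[e /= e0 eB] := near_bound.
apply: continuous_for_dist => eps eps0; near=> z.
pose y k : 'rV[R]_m := \row_j (if (j < k)%N then z 0 j else x 0 j).
have zx : `|z - x| < e.
  near: z; apply: filterS (nbhsx_ballx x e e0) => z.
  by rewrite -ball_normE /ball_ /= distrC.
have zx_small : `|z - x| * (m%:R * M + 1) < eps.
  rewrite -ltr_pdivlMr ?ltr_wpDl ?mulr_ge0 //; near: z.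
  have d0 : 0 < eps / (m%:R * M + 1) by rewrite divr_gt0 // ltr_wpDl ?mulr_ge0.
  apply: filterS (nbhsx_ballx x _ d0) => z.
  by rewrite -ball_normE /ball_ /= distrC.
have zxj j : `|z 0 j - x 0 j| <= `|z - x|.
  rewrite [leRHS]/Num.norm /= mx_normrE.
  by apply: (le_trans _ (le_bigmax _ _ (0, j))); rewrite /= !mxE.
have step k (km : (k < m)%N) : `|f (y k.+1) - f (y k)| <= `|z - x| * M.
  pose i := Ordinal km.
  have -> : y k.+1 = y k + (z 0 i - x 0 i) *: d i.
    apply/rowP => j; rewrite !mxE eqxx /= -(inj_eq val_inj) /= ltnS leq_eqVlt.
    have [jk|jk] := eqVneq (j : nat) k; last by rewrite mulr0 addr0.
    by rewrite jk ltnn mulr1 (_ : j = i) 1?addrC ?subrK //; apply: val_inj.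
  have inB s : `|s| <= `|z 0 i - x 0 i| -> ball x e (y k + s *: d i).
    move=> sz; rewrite -ball_normE /ball_ /= distrC.
    apply: le_lt_trans zx; rewrite {1}/Num.norm /= mx_normrE.
    apply: bigmax_le => [|[i' j] _]; first exact: normr_ge0.
    rewrite /= !mxE ord1 eqxx /= -(inj_eq val_inj) /=.
    have [jk|jk] := eqVneq (j : nat) k.
      rewrite jk ltnn mulr1 addrAC subrr add0r (le_trans sz) //.
    rewrite mulr0 addr0; case: ifP => _; first exact: zxj.
    by rewrite subrr normr0.
  apply: le_trans (_ : `|z 0 i - x 0 i| * M <= _); last first.
    by rewrite ler_wpM2r.
  apply: MVT_line_le => s /inB/eB[Uy Dy]; first exact: df.
  exact: Dy.
have tele k : (k <= m)%N -> `|f (y k) - f x| <= k%:R * (`|z - x| * M).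
  elim: k => [_|k IHk km].
    have -> : y 0%N = x by apply/rowP => j; rewrite mxE.
    by rewrite subrr normr0 mul0r.
  have -> : f (y k.+1) - f x = (f (y k.+1) - f (y k)) + (f (y k) - f x) by lra.
  apply: le_trans (ler_normD _ _) _; rewrite -natr1 mulrDl mul1r addrC.
  by apply: lerD; [apply: IHk; apply: ltnW|apply: step].
have -> : z = y m by apply/rowP => j; rewrite mxE ltn_ord.
rewrite distrC; apply: le_lt_trans (tele m (leqnn _)) (le_lt_trans _ zx_small).
by rewrite mulrCA ler_wpM2l // lerDl.
Unshelve. all: by end_near.
Qed.

Lemma isCk_continuous (R : realType) m k (f : 'rV[R]_m -> R) (U : set 'rV[R]_m) x :
  open U -> isCk k f U -> U x -> {for x, continuous f}.
Proof.
elim: k f x => [|k IHk] f x oU; first by move=> cf Ux; apply: cf.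
move=> [df cD] Ux; apply: (isC1_continuous oU) => //; split => // v y Uy.
exact: IHk (cD v) Uy.
Qed.

Lemma isCk_le (R : realType) m j k (f : 'rV[R]_m -> R) (U : set 'rV[R]_m) :
  open U -> (j <= k)%N -> isCk k f U -> isCk j f U.
Proof.
move=> oU; elim: j k f => [|j IHj] k f.
  by move=> _ fk x; apply: isCk_continuous fk.
by case: k => // k jk [df cD]; split => // v; apply: IHj (cD v).
Qed.

Lemma eq_isCk (R : realType) m k (f g : 'rV[R]_m -> R) (U : set 'rV[R]_m) :
  open U -> (forall x, U x -> f x = g x) -> isCk k f U -> isCk k g U.
Proof.
move=> oU; elim: k f g => [|k IHk] f g fg.
  move=> cf x Ux; apply: (@eq_continuous_for R _ f) (cf x Ux).
  by near=> y; rewrite fg //; near: y; apply: open_nbhs_nbhs.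
have nfg x : U x -> \forall y \near x, f y = g y.
  by move=> Ux; near=> y; rewrite fg //; near: y; apply: open_nbhs_nbhs.
move=> [df cD]; split => [x v Ux|v].
  by apply: near_eq_derivable (df x v Ux); apply: nfg.
by apply: IHk (cD v) => x Ux; apply: near_eq_derive; apply: nfg.
Unshelve. all: by end_near.
Qed.

Lemma isCkD (R : realType) m k (f g : 'rV[R]_m -> R) (U : set 'rV[R]_m) :
  open U -> isCk k f U -> isCk k g U -> isCk k (fun x => f x + g x) U.
Proof.
move=> oU; elim: k f g => [|k IHk] f g.
  by move=> cf cg x Ux; apply: continuousD_for; [apply: cf|apply: cg].
move=> [df cf] [dg cg]; split => [x v Ux|v].
  by apply: derivableD; [apply: df|apply: dg].
apply: (eq_isCk oU _ (IHk _ _ (cf v) (cg v))) => x Ux.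
by rewrite deriveD //; [apply: df|apply: dg].
Qed.

Lemma isCkM (R : realType) m k (f g : 'rV[R]_m -> R) (U : set 'rV[R]_m) :
  open U -> isCk k f U -> isCk k g U -> isCk k (fun x => f x * g x) U.
Proof.
move=> oU; elim: k f g => [|k IHk] f g.
  by move=> cf cg x Ux; apply: continuousM_for; [apply: cf|apply: cg].
move=> fk gk; have [df cf] := fk; have [dg cg] := gk; split => [x v Ux|v].
  by apply: derivableM; [apply: df|apply: dg].
have fk' := isCk_le oU (leqnSn k) fk; have gk' := isCk_le oU (leqnSn k) gk.
apply: (eq_isCk oU _ (isCkD oU (IHk _ _ fk' (cg v)) (IHk _ _ gk' (cf v)))) => x Ux.
by rewrite deriveM //; [apply: df|apply: dg].
Qed.

Lemma isCk_cst (R : realType) m k (a : R) (U : set 'rV[R]_m) :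
  isCk k (fun=> a) U.
Proof.
elim: k a => [|k IHk] a; first by move=> x _; apply: cst_continuous.
split => [x v _|v]; first exact: derivable_cst.
suff -> : 'D_v (fun=> a) = (fun _ : 'rV[R]_m => 0 : R) by [].
by apply/boolp.funext => x; apply: derive_cst.
Qed.

(** * Symmetry of second derivatives and linearity in the direction *)

Lemma is_derive_translate (R : realType) m (f : 'rV[R]_m -> R) (x v c : 'rV[R]_m) :
  derivable f (x + c) v -> is_derive x v (fun z => f (z + c)) ('D_v f (x + c)).
Proof.
move=> df; apply: is_derive_of_line.
have -> : (fun s : R => f (x + s *: v + c)) = (fun s => f (x + c + s *: v)).
  by apply/boolp.funext => s; rewrite addrAC.
by have := @is_derive_line R m f (x + c) v 0; rewrite scale0r addr0; apply.
Qed.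

(** The double difference is symmetric in [v] and [w], while each order of two mean value steps
    turns it into a different mixed derivative at a nearby point; this yields [hessC]. *)
Lemma second_difference (R : realType) m (f : 'rV[R]_m -> R) (U : set 'rV[R]_m)
  (x v w : 'rV[R]_m) (t : R) : isCk 2 f U -> 0 < t ->
  (forall a b, 0 <= a <= t -> 0 <= b <= t -> U (x + a *: v + b *: w)) ->
  exists a b, [/\ 0 < a < t, 0 < b < t &
    f (x + t *: v + t *: w) - f (x + t *: v) - (f (x + t *: w) - f x) =
    t * (t * 'D_w ('D_v f) (x + a *: v + b *: w))].
Proof.
move=> f2 t0 UU; have [df cD] := f2; have [dDf _] := cD v.
have tt : 0 <= t <= t by rewrite lexx ltW.
have z0 : 0 <= (0 : R) <= t by rewrite lexx ltW.
pose g y := f (y + t *: w) - f y.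
have dg s : 0 <= s <= t -> is_derive (x + s *: v) v g
    ('D_v f (x + s *: v + t *: w) - 'D_v f (x + s *: v)).
  move=> st; apply: is_deriveB.
    by apply: is_derive_translate; apply: df; apply: UU.
  apply: derivableP; apply: df.
  by have := UU s 0 st z0; rewrite scale0r addr0.
have [a a0t E] := @MVT_line R m g x v t t0
  (fun s st => @ex_derive _ _ _ _ _ _ _ (dg s st)).
have aw : 0 <= a <= t by move/andP: a0t => [/ltW-> /ltW->].
have [b b0t E'] := @MVT_line R m ('D_v f) (x + a *: v) w t t0
  (fun s st => dDf _ w (UU a s aw st)).
exists a, b; split => //.
by rewrite -E' -(@derive_val _ _ _ _ _ _ _ (dg a aw)) -E /g.
Qed.

(** Mean value theorems give identities between values at nearby but different points; continuity
    moves all of them to [x]. *)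
Lemma continuous_eqD (R : realType) (T : topologicalType) (f g h : T -> R) (x : T) :
  {for x, continuous f} -> {for x, continuous g} -> {for x, continuous h} ->
  (forall W : set T, nbhs x W ->
     exists p q r, [/\ W p, W q, W r & f p = g q + h r]) ->
  f x = g x + h x.
Proof.
move=> cf cg ch H; apply/eqP; rewrite -subr_eq0 -normr_eq0; apply/negPn/negP => d0.
set d := `|_| in d0; have d1 : 0 < d by rewrite lt0r d0 normr_ge0.
have e0 : 0 < d / 3 by rewrite divr_gt0.
pose W y := [/\ `|f x - f y| < d / 3, `|g x - g y| < d / 3 & `|h x - h y| < d / 3].
have nW : nbhs x W.
  have /cvgrPdist_lt/(_ _ e0) Hf := cf.
  have /cvgrPdist_lt/(_ _ e0) Hg := cg.
  have /cvgrPdist_lt/(_ _ e0) Hh := ch.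
  near=> y; split; [near: y; exact: Hf|near: y; exact: Hg|near: y; exact: Hh].
have [p [q [r [[Hp _ _] [_ Hq _] [_ _ Hr] E]]]] := H W nW.
have : d < d.
  rewrite {1}/d; have -> : f x - (g x + h x) =
    (f x - f p) - (g x - g q) - (h x - h r) by rewrite E; lra.
  apply: le_lt_trans (ler_normB _ _) _; apply: le_lt_trans (lerD (ler_normB _ _) (lexx _)) _.
  lra.
by rewrite ltxx.
Unshelve. all: by end_near.
Qed.

Lemma hessC (R : realType) m (f : 'rV[R]_m -> R) (U : set 'rV[R]_m) (x v w : 'rV[R]_m) :
  open U -> isCk 2 f U -> U x -> hess f x v w = hess f x w v.
Proof.
move=> oU f2 Ux; rewrite /hess.
have c2 a b : {for x, continuous ('D_a ('D_b f))} by case: f2 => _ /(_ b)[_ /(_ a)]; apply.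
rewrite -[RHS]addr0; apply: (@continuous_eqD R 'rV[R]_m ('D_v ('D_w f)) ('D_w ('D_v f))
  (fun=> 0) x) => //.
  exact: cst_continuous.
move=> W nW; have nUW : nbhs x (U `&` W)%classic.
  by apply: filterI => //; apply: open_nbhs_nbhs.
have [d d0 dW] := @nbhs_square R m x w v _ nUW.
have H a : 0 <= a <= d -> `|a| <= d by move=> /andP[a0 ad]; rewrite ger0_norm.
have H' a : 0 < a < d -> `|a| <= d by move=> /andP[/ltW a0 /ltW ad]; rewrite ger0_norm.
have [|a [b [a0 b0 E]]] := @second_difference R m f U x w v d f2 d0.
  by move=> a b /H ad /H bd; have [] := dW a b ad bd.
have [|a' [b' [a0' b0' E']]] := @second_difference R m f U x v w d f2 d0.
  by move=> a' b' /H ad /H bd; rewrite addrAC; have [] := dW b' a' bd ad.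
exists (x + a *: w + b *: v), (x + a' *: v + b' *: w), x; split.
- by have [] := dW a b (H' _ a0) (H' _ b0).
- by rewrite addrAC; have [] := dW b' a' (H' _ b0') (H' _ a0').
- exact: nbhs_singleton nW.
rewrite addr0; apply: (mulfI (x := d)); first by rewrite gt_eqF.
apply: (mulfI (x := d)); first by rewrite gt_eqF.
have E0 : x + d *: w + d *: v = x + d *: v + d *: w by rewrite addrAC.
have G (p q r s A B : R) : p - q - (r - s) = A -> p - r - (q - s) = B -> A = B.
  by move=> <- <-; ring.
by rewrite E0 in E; exact: G E E'.
Qed.

Lemma derive_dirZ (R : realType) m (f : 'rV[R]_m -> R) (x v : 'rV[R]_m) (a : R) :
  derivable f x v -> 'D_(a *: v) f x = a * 'D_v f x.
Proof.
move=> df; apply: derive_val; apply: is_derive_of_line.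
have -> : (fun s : R => f (x + s *: (a *: v))) =
    (fun r : R => f (x + r *: v)) \o (fun s => s * a).
  by apply/boolp.funext => s; rewrite /= scalerA.
rewrite mulrC; apply: is_derive1_comp.
  rewrite mul0r; have := @is_derive_line R m f x v 0.
  by rewrite scale0r addr0; apply.
by apply: is_derive_eq; rewrite scaler0 add0r /GRing.scale /= mulr1.
Qed.

(** Additivity in the direction is not built into derivatives along lines. The increment along
    [v + w] is split into a step along [v] and one along [w], and the three mean values tend to the
    derivatives at [x]. *)
Lemma derive_dirD (R : realType) m (f : 'rV[R]_m -> R) (U : set 'rV[R]_m)
  (x v w : 'rV[R]_m) : open U -> isCk 1 f U -> U x ->
  'D_(v + w) f x = 'D_v f x + 'D_w f x.
Proof.
move=> oU [df cD] Ux; apply: (@continuous_eqD R 'rV[R]_m ('D_(v + w) f) ('D_v f) ('D_w f) x);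
  [exact: cD|exact: cD|exact: cD|].
move=> W nW; have nUW : nbhs x (U `&` W)%classic.
  by apply: filterI => //; apply: open_nbhs_nbhs.
have [d d0 dW] := @nbhs_square R m x v w _ nUW.
have H a : 0 <= a <= d -> `|a| <= d by move=> /andP[a0 ad]; rewrite ger0_norm.
have H' a : 0 < a < d -> `|a| <= d by move=> /andP[/ltW a0 /ltW ad]; rewrite ger0_norm.
have dd : `|d| <= d by rewrite ger0_norm // ltW.
have z0 : `|0 : R| <= d by rewrite normr0 ltW.
have Ea s : x + s *: (v + w) = x + s *: v + s *: w by rewrite scalerDr addrA.
have Eb s : x + s *: v = x + s *: v + 0 *: w by rewrite scale0r addr0.
have [s|a a0 E1] := @MVT_line R m f x (v + w) d d0.
  by move=> /H sd; rewrite Ea; apply: df; have [] := dW s s sd sd.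
have [s|b b0 E2] := @MVT_line R m f (x + d *: v) w d d0.
  by move=> /H sd; apply: df; have [] := dW d s dd sd.
have [s|c c0 E3] := @MVT_line R m f x v d d0.
  by move=> /H sd; rewrite Eb; apply: df; have [] := dW s 0 sd z0.
exists (x + a *: (v + w)), (x + c *: v), (x + d *: v + b *: w); split.
- by rewrite Ea; have [] := dW a a (H' _ a0) (H' _ a0).
- by rewrite Eb; have [] := dW c 0 (H' _ c0) z0.
- by have [] := dW d b dd (H' _ b0).
apply: (mulfI (x := d)); first by rewrite gt_eqF.
by rewrite mulrDr -E1 -E2 -E3 Ea; lra.
Qed.

Lemma derive_dir_sum (R : realType) m (f : 'rV[R]_m -> R) (U : set 'rV[R]_m)
  (x : 'rV[R]_m) (I : finType) (a : I -> R) (v : I -> 'rV[R]_m) :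
  open U -> isCk 1 f U -> U x ->
  'D_(\sum_i a i *: v i) f x = \sum_i a i * 'D_(v i) f x.
Proof.
move=> oU f1 Ux; rewrite (@big_morph _ _ (fun v => 'D_v f x) 0 +%R 0 +%R).
- by apply: eq_bigr => i _; rewrite derive_dirZ //; apply: isCk_derivable f1 Ux.
- by move=> y z; rewrite (derive_dirD y z oU f1 Ux).
- exact: derive0.
Qed.

Lemma hess_sum (R : realType) m (f : 'rV[R]_m -> R) (U : set 'rV[R]_m)
  (x : 'rV[R]_m) (I J : finType) (a : I -> R) (v : I -> 'rV[R]_m)
  (b : J -> R) (w : J -> 'rV[R]_m) :
  open U -> isCk 2 f U -> U x ->
  hess f x (\sum_i a i *: v i) (\sum_j b j *: w j) =
  \sum_i \sum_j a i * b j * hess f x (v i) (w j).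
Proof.
move=> oU f2 Ux; rewrite /hess.
rewrite (derive_dir_sum a v oU (isCk_derive _ f2) Ux); apply: eq_bigr => i _.
rewrite -[X in _ * X]/(hess f x (v i) _) (hessC _ _ oU f2 Ux) /hess.
rewrite (derive_dir_sum b w oU (isCk_derive _ f2) Ux) mulr_sumr.
apply: eq_bigr => j _.
have E : 'D_(w j) ('D_(v i) f) x = 'D_(v i) ('D_(w j) f) x.
  exact: hessC (w j) (v i) oU f2 Ux.
by rewrite E mulrA.
Qed.

Lemma hessDl (R : realType) m (f : 'rV[R]_m -> R) (U : set 'rV[R]_m)
  (x v v' w : 'rV[R]_m) : open U -> isCk 2 f U -> U x ->
  hess f x (v + v') w = hess f x v w + hess f x v' w.
Proof. by move=> oU f2 Ux; exact: (derive_dirD _ _ oU (isCk_derive _ f2) Ux). Qed.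

Lemma hessDr (R : realType) m (f : 'rV[R]_m -> R) (U : set 'rV[R]_m)
  (x v v' w : 'rV[R]_m) : open U -> isCk 2 f U -> U x ->
  hess f x w (v + v') = hess f x w v + hess f x w v'.
Proof.
move=> oU f2 Ux; rewrite (hessC w (v + v') oU f2 Ux) (hessDl v v' w oU f2 Ux).
by rewrite (hessC v w oU f2 Ux) (hessC v' w oU f2 Ux).
Qed.

Lemma hessZl (R : realType) m (f : 'rV[R]_m -> R) (U : set 'rV[R]_m)
  (x v w : 'rV[R]_m) (a : R) : open U -> isCk 2 f U -> U x ->
  hess f x (a *: v) w = a * hess f x v w.
Proof.
move=> oU f2 Ux; apply: derive_dirZ.
exact: isCk_derivable (isCk_derive w f2) Ux.
Qed.

Lemma hessZr (R : realType) m (f : 'rV[R]_m -> R) (U : set 'rV[R]_m)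
  (x v w : 'rV[R]_m) (a : R) : open U -> isCk 2 f U -> U x ->
  hess f x w (a *: v) = a * hess f x w v.
Proof.
move=> oU f2 Ux; rewrite (hessC w (a *: v) oU f2 Ux) (hessZl v w a oU f2 Ux).
by rewrite (hessC v w oU f2 Ux).
Qed.

(** * Second-order jets at the origin *)

(** The second derivative is asked for at [0] alone: the second-derivative test uses no more, and
    the class stays closed under the operations below. *)
Definition jet2 (R : realType) (f : R -> R) (a b c : R) : Prop :=
  f 0 = a /\ exists f1 : R -> R,
    [/\ \forall t \near (0 : R), is_derive (t : R) 1 f (f1 t), f1 0 = b &
        is_derive (0 : R) 1 f1 c].

Lemma jet2_line (R : realType) m (f : 'rV[R]_m -> R) (U : set 'rV[R]_m)
  (x v : 'rV[R]_m) : open U -> isCk 2 f U -> U x ->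
  jet2 (fun t => f (x + t *: v)) (f x) ('D_v f x) ('D_v ('D_v f) x).
Proof.
move=> oU f2 Ux; split; first by rewrite scale0r addr0.
exists (fun t => 'D_v f (x + t *: v)); split; last 2 first.
- by rewrite scale0r addr0.
- have := @is_derive_line R m ('D_v f) x v 0; rewrite scale0r addr0; apply.
  exact: isCk_derivable (isCk_derive v f2) Ux.
have nU : nbhs x U by apply: open_nbhs_nbhs.
near=> t; have Ut : U (x + t *: v) by near: t; exact: nbhs_segment.
by apply: is_derive_line; exact: isCk_derivable f2 Ut.
Unshelve. all: by end_near.
Qed.

Lemma eq_jet2 (R : realType) (f g : R -> R) (a b c : R) :
  f =1 g -> jet2 f a b c -> jet2 g a b c.
Proof. by move=> /boolp.funext ->. Qed.

Lemma jet2_cst (R : realType) (a : R) : jet2 (fun=> a) a 0 0.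
Proof.
split => //; exists (fun=> 0); split => //; last exact: is_derive_cst.
by near=> t; apply: is_derive_cst.
Unshelve. all: by end_near.
Qed.

Lemma jet2_id (R : realType) : jet2 (fun t : R => t) 0 1 0.
Proof.
split => //; exists (fun=> 1); split => //; last exact: is_derive_cst.
by near=> t; apply: is_derive_id.
Unshelve. all: by end_near.
Qed.

Lemma jet2D (R : realType) (f g : R -> R) (a b c a' b' c' : R) :
  jet2 f a b c -> jet2 g a' b' c' ->
  jet2 (fun t => f t + g t) (a + a') (b + b') (c + c').
Proof.
move=> [<- [f1 [Hf <- cf]]] [<- [g1 [Hg <- cg]]]; split => //.
exists (fun t => f1 t + g1 t); split => //; last exact: is_deriveD.
by near=> t; apply: is_deriveD; near: t.
Unshelve. all: by end_near.
Qed.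

Lemma jet2M (R : realType) (f g : R -> R) (a b c a' b' c' : R) :
  jet2 f a b c -> jet2 g a' b' c' ->
  jet2 (fun t => f t * g t) (a * a') (a * b' + a' * b)
    (a * c' + 2 * b * b' + a' * c).
Proof.
move=> [<- [f1 [Hf <- cf]]] [<- [g1 [Hg <- cg]]]; split => //.
have df := nbhs_singleton Hf; have dg := nbhs_singleton Hg.
exists (fun t => f t * g1 t + g t * f1 t); split => //.
  by near=> t; apply: is_deriveM; near: t.
have := is_deriveD (is_deriveM df cg) (is_deriveM dg cf).
move=> H; apply: (is_derive_eq H); rewrite /GRing.scale /=; ring.
Unshelve. all: by end_near.
Qed.

Lemma jet2Z (R : realType) (k : R) (f : R -> R) (a b c : R) :
  jet2 f a b c -> jet2 (fun t => k * f t) (k * a) (k * b) (k * c).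
Proof.
move=> Hf; have := jet2M (jet2_cst k) Hf.
by rewrite !(mulr0, mul0r, addr0).
Qed.

Lemma jet2B (R : realType) (f g : R -> R) (a b c a' b' c' : R) :
  jet2 f a b c -> jet2 g a' b' c' ->
  jet2 (fun t => f t - g t) (a - a') (b - b') (c - c').
Proof.
move=> Hf /(jet2Z (-1)) Hg; have := jet2D Hf Hg; rewrite !mulN1r.
by apply: eq_jet2 => t; rewrite mulN1r.
Qed.

Lemma jet2_sum (R : realType) (I : finType) (f : I -> R -> R) (a b c : I -> R) :
  (forall i, jet2 (f i) (a i) (b i) (c i)) ->
  jet2 (fun t => \sum_i f i t) (\sum_i a i) (\sum_i b i) (\sum_i c i).
Proof.
move=> H; elim: (index_enum I) => [|i s IHs].
  by rewrite !big_nil; apply: eq_jet2 (jet2_cst 0) => t; rewrite big_nil.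
rewrite !big_cons; apply: eq_jet2 (jet2D (H i) IHs) => t.
by rewrite big_cons.
Qed.

Lemma near_gt0 (R : realType) (f : R -> R) (d : R) :
  is_derive (0 : R) 1 f d -> 0 < f 0 -> \forall t \near (0 : R), 0 < f t.
Proof.
move=> [df _] f0.
have /cvgrPdist_lt/(_ _ f0) : {for 0, continuous f}.
  by apply: differentiable_continuous; apply/derivable1_diffP.
apply: filterS => t; have := ler_norm (f 0 - f t); lra.
Qed.

Lemma jet2_ln (R : realType) (f : R -> R) (a b c : R) : 0 < a ->
  jet2 f a b c -> jet2 (fun t => ln (f t)) (ln a) (b / a) (c / a - (b / a) ^+ 2).
Proof.
move=> a0 [fa [f1 [Hf <- cf]]]; rewrite -fa in a0 *; split => //.
have df := nbhs_singleton Hf; have Hpos := near_gt0 df a0.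
exists (fun t => f1 t * (f t)^-1); split => //.
  near=> t; rewrite mulrC; apply: (@is_derive1_comp _ (@ln R) f).
    by apply: is_derive1_ln; near: t.
  by near: t.
have fN : f 0 != 0 by rewrite gt_eqF.
have := is_deriveM cf (is_deriveV fN df).
move=> H; apply: (is_derive_eq H); rewrite /GRing.scale /=; field.
by [].
Unshelve. all: by end_near.
Qed.

Lemma jet2V (R : realType) (f : R -> R) (a b c : R) : 0 < a ->
  jet2 f a b c ->
  jet2 (fun t => (f t)^-1) a^-1 (- (b / a ^+ 2)) (2 * b ^+ 2 / a ^+ 3 - c / a ^+ 2).
Proof.
move=> a0 [fa [f1 [Hf <- cf]]]; rewrite -fa in a0 *; split => //.
have df := nbhs_singleton Hf; have Hpos := near_gt0 df a0.
exists (fun t => - ((f t)^-1 * (f t)^-1) * f1 t); split => //.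
- near=> t; have fN : f t != 0 by rewrite gt_eqF //; near: t.
  have dt : is_derive t 1 f (f1 t) by near: t.
  apply: (is_derive_eq (is_deriveV fN dt)).
  by rewrite /GRing.scale /= -invfM expr2.
- by field; rewrite gt_eqF.
have fN : f 0 != 0 by rewrite gt_eqF.
have dV := is_deriveV fN df.
have H : is_derive (0 : R) 1 (fun t => - ((f t)^-1 * (f t)^-1) * f1 t)
    (- ((f 0)^-1 * (f 0)^-1) *: c + f1 0 *: - ((f 0)^-1 *: (- f 0 ^- 2 *: f1 0) +
      (f 0)^-1 *: (- f 0 ^- 2 *: f1 0))).
  exact: is_deriveM (is_deriveN (is_deriveM dV dV)) cf.
by apply: (is_derive_eq H); rewrite /GRing.scale /=; field.
Unshelve. all: by end_near.
Qed.

Lemma jet2_sqrt1 (R : realType) : jet2 (fun t : R => Num.sqrt (1 + t ^+ 2)) 1 0 1.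
Proof.
have pos (t : R) : 0 < 1 + t ^+ 2 by rewrite ltr_pwDl // sqr_ge0.
have d1 (t : R) : is_derive t 1 (fun t : R => Num.sqrt (1 + t ^+ 2))
    (t * (Num.sqrt (1 + t ^+ 2))^-1).
  have H : is_derive t 1 (fun t : R => 1 + t ^+ 2) (0 + (t *: 1 + t *: 1)).
    have H0 : is_derive t 1 (fun t : R => t * t) (t *: 1 + t *: 1).
      exact: is_deriveM (is_derive_id t 1) (is_derive_id t 1).
    have H1 := is_derive_cst (1 : R) t 1.
    exact (is_deriveD H1 H0).
  have H' := @is_derive1_comp R _ _ t _ _ (is_derive1_sqrt (pos t)) H.
  apply: (is_derive_eq H'); rewrite /GRing.scale /=; field.
  by rewrite gt_eqF // sqrtr_gt0.
split; first by rewrite expr0n addr0 sqrtr1.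
exists (fun t => t * (Num.sqrt (1 + t ^+ 2))^-1); split.
- by near=> t.
- by rewrite mul0r.
have r0 : Num.sqrt (1 + (0 : R) ^+ 2) != 0 by rewrite expr0n addr0 sqrtr1 oner_eq0.
have := is_deriveM (is_derive_id (0 : R) 1)
  (@is_deriveV R (fun t => Num.sqrt (1 + t ^+ 2)) 0 _ 1 r0 (d1 0)).
move=> H; apply: (is_derive_eq H).
by rewrite /GRing.scale /= !mul0r add0r expr0n addr0 sqrtr1 invr1 mulr1.
Unshelve. all: by end_near.
Qed.

Lemma jet2_min (R : realType) (f : R -> R) (a b c : R) :
  jet2 f a b c -> (\forall t \near (0 : R), a <= f t) -> b = 0 /\ 0 <= c.
Proof.
move=> [fa [f1 [Hf fb cf]]] fmin.
have nb : nbhs (0 : R) (fun t : R => is_derive t 1 f (f1 t) /\ a <= f t).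
  exact: filterI.
have /nbhs_ballP[d /= d0 dP] := nb.
have inB (t : R) : `|t| < d -> is_derive t 1 f (f1 t) /\ a <= f t.
  by move=> td; apply: dP; rewrite -ball_normE /ball_ /= sub0r normrN.
have itvB (t : R) : t \in `](- d), d[ -> `|t| < d by move=> /itvP ti; rewrite ltr_norml !ti.
have b0 : b = 0.
  have H : is_derive (0 : R) 1 f 0.
    apply: (@derive1_at_min R f (- d) d 0); first by lra.
    - by move=> t /itvB/inB[[]].
    - by rewrite in_itv /= oppr_lt0 d0.
    - by move=> t /itvB/inB[_]; rewrite fa.
  have := nbhs_singleton Hf; rewrite fb => -[_ <-].
  by case: H.
split => //; rewrite leNgt; apply/negP => c0.
have [df1 Df1] := cf.
(* If [c < 0], then [f1] is negative just to the right of [0], and the mean value theorem takes [f]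
   below its minimum. *)
have : \forall h \near dnbhs (0 : R), h^-1 *: ((f1 \o shift 0) (h *: (1 : R)) - f1 0) < 0.
  have H : (h^-1 *: ((f1 \o shift 0) (h *: (1 : R)) - f1 0) @[h --> dnbhs (0 : R)] --> c)%classic.
    by rewrite -Df1; exact: df1.
  have Nc : 0 < - c by rewrite oppr_gt0.
  have /cvgrPdist_lt/(_ _ Nc) := H; apply: filterS => h; rewrite distrC.
  by have := ler_norm (h^-1 *: ((f1 \o shift 0) (h *: (1 : R)) - f1 0) - c); lra.
rewrite /= near_withinE => /nbhs_ballP[e /= e0 eP].
pose t := Num.min d e / 2; have t0 : 0 < t by rewrite divr_gt0 // lt_min d0.
have td : t < d by rewrite /t /Order.min; case: ifP; lra.
have te : t < e by rewrite /t /Order.min; case: ifP; lra.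
have [||s /itvP st E] := @MVT R f f1 0 t t0.
- move=> s /itvP st; suff /inB[] : `|s| < d by [].
  by rewrite gtr0_norm ?st // (lt_trans _ td) // st.
- apply: derivable_within_continuous => s /itvP st.
  suff /inB[[]] : `|s| < d by [].
  by rewrite ger0_norm ?st // (le_lt_trans _ td) // st.
have s0 : 0 < s by rewrite st.
have : s^-1 *: ((f1 \o shift 0) (s *: (1 : R)) - f1 0) < 0.
  apply: eP; last by rewrite gt_eqF.
  by rewrite -ball_normE /ball_ /= sub0r normrN gtr0_norm // (lt_trans _ te) // st.
rewrite /shift /= addr0 fb b0 subr0 /GRing.scale /= mulr1 => sneg.
have f1s : f1 s < 0 by move: sneg; rewrite pmulr_rlt0 // invr_gt0.
have td' : `|t| < d by rewrite gtr0_norm.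
have [_ ft] := inB t td'; have : f1 s * t < 0 by rewrite nmulr_rlt0.
by rewrite subr0 in E; lra.
Qed.

(** * Homogeneous extensions *)

Definition eucl_norm (R : realType) m (x : 'rV[R]_m) : R := Num.sqrt (dotv x x).

Definition hom1 (R : realType) m (u : 'rV[R]_m -> R) (x : 'rV[R]_m) : R :=
  eucl_norm x * hext u x.

Definition punctured (R : realType) m : set 'rV[R]_m :=
  fun x => x != 0.
Arguments punctured {R m} _.

Lemma open_punctured (R : realType) m : open (@punctured R m).
Proof.
have -> : @punctured R m = (~` [set (0 : 'rV[R]_m)])%classic.
  by apply/boolp.funext => x; apply/boolp.propext; split => /eqP.
rewrite openC; apply: accessible_closed_set1; apply: hausdorff_accessible.
exact: norm_hausdorff.
Qed.

Lemma nbhs_punctured (R : realType) m (x : 'rV[R]_m) : x != 0 -> nbhs x punctured.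
Proof. by move=> x0; apply: open_nbhs_nbhs; split => //; apply: open_punctured. Qed.

Lemma eucl_norm_gt0 (R : realType) m (x : 'rV[R]_m) : (0 < eucl_norm x) = (x != 0).
Proof. by rewrite sqrtr_gt0 dotv_gt0. Qed.

Lemma eucl_norm_sqr (R : realType) m (x : 'rV[R]_m) : eucl_norm x ^+ 2 = dotv x x.
Proof. by rewrite sqr_sqrtr // dotv_ge0. Qed.

Lemma eucl_normZ (R : realType) m (x : 'rV[R]_m) (c : R) :
  0 <= c -> eucl_norm (c *: x) = c * eucl_norm x.
Proof.
move=> c0; rewrite /eucl_norm dotvZl dotvZr mulrA sqrtrM ?mulr_ge0 //.
by rewrite -expr2 sqrtr_sqr ger0_norm.
Qed.

Lemma eucl_norm_sphere (R : realType) n (x : 'rV[R]_n.+1) :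
  sphere n x -> eucl_norm x = 1.
Proof. by rewrite /sphere /eucl_norm /= => ->; rewrite sqrtr1. Qed.

Lemma sphere_normalize (R : realType) n (x : 'rV[R]_n.+1) :
  x != 0 -> sphere n ((eucl_norm x)^-1 *: x).
Proof.
move=> x0; rewrite /sphere /= dotvZl dotvZr -eucl_norm_sqr.
by field; rewrite gt_eqF // eucl_norm_gt0.
Qed.

Lemma is_derive_dotv (R : realType) m (x v w : 'rV[R]_m) :
  is_derive x v (fun y => dotv y w) (dotv v w).
Proof.
apply: is_derive_of_line.
have -> : (fun s : R => dotv (x + s *: v) w) = (fun s => dotv x w + s * dotv v w).
  by apply/boolp.funext => s; rewrite dotvDl dotvZl.
have H0 : is_derive (0 : R) 1 (fun s : R => s * dotv v w) (0 *: 0 + dotv v w *: 1).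
  exact: is_deriveM (is_derive_id (0 : R) 1) (is_derive_cst (dotv v w) (0 : R) 1).
have H1 := is_derive_cst (dotv x w) (0 : R) 1.
apply: (is_derive_eq (is_deriveD H1 H0)).
by rewrite /GRing.scale /= mul0r !add0r mulr1.
Qed.

Lemma is_derive_eucl_norm (R : realType) m (x v : 'rV[R]_m) :
  x != 0 -> is_derive x v (@eucl_norm R m) (dotv x v * (eucl_norm x)^-1).
Proof.
move=> x0; apply: is_derive_of_line; set A := dotv x v.
have E : (fun s : R => eucl_norm (x + s *: v)) =
    Num.sqrt \o (fun s => dotv x x + s * (2 * A + s * dotv v v)).
  apply/boolp.funext => s; rewrite /eucl_norm /=; congr Num.sqrt.
  by rewrite !(dotvDl, dotvDr, dotvZl, dotvZr) (dotvC v x) -/A; ring.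
rewrite E.
have Hi := is_derive_id (0 : R) 1.
have H0 : is_derive (0 : R) 1 (fun s : R => s * dotv v v) (0 *: 0 + dotv v v *: 1).
  exact: is_deriveM Hi (is_derive_cst (dotv v v) (0 : R) 1).
have H1 : is_derive (0 : R) 1 (fun s : R => 2 * A + s * dotv v v)
    (0 + (0 *: 0 + dotv v v *: 1)).
  exact (is_deriveD (is_derive_cst (2 * A) (0 : R) 1) H0).
have H2 : is_derive (0 : R) 1 (fun s : R => s * (2 * A + s * dotv v v))
    (0 *: (0 + (0 *: 0 + dotv v v *: 1)) + (2 * A + 0 * dotv v v) *: 1).
  exact (is_deriveM Hi H1).
have H3 : is_derive (0 : R) 1 (fun s : R => dotv x x + s * (2 * A + s * dotv v v))
    (0 + (0 *: (0 + (0 *: 0 + dotv v v *: 1)) + (2 * A + 0 * dotv v v) *: 1)).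
  exact (is_deriveD (is_derive_cst (dotv x x) (0 : R) 1) H2).
have pos : 0 < dotv x x + 0 * (2 * A + 0 * dotv v v) by rewrite mul0r addr0 dotv_gt0.
have H4 := @is_derive1_comp R _ _ 0 _ _ (is_derive1_sqrt pos) H3.
apply: (is_derive_eq H4); rewrite /GRing.scale /= !mul0r !addr0 !add0r mulr1 /eucl_norm.
by field; rewrite gt_eqF // sqrtr_gt0 dotv_gt0.
Qed.

Lemma isCk_dotv (R : realType) m k (w : 'rV[R]_m) (U : set 'rV[R]_m) :
  isCk k (fun y => dotv y w) U.
Proof.
case: k => [|k].
  move=> x _; apply: (@continuous_dotv R 'rV[R]_m m (fun y => y) (fun=> w) x).
    exact: cvg_id.
  exact: cst_continuous.
split => [x v _|v]; first by have [] := is_derive_dotv x v w.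
suff -> : 'D_v (fun y => dotv y w) = (fun _ : 'rV[R]_m => dotv v w).
  exact: isCk_cst.
by apply/boolp.funext => x; have [] := is_derive_dotv x v w.
Qed.

Lemma eucl_norm_continuous (R : realType) m (x : 'rV[R]_m) :
  {for x, continuous (@eucl_norm R m)}.
Proof.
apply: (@continuous_comp 'rV[R]_m R R (fun y => dotv y y) Num.sqrt x).
  exact: continuous_dotvv.
exact: sqrt_continuous.
Qed.

Lemma continuousV_for (R : realType) (T : topologicalType) (f : T -> R) (t : T) :
  f t != 0 -> {for t, continuous f} -> {for t, continuous (fun s => (f s)^-1)}.
Proof. exact: cvgV. Qed.

Lemma is_derive_eucl_normV (R : realType) m (x v : 'rV[R]_m) : x != 0 ->
  is_derive x v (fun y => (eucl_norm y)^-1)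
    (- (dotv x v) * ((eucl_norm x)^-1 * (eucl_norm x)^-1 * (eucl_norm x)^-1)).
Proof.
move=> x0; have nx : eucl_norm x != 0 by rewrite gt_eqF // eucl_norm_gt0.
have H := is_derive_eucl_norm v x0.
have dn : derivable (@eucl_norm R m) x v by case: H.
apply: DeriveDef; first exact: derivableV.
rewrite (deriveV nx dn) (@derive_val _ _ _ _ _ _ _ H) /GRing.scale /=.
by field.
Qed.

Lemma isCk_eucl_normV (R : realType) m k :
  isCk k (fun y : 'rV[R]_m => (eucl_norm y)^-1) punctured.
Proof.
elim: k => [|k IHk].
  move=> x x0; apply: continuousV_for; last exact: eucl_norm_continuous.
  by rewrite gt_eqF // eucl_norm_gt0.
have oP := @open_punctured R m.
split => [x v x0|v]; first by have [] := is_derive_eucl_normV v x0.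
apply: (@eq_isCk R m k (fun x => dotv x (- v) *
  ((eucl_norm x)^-1 * (eucl_norm x)^-1 * (eucl_norm x)^-1))) => //.
  by move=> x x0; rewrite (@derive_val _ _ _ _ _ _ _ (is_derive_eucl_normV v x0)) dotvNr.
by apply: isCkM => //; [exact: isCk_dotv|do 2 apply: isCkM => //].
Qed.

Lemma isCk_eucl_norm (R : realType) m k : isCk k (@eucl_norm R m) punctured.
Proof.
have oP := @open_punctured R m.
apply: (@isCk_le R m k k.+1) => //; split => [x v x0|v].
  by have [] := is_derive_eucl_norm v x0.
apply: (@eq_isCk R m k (fun x => dotv x v * (eucl_norm x)^-1)) => //.
  by move=> x x0; rewrite (@derive_val _ _ _ _ _ _ _ (is_derive_eucl_norm v x0)).
by apply: isCkM => //; [exact: isCk_dotv|exact: isCk_eucl_normV].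
Qed.

Lemma CkS_isCk (R : realType) n k (u : 'rV[R]_n.+1 -> R) :
  CkS k u -> isCk k (hext u) punctured.
Proof. by []. Qed.

Lemma isCk_hom1 (R : realType) n k (u : 'rV[R]_n.+1 -> R) :
  CkS k u -> isCk k (hom1 u) punctured.
Proof.
by move=> uk; apply: isCkM => //; [exact: open_punctured|exact: isCk_eucl_norm].
Qed.

Lemma hext_sphere (R : realType) n (u : 'rV[R]_n.+1 -> R) (x : 'rV[R]_n.+1) :
  sphere n x -> hext u x = u x.
Proof. by rewrite /sphere /hext /= => ->; rewrite sqrtr1 invr1 scale1r. Qed.

Lemma hextZ (R : realType) m (u : 'rV[R]_m -> R) (x : 'rV[R]_m) (c : R) :
  0 < c -> hext u (c *: x) = hext u x.
Proof.
move=> c0; rewrite /hext -!/(eucl_norm _) eucl_normZ ?ltW // scalerA; congr u.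
have [->|x0] := eqVneq x 0; first by rewrite !scaler0.
by congr (_ *: _); field; rewrite !gt_eqF // eucl_norm_gt0.
Qed.

Lemma hom1Z (R : realType) m (u : 'rV[R]_m -> R) (x : 'rV[R]_m) (c : R) :
  0 < c -> hom1 u (c *: x) = c * hom1 u x.
Proof. by move=> c0; rewrite /hom1 hextZ // eucl_normZ ?ltW // mulrA. Qed.

Lemma hom1_sphere (R : realType) n (u : 'rV[R]_n.+1 -> R) (x : 'rV[R]_n.+1) :
  sphere n x -> hom1 u x = u x.
Proof. by move=> xS; rewrite /hom1 hext_sphere // eucl_norm_sphere // mul1r. Qed.

(** The factor [s] stays free instead of being a power of [c]: it is [c] for [hom1 u], and [1] for
    [hext u] and for the first derivatives of [hom1 u]. *)
Lemma derive_homogeneous (R : realType) m (f : 'rV[R]_m -> R) (x v : 'rV[R]_m) (c s : R) :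
  0 < c -> (forall y : 'rV[R]_m, y != 0 -> f (c *: y) = s * f y) -> x != 0 ->
  derivable f x v -> 'D_v f (c *: x) = s / c * 'D_v f x.
Proof.
move=> c0 fs x0 df; apply: derive_val; apply: is_derive_of_line.
apply: (@near_eq_is_derive R R R
  (fun t : R => s * ((fun r => f (x + r *: v)) \o (fun t => t * c^-1)) t)).
  have nz : \forall t \near (0 : R), x + t *: (c^-1 *: v) != 0.
    exact: (@nbhs_segment R m x (c^-1 *: v) punctured) (nbhs_punctured x0).
  near=> t; rewrite /= -fs.
    by rewrite scalerDr !scalerA mulrCA divff ?gt_eqF // mulr1.
  by rewrite -scalerA; near: t.
have H1 : is_derive (0 : R) 1 (fun t : R => t * c^-1) (0 *: 0 + c^-1 *: 1).
  exact: is_deriveM (is_derive_id (0 : R) 1) (is_derive_cst c^-1 (0 : R) 1).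
have H2 : is_derive ((0 : R) * c^-1) 1 (fun r => f (x + r *: v)) ('D_v f x).
  by have := @is_derive_line R m f x v (0 * c^-1); rewrite mul0r scale0r addr0; apply.
have H3 := @is_derive1_comp R _ _ 0 _ _ H2 H1.
have H4 := is_deriveM (is_derive_cst s (0 : R) 1) H3.
apply: (is_derive_eq H4); rewrite /GRing.scale /= mul0r add0r mulr1 mulr0 addr0.
by rewrite mulrA mulrAC.
Unshelve. all: by end_near.
Qed.

Lemma derive_radial (R : realType) m (f : 'rV[R]_m -> R) (x : 'rV[R]_m) :
  (forall c : R, 0 < c -> f (c *: x) = f x) -> 'D_x f x = 0.
Proof.
move=> fc; apply: derive_val; apply: is_derive_of_line.
apply: (@near_eq_is_derive R R R (fun=> f x)).
near=> t; rewrite -[in RHS](scale1r x) scalerA mulr1 -scalerDl fc //.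
have t1 : `|t| < 1 by near: t; exact: (@nbhs0_lt R R 1 ltr01).
by have := ler_norm (- t); rewrite normrN; lra.
Unshelve. all: by end_near.
Qed.

Lemma derive_hom1Z (R : realType) n (u : 'rV[R]_n.+1 -> R) (x v : 'rV[R]_n.+1) (c : R) :
  CkS 1 u -> 0 < c -> x != 0 -> 'D_v (hom1 u) (c *: x) = 'D_v (hom1 u) x.
Proof.
move=> u1 c0 x0; rewrite (@derive_homogeneous R _ _ x v c c) //.
- by rewrite divff ?mul1r // gt_eqF.
- by move=> y _; apply: hom1Z.
- exact: isCk_derivable (isCk_hom1 u1) x0.
Qed.

Lemma hess_hom1Z (R : realType) n (u : 'rV[R]_n.+1 -> R) (x v w : 'rV[R]_n.+1) (c : R) :
  CkS 2 u -> 0 < c -> x != 0 ->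
  hess (hom1 u) (c *: x) v w = c^-1 * hess (hom1 u) x v w.
Proof.
move=> u2 c0 x0; rewrite /hess (@derive_homogeneous R _ _ x v c 1) ?mul1r //.
  move=> y y0; rewrite mul1r derive_hom1Z //.
  exact: isCk_le (@open_punctured R _) _ u2.
exact: isCk_derivable (isCk_derive w (isCk_hom1 u2)) x0.
Qed.

Lemma hess_hom1_radial (R : realType) n (u : 'rV[R]_n.+1 -> R) (x w : 'rV[R]_n.+1) :
  CkS 2 u -> x != 0 -> hess (hom1 u) x x w = 0.
Proof.
move=> u2 x0; apply: derive_radial => c c0; rewrite derive_hom1Z //.
exact: isCk_le (@open_punctured R _) _ u2.
Qed.

Lemma derive_hext_radial (R : realType) m (u : 'rV[R]_m -> R) (x : 'rV[R]_m) :
  'D_x (hext u) x = 0.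
Proof. by apply: derive_radial => c; apply: hextZ. Qed.

Lemma derive_hom1 (R : realType) n (u : 'rV[R]_n.+1 -> R) (x v : 'rV[R]_n.+1) :
  CkS 1 u -> x != 0 -> 'D_v (hom1 u) x =
  eucl_norm x * 'D_v (hext u) x + hext u x * (dotv x v * (eucl_norm x)^-1).
Proof.
move=> u1 x0; have H := is_derive_eucl_norm v x0.
rewrite deriveM //; last exact: isCk_derivable (CkS_isCk u1) x0.
by rewrite (@derive_val _ _ _ _ _ _ _ H).
Qed.

Lemma derive_hom1_tangent (R : realType) n (u : 'rV[R]_n.+1 -> R) (x v : 'rV[R]_n.+1) :
  CkS 1 u -> sphere n x -> dotv v x = 0 -> 'D_v (hom1 u) x = 'D_v (hext u) x.
Proof.
move=> u1 xS vx; rewrite derive_hom1 // ?sphere_neq0 // eucl_norm_sphere //.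
by rewrite mul1r dotvC vx mul0r mulr0 addr0.
Qed.

Lemma derive_hom1_radial (R : realType) n (u : 'rV[R]_n.+1 -> R) (x : 'rV[R]_n.+1) :
  CkS 1 u -> sphere n x -> 'D_x (hom1 u) x = u x.
Proof.
move=> u1 xS; rewrite derive_hom1 // ?sphere_neq0 // eucl_norm_sphere //.
rewrite derive_hext_radial mulr0 add0r hext_sphere // invr1 mulr1.
by move: xS; rewrite /sphere /= => ->; rewrite mulr1.
Qed.

(** In the derivative of [|y| D_w (hext u) + hext u (y . w) / |y|] at [x], orthogonality to [x]
    kills every term except the Hessian of [hext u] and the one from the derivative [v . w] of
    [y . w]. *)
Lemma hess_hom1 (R : realType) n (u : 'rV[R]_n.+1 -> R) (x v w : 'rV[R]_n.+1) :
  CkS 2 u -> sphere n x -> dotv v x = 0 -> dotv w x = 0 ->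
  hess (hom1 u) x v w = hess (hext u) x v w + dotv v w * u x.
Proof.
move=> u2 xS vx wx; have x0 := sphere_neq0 xS; have oP := @open_punctured R n.+1.
have u1 : CkS 1 u by apply: isCk_le u2.
have du : derivable (hext u) x v := isCk_derivable (CkS_isCk u2) x0.
have ddu : derivable ('D_w (hext u)) x v := isCk_derivable (isCk_derive w (CkS_isCk u2)) x0.
have HN := is_derive_eucl_norm v x0; have HV := is_derive_eucl_normV v x0.
have H1 := is_deriveM HN (derivableP ddu).
have H2 : is_derive x v (fun y => hext u y * (dotv y w * (eucl_norm y)^-1))
    (hext u x *: (dotv x w *: (- dotv x v * ((eucl_norm x)^-1 * (eucl_norm x)^-1 *
      (eucl_norm x)^-1)) + (eucl_norm x)^-1 *: dotv v w) +
     (dotv x w * (eucl_norm x)^-1) *: 'D_v (hext u) x).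
  exact: is_deriveM (derivableP du) (is_deriveM (is_derive_dotv x v w) HV).
have H3 := is_deriveD H1 H2.
rewrite /hess; transitivity ('D_v (fun y => eucl_norm y * 'D_w (hext u) y +
    hext u y * (dotv y w * (eucl_norm y)^-1)) x).
  apply: near_eq_derive; near=> y; apply: derive_hom1 => //.
  by near: y; apply: nbhs_punctured.
rewrite (@derive_val _ _ _ _ _ _ _ H3) /GRing.scale /= eucl_norm_sphere //.
by rewrite (dotvC x) (dotvC x) vx wx hext_sphere // invr1; ring.
Unshelve. all: by end_near.
Qed.

(** * The equation in adapted frames *)

Lemma sphA_hess (R : realType) n (u : 'rV[R]_n.+1 -> R) (x : 'rV[R]_n.+1) e i j :
  CkS 2 u -> sphere n x -> tframe x e ->
  sphA u x e i j = hess (hom1 u) x (e i) (e j).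
Proof. by move=> u2 xS [ee ex]; rewrite mxE hess_hom1 // ee. Qed.

Lemma hess_hom1C (R : realType) n (u : 'rV[R]_n.+1 -> R) (x v w : 'rV[R]_n.+1) :
  CkS 2 u -> x != 0 -> hess (hom1 u) x v w = hess (hom1 u) x w v.
Proof. by move=> u2 x0; exact: hessC _ _ (@open_punctured R _) (isCk_hom1 u2) x0. Qed.

Lemma sphA_sym (R : realType) n (u : 'rV[R]_n.+1 -> R) (x : 'rV[R]_n.+1) e :
  CkS 2 u -> sphere n x -> tframe x e -> (sphA u x e)^T = sphA u x e.
Proof.
move=> u2 xS xe; apply/matrixP => i j; rewrite mxE (sphA_hess i j u2 xS xe).
by rewrite (sphA_hess j i u2 xS xe) (hess_hom1C _ _ u2 (sphere_neq0 xS)).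
Qed.

Lemma dotv_suml (R : realType) m (I : finType) (a : I -> R) (v : I -> 'rV[R]_m)
  (w : 'rV[R]_m) : dotv (\sum_i a i *: v i) w = \sum_i a i * dotv (v i) w.
Proof.
rewrite (@big_morph _ _ (fun v => dotv v w) 0 +%R 0 +%R).
- by apply: eq_bigr => i _; rewrite dotvZl.
- by move=> y z; rewrite dotvDl.
- by rewrite -(scale0r 0) dotvZl mul0r.
Qed.

Lemma principal_frame (R : realType) n (u : 'rV[R]_n.+1 -> R) (x : 'rV[R]_n.+1) :
  CkS 2 u -> sphere n x -> exists e lam, [/\ tframe x e, eigvals (sphA u x e) lam &
    forall i j, hess (hom1 u) x (e i) (e j) = (i == j)%:R * lam i].
Proof.
move=> u2 xS; have [e0 xe0] := tframe_exists xS; have [ee0 ex0] := xe0.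
have [Q [d [QQ AE]]] := real_spectral (sphA_sym u2 xS xe0).
pose e i := \sum_j Q i j *: e0 j.
have ee i j : dotv (e i) (e j) = (i == j)%:R.
  have : (Q *m Q^T) i j = (i == j)%:R by rewrite QQ mxE.
  rewrite mxE => <-; rewrite dotv_suml; apply: eq_bigr => a _.
  rewrite dotvC dotv_suml (bigD1 a) //= ee0 eqxx mulr1 big1 ?addr0 ?mxE //.
  by move=> b ba; rewrite ee0 (negPf ba) mulr0.
have xe : tframe x e.
  split => // i; rewrite dotv_suml big1 // => j _.
  by rewrite ex0 mulr0.
have He i j : hess (hom1 u) x (e i) (e j) = (i == j)%:R * d 0 i.
  rewrite (hess_sum _ _ _ _ (@open_punctured R _) (isCk_hom1 u2) (sphere_neq0 xS)).
  transitivity ((Q *m sphA u x e0 *m Q^T) i j).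
    rewrite mxE exchange_big /=; apply: eq_bigr => b _; rewrite !mxE mulr_suml.
    by apply: eq_bigr => a _; rewrite sphA_hess //; ring.
  rewrite AE !mulmxA QQ mul1mx -mulmxA QQ mulmx1 mxE.
  by case: eqP => _; rewrite ?mul1r ?mul0r.
exists e, (d 0); split => //.
have -> : sphA u x e = (1%:M)^T *m diag_mx d *m 1%:M.
  apply/matrixP => i j; rewrite sphA_hess // He trmx1 mulmx1 mul1mx mxE.
  by case: eqP => _; rewrite ?mul1r ?mul0r.
by apply: orthogonal_eigvals; rewrite trmx1 mulmx1.
Qed.

(* The frame carried along by the rotation that takes [x] to the direction of
   [x + t w]. *)
Lemma tframe_rotate (R : realType) n (x w : 'rV[R]_n.+1) e (t : R) :
  sphere n x -> tframe x e -> utan x w ->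
  let r := Num.sqrt (1 + t ^+ 2) in
  tframe (r^-1 *: (x + t *: w))
    (fun i => e i + (dotv (e i) w * (r - 1)) *: w -
              (dotv (e i) w * (t / r)) *: (x + t *: w)).
Proof.
move=> xS [ee ex] [ww wx] r.
have r2 : r ^+ 2 = 1 + t ^+ 2 by rewrite sqr_sqrtr // addr_ge0 // sqr_ge0.
have r0 : 0 < r by rewrite sqrtr_gt0 ltr_pwDl // sqr_ge0.
have rN : r != 0 by rewrite gt_eqF.
have rt : t * t / r = r - r^-1.
  by apply: (mulIf rN); rewrite mulfVK // mulrBl mulVf // -!expr2 r2; ring.
have xx : dotv x x = 1 := xS.
have xw : dotv x w = 0 by rewrite dotvC.
(* The rotation takes [x] to [(x + t w) / r] and [w] to [(w - t x) / r]. The displacement of [w] is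
   [z], and a tangent vector moves by its [w]-component times [z]. The statement isolates in this
   displacement a multiple of the radial vector [x + t w], which the Hessian of [U] ignores. *)
have [z zE] : exists z : 'rV[R]_n.+1, z = (r^-1 - 1) *: w - (t / r) *: x.
  by exists ((r^-1 - 1) *: w - (t / r) *: x).
have E i : e i + (dotv (e i) w * (r - 1)) *: w -
    (dotv (e i) w * (t / r)) *: (x + t *: w) = e i + dotv (e i) w *: z.
  rewrite zE; apply/rowP => j; rewrite !mxE.
  have -> : r^-1 - 1 = r - 1 - t / r * t by rewrite mulrAC rt; ring.
  by ring.
have ez i : dotv (e i) z = dotv (e i) w * (r^-1 - 1).
  by rewrite zE !(dotvDr, dotvNr, dotvZr) ex mulr0 subr0 mulrC.
have zz : dotv z z = - 2 * (r^-1 - 1).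
  rewrite zE !(dotvDl, dotvDr, dotvNl, dotvNr, dotvZl, dotvZr) ww wx xw xx.
  rewrite !(mulr0, mulr1, subr0, sub0r, oppr0, addr0, add0r, opprK).
  rewrite mulrN opprK; have -> : t / r * (t / r) = t * t / r * r^-1 by ring.
  by rewrite rt; field.
split => [i j|i]; rewrite !E.
  by rewrite !(dotvDl, dotvDr, dotvZl, dotvZr) ee (dotvC z) !ez zz; ring.
rewrite dotvZr !(dotvDl, dotvDr, dotvZl, dotvZr) ex (dotvC z x) (dotvC z w).
rewrite zE !(dotvDr, dotvNr, dotvZr) xx xw ww wx.
by field.
Qed.

Lemma eucl_norm_line (R : realType) n (x w : 'rV[R]_n.+1) (t : R) :
  sphere n x -> utan x w -> eucl_norm (x + t *: w) = Num.sqrt (1 + t ^+ 2).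
Proof.
move=> xS [ww wx]; rewrite /eucl_norm; congr Num.sqrt.
rewrite !(dotvDl, dotvDr, dotvZl, dotvZr) ww wx (dotvC x w) wx.
by move: xS; rewrite /sphere /= => ->; ring.
Qed.

Lemma line_neq0 (R : realType) n (x w : 'rV[R]_n.+1) (t : R) :
  sphere n x -> utan x w -> x + t *: w != 0.
Proof.
move=> xS xw; rewrite -eucl_norm_gt0 (eucl_norm_line _ xS xw) sqrtr_gt0.
by rewrite ltr_pwDl // sqr_ge0.
Qed.

(** Serves twice: it discards the radial part of the rotated frame vectors, and it replaces a fixed
    direction by its tangential part in the Hessian estimate. *)
Lemma hess_hom1_mod_radial (R : realType) n (u : 'rV[R]_n.+1 -> R)
  (x v : 'rV[R]_n.+1) (s : R) : CkS 2 u -> x != 0 ->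
  hess (hom1 u) x (v - s *: x) (v - s *: x) = hess (hom1 u) x v v.
Proof.
move=> u2 x0; have oP := @open_punctured R n.+1; have U2 := isCk_hom1 u2.
rewrite -scaleNr (hessDl _ _ _ oP U2 x0) !(hessDr _ _ _ oP U2 x0).
rewrite !(hessZl _ _ _ oP U2 x0) !(hessZr _ _ _ oP U2 x0) !hess_hom1_radial //.
by rewrite (hess_hom1C _ _ u2 x0) hess_hom1_radial // !(mulr0, addr0).
Qed.

(* The diagonal entry at [e] of the matrix of the equation at the direction of
   [x + t w], in the frame of [tframe_rotate]. *)
Definition rotated_entry (R : realType) n (u : 'rV[R]_n.+1 -> R)
  (x w e : 'rV[R]_n.+1) (t : R) : R :=
  let r := Num.sqrt (1 + t ^+ 2) in
  let y := x + t *: w in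
  r * (hess (hom1 u) y e e + 2 * dotv e w * (r - 1) * hess (hom1 u) y e w +
       (dotv e w * (r - 1)) ^+ 2 * hess (hom1 u) y w w).

(** The factor [r] in [rotated_entry] undoes the degree [-1] homogeneity of the Hessian of [U]
    between [x + t w] and its direction. *)
Lemma rotated_entryE (R : realType) n (u : 'rV[R]_n.+1 -> R) (x w : 'rV[R]_n.+1) e
  (t : R) i : CkS 2 u -> sphere n x -> tframe x e -> utan x w ->
  let r := Num.sqrt (1 + t ^+ 2) in
  sphA u (r^-1 *: (x + t *: w))
    (fun i => e i + (dotv (e i) w * (r - 1)) *: w -
              (dotv (e i) w * (t / r)) *: (x + t *: w)) i i =
  rotated_entry u x w (e i) t.
Proof.
move=> u2 xS xe xw r; have y0 := line_neq0 t xS xw.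
have r0 : 0 < r by rewrite /r -(eucl_norm_line t xS xw) eucl_norm_gt0.
have yS : sphere n (r^-1 *: (x + t *: w)).
  by rewrite /r -(eucl_norm_line t xS xw); apply: sphere_normalize.
rewrite (sphA_hess _ _ u2 yS (tframe_rotate t xS xe xw)).
rewrite hess_hom1Z ?invr_gt0 // invrK hess_hom1_mod_radial // /rotated_entry -/r.
have oP := @open_punctured R n.+1; have U2 := isCk_hom1 u2.
rewrite (hessDl _ _ _ oP U2 y0) !(hessDr _ _ _ oP U2 y0).
rewrite !(hessZl _ _ _ oP U2 y0) !(hessZr _ _ _ oP U2 y0).
rewrite (hess_hom1C w (e i) u2 y0).
move: (hess _ _ (e i) (e i)) (hess _ _ (e i) w) (hess _ _ w w) (dotv (e i) w) (r : R).
by move=> a b c d q; ring.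
Qed.

Lemma ln_le_sub1 (R : realType) (x : R) : 0 < x -> ln x <= x - 1.
Proof.
by move=> x0; have := @le_ln1Dx R (x - 1); rewrite [1 + _]addrC subrK; apply; lra.
Qed.

Lemma solves_ratio (R : realType) n P k l (eps : R) (phi u : 'rV[R]_n.+1 -> R) x e lam :
  (l < k)%N -> solves P k l k.+1 (k.+1 - l) eps phi u -> sphere n x -> tframe x e ->
  eigvals (sphA u x e) lam -> 0 < u x ->
  ratioL P k l lam = u x ^+ (k - l) * (u x `^ eps * phi x).
Proof.
move=> lk sol xS xe le u0; rewrite /ratioL (sol x xS e xe lam le).
rewrite subrr mul0r powRr0 mulr1 mulrA; congr (_ * _).
have -> : (k.+1 - l)%:R - 1 = (k - l)%:R :> R by rewrite subSn ?(ltnW lk) // -natr1 addrK.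
by rewrite powRD ?powR_mulrn ?ltW // (gt_eqF u0) implybT.
Qed.

Lemma ln_ratio (R : realType) (d : nat) (a eps b : R) : 0 < a -> 0 < b ->
  ln (a ^+ d * (a `^ eps * b)) = (d%:R + eps) * ln a + ln b.
Proof.
move=> a0 b0; have ad : 0 < a ^+ d by rewrite exprn_gt0.
have ae : 0 < a `^ eps by rewrite powR_gt0.
rewrite lnM ?posrE ?mulr_gt0 // lnM ?posrE // ln_powR lnXn // mulrDl addrA.
by rewrite mulr_natl.
Qed.

(* Concavity of the operator compares the solution along the line [x + t w] with
   the linearization at [x]. *)
Lemma log_comparison (R : realType) n P k l (eps : R) (phi u : 'rV[R]_n.+1 -> R)
  (x w : 'rV[R]_n.+1) e lam (g : 'I_n -> R) :
  (l < k)%N -> CkS 2 u ->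
  (forall y, sphere n y -> 0 < u y) -> (forall y, sphere n y -> 0 < phi y) ->
  admissible P k u -> solves P k l k.+1 (k.+1 - l) eps phi u ->
  sphere n x -> tframe x e -> utan x w -> eigvals (sphA u x e) lam ->
  (forall B : 'M[R]_n, B^T = B ->
      (forall mu, eigvals B mu -> inGamma P k mu) ->
      exists mu, [/\ eigvals B mu, 0 < \sum_i g i * B i i &
        ratioL P k l mu <= ratioL P k l lam * (\sum_i g i * B i i) ^+ (k - l)]) ->
  forall t,
  ((k - l)%:R + eps) * ln (hext u (x + t *: w)) + ln (hext phi (x + t *: w)) -
    (((k - l)%:R + eps) * ln (u x) + ln (phi x)) <=
  (k - l)%:R * (\sum_i g i * rotated_entry u x w (e i) t - 1).
Proof.
move=> lk u2 u0 phi0 adm sol xS xe xw le gB t.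
set r := Num.sqrt (1 + t ^+ 2).
have y0 := line_neq0 t xS xw; have rE := eucl_norm_line t xS xw.
have yS : sphere n (r^-1 *: (x + t *: w)).
  by rewrite /r -rE; apply: sphere_normalize.
have ye := tframe_rotate t xS xe xw; rewrite -/r in ye.
have [mu [muB S0 muS]] := gB _ (sphA_sym u2 yS ye) (adm _ yS _ ye).
have SE : \sum_i g i * sphA u (r^-1 *: (x + t *: w)) (fun i => e i +
    (dotv (e i) w * (r - 1)) *: w - (dotv (e i) w * (t / r)) *: (x + t *: w)) i i =
    \sum_i g i * rotated_entry u x w (e i) t.
  by apply: eq_bigr => i _; rewrite rotated_entryE.
rewrite SE in S0 muS; set S := \sum_i _ in S0 muS *.
rewrite (solves_ratio lk sol yS ye muB (u0 _ yS)) in muS.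
rewrite (solves_ratio lk sol xS xe le (u0 _ xS)) in muS.
have hu f : hext f (x + t *: w) = f (r^-1 *: (x + t *: w)).
  by rewrite /hext -/(eucl_norm _) rE.
have posR y : sphere n y -> 0 < u y ^+ (k - l) * (u y `^ eps * phi y).
  by move=> /[dup] /u0 uy /phi0 py; rewrite !mulr_gt0 ?exprn_gt0 ?powR_gt0.
have Sd : 0 < S ^+ (k - l) by rewrite exprn_gt0.
rewrite !hu -!ln_ratio ?u0 ?phi0 // lerBlDl.
apply: le_trans (_ : ln (u x ^+ (k - l) * (u x `^ eps * phi x) * S ^+ (k - l)) <= _).
  by rewrite ler_ln ?posrE ?posR // mulr_gt0 ?posR.
(* The logarithm of [S] is replaced by its tangent at [S = 1], so that the bound becomes linear in
   the diagonal entries and can be expanded in [t]. *)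
rewrite lnM ?posrE ?posR // lerD2l lnXn // -[ln S *+ _]mulr_natl ler_wpM2l ?ler0n //.
exact: ln_le_sub1.
Qed.

(** * Extrema on the sphere and on its unit tangent bundle *)

Lemma tangent_bundle_max (R : realType) n (F : 'rV[R]_n.+1 * 'rV[R]_n.+1 -> R) :
  (0 < n)%N -> (forall p, p.1 != 0 -> {for p, continuous F}) ->
  exists x e, [/\ sphere n x, utan x e &
    forall y f, sphere n y -> utan y f -> F (y, f) <= F (x, e)].
Proof.
move=> n0 cF; pose S := @sphere R n.
pose A : set ('rV[R]_n.+1 * 'rV[R]_n.+1) :=
  ((S `*` S) `&` [set p | dotv p.2 p.1 = 0])%classic.
have cA : compact A.
  apply: compact_closedI; first by apply: compact_setX; apply: sphere_compact.
  apply: (@closed_comp _ _ (fun p : 'rV[R]_n.+1 * 'rV[R]_n.+1 => dotv p.2 p.1)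
    [set 0 : R]%classic); last exact: closed_eq.
  by move=> p _; apply: continuous_dotv; [exact: cvg_snd|exact: cvg_fst].
have A0 : (A !=set0)%classic.
  have [x xS] := @sphere_nonempty R n; have [e [ee ex]] := tframe_exists xS.
  exists (x, e (Ordinal n0)); split => /=; last exact: ex.
  by split => //=; rewrite /S /sphere /= ee eqxx.
have [|[x e] /set_mem[[/= xS eS] ex] Fmax] := @compact_EVT_max _ R F A A0 cA.
  apply: continuous_in_subspaceT => p /set_mem[[pS _] _]; apply: cF.
  exact: sphere_neq0.
exists x, e; split => // y f yS [ff fy].
by apply: Fmax; apply/mem_set.
Qed.

Lemma sphere_max (R : realType) n (u : 'rV[R]_n.+1 -> R) :
  CkS 1 u -> exists2 x, sphere n x & forall y, sphere n y -> u y <= u x.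
Proof.
move=> u1; have [|x /set_mem xS xmax] := @compact_EVT_max _ R (hext u) _
  (@sphere_nonempty R n) (@sphere_compact R n).
  apply: continuous_in_subspaceT => x /set_mem xS.
  exact: (isCk_continuous (@open_punctured R _) (CkS_isCk u1)) (sphere_neq0 xS).
exists x => // y yS; have := xmax y (mem_set yS).
by rewrite !hext_sphere.
Qed.

(** [isCk] gives continuity in the point for a fixed direction; expansion in coordinates makes the
    derivative jointly continuous in point and direction, as maximization over the tangent bundle
    requires. *)
Lemma derive_coord (R : realType) m (f : 'rV[R]_m -> R) (x v : 'rV[R]_m) :
  isCk 1 f punctured -> x != 0 ->
  'D_v f x = \sum_i v 0 i * 'D_(delta_mx 0 i) f x.
Proof.
move=> f1 x0; rewrite {1}(row_sum_delta v).
exact: derive_dir_sum (@open_punctured R m) f1 x0.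
Qed.

Lemma hess_coord (R : realType) m (f : 'rV[R]_m -> R) (x v : 'rV[R]_m) :
  isCk 2 f punctured -> x != 0 ->
  hess f x v v = \sum_i \sum_j v 0 i * v 0 j *
    hess f x (delta_mx 0 i) (delta_mx 0 j).
Proof.
move=> f2 x0; rewrite {1 2}(row_sum_delta v).
exact: hess_sum (@open_punctured R m) f2 x0.
Qed.

Lemma continuous_fst_for (R : realType) (T U : topologicalType) (f : T -> R) (p : T * U) :
  {for p.1, continuous f} -> {for p, continuous (fun q => f q.1)}.
Proof.
by move=> cf; apply: (@continuous_comp _ _ _ fst f); [exact: cvg_fst|exact: cf].
Qed.

Lemma continuous_snd_coord (R : realType) (T : topologicalType) m i
  (p : T * 'rV[R]_m) : {for p, continuous (fun q : T * 'rV[R]_m => q.2 0 i)}.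
Proof.
apply: (@continuous_comp _ _ _ snd (fun y : 'rV[R]_m => y 0 i)).
  exact: cvg_snd.
exact: coord_continuous.
Qed.

Lemma log_gradient_max (R : realType) n (u : 'rV[R]_n.+1 -> R) :
  (0 < n)%N -> CkS 2 u -> (forall x, sphere n x -> 0 < u x) ->
  exists x w (K : R), [/\ sphere n x, utan x w, 0 <= K,
    'D_w (hom1 u) x = K * u x &
    forall y f, sphere n y -> utan y f -> 'D_f (hom1 u) y <= K * u y].
Proof.
move=> n0 u2 u0; have oP := @open_punctured R n.+1.
have U2 := isCk_hom1 u2; have U1 := isCk_le oP (leqnSn 1) U2.
pose F (p : 'rV[R]_n.+1 * 'rV[R]_n.+1) :=
  (\sum_i p.2 0 i * 'D_(delta_mx 0 i) (hom1 u) p.1) * (hom1 u p.1)^-1.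
have posU (y : 'rV[R]_n.+1) : y != 0 -> 0 < hom1 u y.
  by move=> y0; rewrite mulr_gt0 ?eucl_norm_gt0 // u0 //; apply: sphere_normalize.
have FE y f : sphere n y -> F (y, f) = 'D_f (hom1 u) y / u y.
  by move=> yS; rewrite /F /= -derive_coord ?sphere_neq0 // hom1_sphere.
have [|x [w [xS xw Fmax]]] := @tangent_bundle_max R n F n0.
  move=> p p0; apply: continuousM_for.
    apply: continuous_sum_for => i; apply: continuousM_for.
      exact: continuous_snd_coord.
    apply: (@continuous_fst_for _ _ _ ('D_(delta_mx 0 i) (hom1 u))).
    exact: isCk_continuous oP (isCk_derive _ U2) p0.
  apply: (@continuous_fst_for _ _ _ (fun y => (hom1 u y)^-1)).
  apply: continuousV_for; first by rewrite gt_eqF // posU.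
  exact: isCk_continuous oP U2 p0.
have Fle y f : sphere n y -> utan y f -> 'D_f (hom1 u) y <= F (x, w) * u y.
  by move=> yS yf; rewrite -ler_pdivrMr ?u0 // -FE //; apply: Fmax.
exists x, w, (F (x, w)); split => //; last first.
  by rewrite FE // divfK // gt_eqF // u0.
(* The direction [-w] competes as well, so the maximum is nonnegative. *)
have xNw : utan x (- w).
  by case: xw => ww wx; split; rewrite !(dotvNl, dotvNr) ?opprK // wx oppr0.
have := Fmax _ _ xS xNw; rewrite !FE // -scaleN1r derive_dirZ.
  by rewrite mulN1r mulNr; lra.
exact: isCk_derivable U2 (sphere_neq0 xS).
Qed.

Lemma hessian_max (R : realType) n (u : 'rV[R]_n.+1 -> R) :
  (0 < n)%N -> CkS 2 u ->
  exists x w, [/\ sphere n x, utan x w &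
    forall y f, sphere n y -> utan y f ->
      hess (hom1 u) y f f <= hess (hom1 u) x w w].
Proof.
move=> n0 u2; have oP := @open_punctured R n.+1; have U2 := isCk_hom1 u2.
pose F (p : 'rV[R]_n.+1 * 'rV[R]_n.+1) := \sum_i \sum_j p.2 0 i * p.2 0 j *
  hess (hom1 u) p.1 (delta_mx 0 i) (delta_mx 0 j).
have FE y f : sphere n y -> F (y, f) = hess (hom1 u) y f f.
  by move=> yS; rewrite [RHS]hess_coord // sphere_neq0.
have [|x [w [xS xw Fmax]]] := @tangent_bundle_max R n F n0.
  move=> p p0; do 2 apply: continuous_sum_for => ?; apply: continuousM_for.
    by apply: continuousM_for; apply: continuous_snd_coord.
  apply: (@continuous_fst_for _ _ _ (fun y => hess (hom1 u) y _ _)).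
  exact: isCk_continuous oP (isCk_derive _ (isCk_derive _ U2)) p0.
by exists x, w; split => // y f yS yf; rewrite -(FE y f yS) -(FE x w xS); apply: Fmax.
Qed.

(** * Bounds of order zero *)

Record solution_data (R : realType) n P k l (eps m0 M0 : R)
    (phi u : 'rV[R]_n.+1 -> R) : Prop := SolutionData {
  sd_n : (0 < n)%N;
  sd_P : (1 < P)%N;
  sd_kl : (l < k <= 'C(n, P))%N;
  sd_m0 : 0 < m0;
  sd_eps : 0 < eps;
  sd_phi2 : CkS 2 phi;
  sd_phi_ge : forall x, sphere n x -> m0 <= phi x;
  sd_phi_bound : C2bound phi M0;
  sd_u4 : CkS 4 u;
  sd_u_gt0 : forall x, sphere n x -> 0 < u x;
  sd_adm : admissible P k u;
  sd_sol : solves P k l k.+1 (k.+1 - l) eps phi u }.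

Lemma sd_u2 (R : realType) n P k l (eps m0 M0 : R) (phi u : 'rV[R]_n.+1 -> R) :
  solution_data P k l eps m0 M0 phi u -> CkS 2 u.
Proof. by move=> H; apply: isCk_le (sd_u4 H) => //; apply: open_punctured. Qed.

Lemma sd_phi_gt0 (R : realType) n P k l (eps m0 M0 : R) (phi u : 'rV[R]_n.+1 -> R) x :
  solution_data P k l eps m0 M0 phi u -> sphere n x -> 0 < phi x.
Proof. by move=> H xS; apply: lt_le_trans (sd_m0 H) (sd_phi_ge H xS). Qed.

Lemma sd_phi_le (R : realType) n P k l (eps m0 M0 : R) (phi u : 'rV[R]_n.+1 -> R) x :
  solution_data P k l eps m0 M0 phi u -> sphere n x -> phi x <= M0.
Proof.
by move=> H xS; have [+ _] := sd_phi_bound H xS; apply: le_trans; apply: ler_norm.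
Qed.

Lemma sd_m0_le_M0 (R : realType) n P k l (eps m0 M0 : R) (phi u : 'rV[R]_n.+1 -> R) :
  solution_data P k l eps m0 M0 phi u -> m0 <= M0.
Proof.
move=> H; have [x xS] := @sphere_nonempty R n.
exact: le_trans (sd_phi_ge H xS) (sd_phi_le H xS).
Qed.

Lemma hess_hext_at_max (R : realType) n (u : 'rV[R]_n.+1 -> R) (x v : 'rV[R]_n.+1) :
  CkS 2 u -> sphere n x -> (forall y, sphere n y -> u y <= u x) -> utan x v ->
  hess (hext u) x v v <= 0.
Proof.
move=> u2 xS xmax xv.
have J := jet2_line v (@open_punctured R _) (CkS_isCk u2) (sphere_neq0 xS).
have [|_ +] := jet2_min (jet2B (jet2_cst (hext u x)) J).
  rewrite subrr; near=> t; rewrite subr_ge0 (hext_sphere _ xS).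
  by apply: xmax; apply: sphere_normalize; apply: line_neq0.
by rewrite sub0r oppr_ge0.
Unshelve. all: by end_near.
Qed.

(* Evaluate the equation at a maximum of [u], where the matrix is at most
   [u] times the identity. *)
Lemma powR_upper (R : realType) n P k l (eps m0 M0 : R) (phi u : 'rV[R]_n.+1 -> R) x :
  solution_data P k l eps m0 M0 phi u -> sphere n x ->
  u x `^ eps * m0 <= ratioL P k l (fun _ : 'I_n => 1).
Proof.
move=> H xS; have u2 := sd_u2 H; have /andP[lk kN] := sd_kl H.
have [z zS zmax] := sphere_max (isCk_le (@open_punctured R n.+1) (leqnSn 1) u2).
have [e ze] := tframe_exists zS; have [ee ez] := ze.
have kap0 := ratioL_gt0 (ltnW lk) (inGamma1 R (ltnW (sd_P H)) kN).
(* The weights are taken at the identity matrix, where their normalization says that they sum to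
   [1]. *)
have [g [g0 g1 _ _ gB]] := ratioL_matrix (sd_P H) (sd_kl H) (inGamma1 R (ltnW (sd_P H)) kN).
have [mu [muB S0 muS]] := gB _ (sphA_sym u2 zS ze) (sd_adm H zS ze).
have uz := sd_u_gt0 H zS.
rewrite (solves_ratio lk (sd_sol H) zS ze muB uz) in muS.
have S_le : \sum_i g i * sphA u z e i i <= u z.
  have -> : u z = \sum_i g i * 1 * u z by rewrite -mulr_suml g1 mul1r.
  apply: ler_sum => i _; rewrite mulr1 ler_wpM2l // mxE eqxx mul1r gerDr.
  by apply: hess_hext_at_max => //; split => //; rewrite ee eqxx.
have main : u z `^ eps * phi z <= ratioL P k l (fun _ : 'I_n => 1).
  have ud : 0 < u z ^+ (k - l) by rewrite exprn_gt0.
  rewrite -(ler_pM2l ud); apply: le_trans muS _.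
  rewrite mulrC ler_pM2r // lerXn2r // nnegrE ltW //.
apply: le_trans main; apply: ler_pM; rewrite ?powR_ge0 ?(ltW (sd_m0 H)) //.
  apply: ge0_ler_powR; first exact: ltW (sd_eps H).
  - by rewrite nnegrE ltW // (sd_u_gt0 H xS).
  - by rewrite nnegrE ltW.
  - exact: zmax.
exact: (sd_phi_ge H zS).
Qed.

(** With [kap] the operator at the identity and [G] the total weight, the last hypothesis becomes
    [kap <= (u G)^d u^eps phi]. Inserting [u^eps <= kap / m0] and [phi <= M0] cancels [kap] and
    removes [eps]. *)
Lemma weight_lower (R : realType) n P k l (eps m0 M0 : R) (phi u : 'rV[R]_n.+1 -> R)
  (x : 'rV[R]_n.+1) e lam (g : 'I_n -> R) :
  solution_data P k l eps m0 M0 phi u -> sphere n x -> tframe x e ->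
  eigvals (sphA u x e) lam -> (forall i, 0 <= g i) ->
  ratioL P k l (fun _ : 'I_n => 1) <= ratioL P k l lam * (\sum_i g i) ^+ (k - l) ->
  m0 / M0 <= u x * \sum_i g i.
Proof.
move=> H xS xe le g0; have /andP[lk kN] := sd_kl H; have ux := sd_u_gt0 H xS.
rewrite (solves_ratio lk (sd_sol H) xS xe le ux).
set G := \sum_i g i; set kap := ratioL _ _ _ _ => kapG.
have m00 := sd_m0 H; have mM := sd_m0_le_M0 H.
have M00 : 0 < M0 by apply: lt_le_trans mM.
have kap0 : 0 < kap := ratioL_gt0 (ltnW lk) (inGamma1 R (ltnW (sd_P H)) kN).
have up := powR_upper H xS; rewrite -/kap in up.
have G0 : 0 <= G by apply: sumr_ge0.
have y0 : 0 <= u x * G by rewrite mulr_ge0 // ltW.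
have yd : m0 / M0 <= (u x * G) ^+ (k - l).
  rewrite ler_pdivrMr // exprMn; rewrite -(ler_pM2l kap0).
  apply: le_trans (_ : m0 * (u x ^+ (k - l) * (u x `^ eps * phi x) * G ^+ (k - l)) <= _).
    by rewrite mulrC ler_pM2l.
  have -> : m0 * (u x ^+ (k - l) * (u x `^ eps * phi x) * G ^+ (k - l)) =
    (u x `^ eps * m0) * (u x ^+ (k - l) * G ^+ (k - l) * phi x) by ring.
  apply: ler_pM => //.
  - by rewrite mulr_ge0 ?powR_ge0 // ltW.
  - by rewrite !mulr_ge0 ?exprn_ge0 // ltW // (sd_phi_gt0 H xS).
  - by rewrite ler_wpM2l ?(sd_phi_le H xS) // mulr_ge0 ?exprn_ge0 // ltW.
(* As [m0 / M0 <= 1], the power can be removed: either [u G >= 1], or [(u G)^d <= u G]. *)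
have [y1|y1] := lerP 1 (u x * G).
  by apply: le_trans y1; rewrite ler_pdivrMr // mul1r.
apply: le_trans yd _; have : (0 < k - l)%N by rewrite subn_gt0.
case: (k - l)%N => // d _; rewrite exprS ler_piMr //.
by apply: exprn_ile1 => //; exact: ltW.
Qed.

(** * Gradient estimate *)

Lemma derive_commute3 (R : realType) m (f : 'rV[R]_m -> R) (U : set 'rV[R]_m)
  (x v w : 'rV[R]_m) : open U -> isCk 3 f U -> U x ->
  'D_w ('D_v ('D_v f)) x = 'D_v ('D_v ('D_w f)) x.
Proof.
move=> oU f3 Ux; have f2 := isCk_le oU (leqnSn 2) f3.
transitivity ('D_v ('D_w ('D_v f)) x).
  exact: (hessC w v oU (isCk_derive v f3) Ux).
apply: near_eq_derive.
have nU : nbhs x U by apply: open_nbhs_nbhs.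
near=> y; apply: (hessC w v oU f2).
by near: y.
Unshelve. all: by end_near.
Qed.

Lemma derive_commute4 (R : realType) m (f : 'rV[R]_m -> R) (U : set 'rV[R]_m)
  (x v w : 'rV[R]_m) : open U -> isCk 4 f U -> U x ->
  'D_w ('D_w ('D_v ('D_v f))) x = 'D_v ('D_v ('D_w ('D_w f))) x.
Proof.
move=> oU f4 Ux; have f3 := isCk_le oU (leqnSn 3) f4.
transitivity ('D_w ('D_v ('D_v ('D_w f))) x); last first.
  exact: derive_commute3 oU (isCk_derive w f4) Ux.
apply: near_eq_derive.
have nU : nbhs x U by apply: open_nbhs_nbhs.
near=> y; apply: (derive_commute3 _ _ oU f3).
by near: y.
Unshelve. all: by end_near.
Qed.

(** * Second-order jets along the rotated frame *)

Lemma jet2_rinv (R : realType) :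
  jet2 (fun t : R => (Num.sqrt (1 + t ^+ 2))^-1) 1 0 (-1).
Proof.
have := jet2V (@ltr01 R) (@jet2_sqrt1 R).
by rewrite invr1 mul0r oppr0 !expr1n !divr1 expr0n mulr0 sub0r.
Qed.

Lemma jet2_sine (R : realType) :
  jet2 (fun t : R => t * (Num.sqrt (1 + t ^+ 2))^-1) 0 1 0.
Proof.
have := jet2M (@jet2_id R) (@jet2_rinv R).
by rewrite !(mul0r, mulr0, add0r, mulr1, addr0).
Qed.

Lemma eq_jet2_coef (R : realType) (f : R -> R) (a b c a' b' c' : R) :
  jet2 f a b c -> a = a' -> b = b' -> c = c' -> jet2 f a' b' c'.
Proof. by move=> ? <- <- <-. Qed.

(** The jets of [r] and [r - 1] are [(1, 0, 1)] and [(0, 0, 1)], so to second order the rotation of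
    the frame contributes only [2 k a2], and the change of scale only the last [a1]. *)
Lemma jet2_rotation (R : realType) (f1 f2 f3 : R -> R) (k a1 b1 c1 a2 b2 c2 a3 b3 c3 : R) :
  jet2 f1 a1 b1 c1 -> jet2 f2 a2 b2 c2 -> jet2 f3 a3 b3 c3 ->
  jet2 (fun t => let r := Num.sqrt (1 + t ^+ 2) in
      r * (f1 t + 2 * k * (r - 1) * f2 t + (k * (r - 1)) ^+ 2 * f3 t))
    a1 b1 (c1 + 2 * k * a2 + a1).
Proof.
move=> J1 J2 J3; have Jr1 := jet2B (@jet2_sqrt1 R) (jet2_cst 1).
have Jc := jet2Z k Jr1.
have J := jet2M (@jet2_sqrt1 R)
  (jet2D (jet2D J1 (jet2M (jet2Z (2 * k) Jr1) J2)) (jet2M (jet2M Jc Jc) J3)).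
by apply: (eq_jet2_coef J); ring.
Qed.

Lemma jet2_rotated_entry (R : realType) n (u : 'rV[R]_n.+1 -> R)
  (x w e : 'rV[R]_n.+1) : CkS 4 u -> x != 0 ->
  jet2 (rotated_entry u x w e) (hess (hom1 u) x e e)
    ('D_w ('D_e ('D_e (hom1 u))) x)
    ('D_w ('D_w ('D_e ('D_e (hom1 u)))) x +
     2 * dotv e w * hess (hom1 u) x e w + hess (hom1 u) x e e).
Proof.
move=> u4 x0; have oP := @open_punctured R n.+1; have U4 := isCk_hom1 u4.
have J a b : jet2 (fun t => hess (hom1 u) (x + t *: w) a b) (hess (hom1 u) x a b)
    ('D_w ('D_a ('D_b (hom1 u))) x) ('D_w ('D_w ('D_a ('D_b (hom1 u)))) x).
  exact: jet2_line w oP (isCk_derive a (isCk_derive b U4)) x0.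
exact (jet2_rotation (dotv e w) (J e e) (J e w) (J w w)).
Qed.

Lemma eucl_norm0 (R : realType) m : eucl_norm (0 : 'rV[R]_m) = 0.
Proof.
have /eqP dot0 : dotv (0 : 'rV[R]_m) 0 == 0 by rewrite dotv_eq0.
by rewrite /eucl_norm dot0 sqrtr0.
Qed.

Lemma derive_tangent_le (R : realType) n (u : 'rV[R]_n.+1 -> R) (K : R)
  (x v : 'rV[R]_n.+1) : CkS 1 u ->
  (forall y f, sphere n y -> utan y f -> 'D_f (hom1 u) y <= K * u y) ->
  sphere n x -> dotv v x = 0 -> 'D_v (hom1 u) x <= K * eucl_norm v * u x.
Proof.
move=> u1 HK xS vx; have [->|v0] := eqVneq v 0.
  by rewrite derive0 eucl_norm0 mulr0 mul0r.
have N0 : 0 < eucl_norm v by rewrite eucl_norm_gt0.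
have utv : utan x ((eucl_norm v)^-1 *: v).
  split; last by rewrite dotvZl vx mulr0.
  exact: (sphere_normalize v0).
have := HK _ _ xS utv; rewrite derive_dirZ; last first.
  exact: isCk_derivable (isCk_hom1 u1) (sphere_neq0 xS).
by rewrite mulrC ler_pdivrMr // mulrAC.
Qed.

Lemma tangential_part (R : realType) n (x w : 'rV[R]_n.+1) : sphere n x ->
  let v := w - dotv w x *: x in
  dotv v x = 0 /\ dotv v v = dotv w w - dotv w x ^+ 2.
Proof.
move=> xS v; have xx : dotv x x = 1 := xS.
rewrite /v !(dotvDl, dotvDr, dotvNl, dotvNr, dotvZl, dotvZr) xx (dotvC x w).
by split; ring.
Qed.

(** The majorant is tangent at [y = 0]. It is applied with [y] the square of a quantity vanishing at
    the touching point, so no second-order information is lost. *)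
Lemma sqrt_le_half (R : realType) (y : R) : 0 <= 1 - y ->
  Num.sqrt (1 - y) <= 1 - y / 2.
Proof.
move=> y1; have s0 : 0 <= Num.sqrt (1 - y) by apply: sqrtr_ge0.
have := sqr_ge0 (Num.sqrt (1 - y) - 1); rewrite sqrrB sqr_sqrtr // expr1n; lra.
Qed.

(* Along [x + s e] the bound [D_w U <= K |w^T| U + (w . x) U] is an equality at
   [s = 0]. *)
Lemma gradient_jet_bound (R : realType) n (u : 'rV[R]_n.+1 -> R) (K : R)
  (x w e : 'rV[R]_n.+1) : CkS 1 u -> 0 <= K ->
  (forall y, sphere n y -> 0 < u y) ->
  (forall y f, sphere n y -> utan y f -> 'D_f (hom1 u) y <= K * u y) ->
  sphere n x -> utan x w -> utan x e ->
  forall s rho : R, rho = (Num.sqrt (1 + s ^+ 2))^-1 ->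
  'D_w (hom1 u) (x + s *: e) <= hom1 u (x + s *: e) *
    ((dotv e w * (s * rho) + K * (1 - dotv e w ^+ 2 / 2 * (s * rho * (s * rho)))) * rho).
Proof.
move=> u1 K0 u0 HK xS [ww wx] xe s rho rhoE0.
have z0 := line_neq0 s xS xe; have rE := eucl_norm_line s xS xe.
set z := x + s *: e in z0 rE *.
have r0 : 0 < eucl_norm z by rewrite eucl_norm_gt0.
have rhoE : rho = (eucl_norm z)^-1 by rewrite rE.
have rho0 : 0 < rho by rewrite rhoE invr_gt0.
have zS : sphere n (rho *: z) by rewrite rhoE; apply: sphere_normalize.
set y := dotv e w * (s * rho).
have wy : dotv w (rho *: z) = y.
  by rewrite dotvZr /z dotvDr dotvZr wx (dotvC w e) /y; ring.
have [vz vv] := tangential_part w zS; set v := w - _ in vz vv.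
rewrite ww wy in vv.
have y1 : 0 <= 1 - y ^+ 2 by rewrite -vv dotv_ge0.
have Nv : eucl_norm v <= 1 - y ^+ 2 / 2 by rewrite /eucl_norm vv; apply: sqrt_le_half.
have Uz : hom1 u z = u (rho *: z) / rho.
  by rewrite /hom1 /hext -/(eucl_norm z) -rhoE rhoE invrK mulrC.
have wE : w = v + y *: (rho *: z) by rewrite /v wy subrK.
have -> : 'D_w (hom1 u) z = 'D_w (hom1 u) (rho *: z) by rewrite derive_hom1Z.
have U1 := isCk_hom1 u1; have oP := @open_punctured R n.+1.
have zn0 := sphere_neq0 zS.
rewrite {1}wE (derive_dirD _ _ oP U1 zn0) derive_dirZ; last exact: isCk_derivable U1 zn0.
rewrite (derive_hom1_radial u1 zS) Uz.
have -> : u (rho *: z) / rho * ((y + K * (1 - dotv e w ^+ 2 / 2 *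
    (s * rho * (s * rho)))) * rho) = (y + K * (1 - y ^+ 2 / 2)) * u (rho *: z).
  rewrite /y; move: (u (rho *: z)) (dotv e w) => a c; field.
  by rewrite gt_eqF.
rewrite mulrDl addrC lerD2l.
apply: le_trans (derive_tangent_le u1 HK zS vz) _.
by rewrite ler_wpM2r ?(ltW (u0 _ zS)) // ler_wpM2l.
Qed.

Lemma parseval (R : realType) n (x v w : 'rV[R]_n.+1) e :
  sphere n x -> tframe x e -> dotv v x = 0 ->
  dotv v w = \sum_i dotv (e i) v * dotv (e i) w.
Proof. by move=> xS xe vx; rewrite {1}(tframe_expand xS xe vx) dotv_suml. Qed.

(* A linear form on the tangent space of norm at most [k], attaining [k] at the
   unit vector [w], is [k] times the scalar product with [w]. *)
Lemma maximal_gradient (R : realType) n (u : 'rV[R]_n.+1 -> R) (K : R)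
  (x w : 'rV[R]_n.+1) e i : CkS 1 u -> 0 <= K -> 0 < u x ->
  (forall y f, sphere n y -> utan y f -> 'D_f (hom1 u) y <= K * u y) ->
  sphere n x -> tframe x e -> utan x w -> 'D_w (hom1 u) x = K * u x ->
  'D_(e i) (hom1 u) x = K * u x * dotv (e i) w.
Proof.
move=> u1 K0 ux HK xS xe [ww wx] Dw; have [ee ex] := xe.
have oP := @open_punctured R n.+1; have U1 := isCk_hom1 u1; have x0 := sphere_neq0 xS.
pose a j := 'D_(e j) (hom1 u) x; pose c j := dotv (e j) w; set k := K * u x in Dw *.
have k0 : 0 <= k by rewrite mulr_ge0 // ltW.
have ac : \sum_j c j * a j = k.
  by rewrite -Dw {1}(tframe_expand xS xe wx) (derive_dir_sum _ _ oP U1 x0).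
have cc : \sum_j c j ^+ 2 = 1.
  by rewrite -ww (parseval _ xS xe wx); apply: eq_bigr => j _; rewrite expr2.
(* The linear form is tested on the vector [v] that represents it, which gives [|a|^2 <= k |a|]. *)
have aa : \sum_j a j ^+ 2 <= k ^+ 2.
  pose v := \sum_j a j *: e j.
  have vx : dotv v x = 0 by rewrite dotv_suml big1 // => j _; rewrite ex mulr0.
  have av : \sum_j a j ^+ 2 = 'D_v (hom1 u) x.
    by rewrite (derive_dir_sum _ _ oP U1 x0); apply: eq_bigr => j _; rewrite expr2.
  have vv : dotv v v = \sum_j a j ^+ 2.
    rewrite dotv_suml; apply: eq_bigr => j _; rewrite dotvC dotv_suml (bigD1 j) //=.
    rewrite ee eqxx mulr1 big1 ?addr0 ?expr2 // => j' jj.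
    by rewrite ee (negPf jj) mulr0.
  have := derive_tangent_le u1 HK xS vx; rewrite -av -vv -eucl_norm_sqr.
  rewrite mulrAC -/k expr2; have := sqrtr_ge0 (dotv v v); rewrite -/(eucl_norm v).
  set N := eucl_norm v => N0 NN.
  have [->|Nn0] := eqVneq N 0; first by rewrite mulr0 sqr_ge0.
  have Np : 0 < N by rewrite lt0r Nn0.
  have Nk : N <= k by rewrite -(ler_pM2r Np).
  by rewrite -expr2 lerXn2r.
have S0 : \sum_j (a j - k * c j) ^+ 2 = 0.
  apply/le_anti/andP; split; last by apply: sumr_ge0 => j _; apply: sqr_ge0.
  have -> : \sum_j (a j - k * c j) ^+ 2 =
      \sum_j a j ^+ 2 - 2 * k * (\sum_j c j * a j) + k ^+ 2 * \sum_j c j ^+ 2.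
    rewrite !mulr_sumr -sumrB -big_split /=; apply: eq_bigr => j _.
    by move: (a j) (c j) => p q; ring.
  by rewrite ac cc; lra.
have /eqP := S0; rewrite psumr_eq0; last by move=> j _; apply: sqr_ge0.
move=> /allP/(_ i (mem_index_enum _)); rewrite /= sqrf_eq0 subr_eq0 => /eqP.
by rewrite /a /c.
Qed.

(** After commuting, the left side is the second derivative along [e i] of [D_w U], which
    [gradient_jet_bound] touches from above at [x]. With [c = e_i . w], the direct terms give
    [- K u (1 + c^2)], and the cross term [2 K u c^2] from [maximal_gradient] turns this into
    [- K u (1 - c^2)]. Nothing is gained in the direction [w] itself, so the weights must not
    concentrate there. *)
Lemma gradient_third_order (R : realType) n (u : 'rV[R]_n.+1 -> R) (K : R)
  (x w : 'rV[R]_n.+1) e i : CkS 4 u -> 0 <= K ->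
  (forall y, sphere n y -> 0 < u y) ->
  (forall y f, sphere n y -> utan y f -> 'D_f (hom1 u) y <= K * u y) ->
  sphere n x -> tframe x e -> utan x w -> 'D_w (hom1 u) x = K * u x ->
  'D_w ('D_(e i) ('D_(e i) (hom1 u))) x <=
  K * (hess (hom1 u) x (e i) (e i) - u x * (1 - dotv (e i) w ^+ 2)).
Proof.
move=> u4 K0 u0 HK xS xe xw Dw; have [ee ex] := xe.
have oP := @open_punctured R n.+1; have U4 := isCk_hom1 u4; have x0 := sphere_neq0 xS.
have u1 : CkS 1 u by apply: isCk_le u4.
have U3 := isCk_le oP (leqnSn 3) U4; have U2 := isCk_le oP (leqnSn 2) U3.
have xei : utan x (e i) by split; rewrite ?ee ?eqxx.
rewrite (derive_commute3 _ _ oP U3 x0).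
have JU := jet2_line (e i) oP U2 x0.
have JD := jet2_line (e i) oP (isCk_derive w U3) x0.
have grad := maximal_gradient i u1 K0 (u0 _ xS) HK xS xe xw Dw.
rewrite (hom1_sphere _ xS) grad -/(hess (hom1 u) x (e i) (e i)) in JU.
rewrite Dw in JD; set c := dotv (e i) w in grad JU *.
have Js := @jet2_sine R.
have Jk := jet2M (jet2D (jet2Z c Js) (jet2Z K (jet2B (jet2_cst 1)
  (jet2Z (c ^+ 2 / 2) (jet2M Js Js))))) (@jet2_rinv R).
have := jet2_min (jet2B (jet2M JU Jk) JD).
move: (hess _ _ _ _) (u x) ('D_(e i) ('D_(e i) _) x) => H ux D /(_ _)[].
  near=> t; apply: le_trans (_ : 0 <= _).
    by rewrite le_eqVlt; apply/orP; left; apply/eqP; ring.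
  by rewrite subr_ge0; apply: gradient_jet_bound.
by move=> _; nra.
Unshelve. all: by end_near.
Qed.

(** The [c i ^+ 2] average the weights, none of which exceeds half the total; so at least half of
    the total survives the loss in the direction [w]. *)
Lemma weighted_sum_bound (R : realType) (I : finType) (g c : I -> R) :
  (forall j, 2 * g j <= \sum_i g i) -> \sum_i c i ^+ 2 = 1 ->
  (\sum_i g i) / 2 <= \sum_i g i * (1 - c i ^+ 2).
Proof.
move=> g2 c1; set G := \sum_i g i in g2 *.
have -> : \sum_i g i * (1 - c i ^+ 2) = G - \sum_i g i * c i ^+ 2.
  by rewrite -sumrB; apply: eq_bigr => i _; rewrite mulrBr mulr1.
have : \sum_i g i * c i ^+ 2 <= \sum_i G / 2 * c i ^+ 2.
  by apply: ler_sum => i _; rewrite ler_wpM2r ?sqr_ge0 //; have := g2 i; lra.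
by rewrite -mulr_sumr c1; lra.
Qed.

Lemma sphere_phi_derivatives (R : realType) n P k l (eps m0 M0 : R)
  (phi u : 'rV[R]_n.+1 -> R) (x w : 'rV[R]_n.+1) :
  solution_data P k l eps m0 M0 phi u -> sphere n x -> utan x w ->
  `|'D_w (hext phi) x / phi x| <= M0 / m0 /\
  `|'D_w ('D_w (hext phi)) x / phi x| <= M0 / m0.
Proof.
move=> H xS xw; have [_ [D1 D2]] := sd_phi_bound H xS.
have m00 := sd_m0 H; have px := sd_phi_gt0 H xS; have mp := sd_phi_ge H xS.
have b (a : R) : `|a| <= M0 -> `|a / phi x| <= M0 / m0.
  move=> aM; rewrite normrM normfV (gtr0_norm px).
  apply: ler_pM => //; first by rewrite invr_ge0 ltW.
  by rewrite lef_pV2.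
by split; apply: b; [exact: D1|exact: D2].
Qed.

Lemma jet2_log_solution (R : realType) n P k l (eps m0 M0 : R)
  (phi u : 'rV[R]_n.+1 -> R) (x w : 'rV[R]_n.+1) :
  solution_data P k l eps m0 M0 phi u -> sphere n x -> utan x w ->
  let D := (k - l)%:R + eps in
  jet2 (fun t => D * ln (hext u (x + t *: w)) + ln (hext phi (x + t *: w)) -
                 (D * ln (u x) + ln (phi x))) 0
    (D * ('D_w (hext u) x / u x) + 'D_w (hext phi) x / phi x)
    (D * ('D_w ('D_w (hext u)) x / u x - ('D_w (hext u) x / u x) ^+ 2) +
     ('D_w ('D_w (hext phi)) x / phi x - ('D_w (hext phi) x / phi x) ^+ 2)).
Proof.
move=> H xS xw D; have oP := @open_punctured R n.+1; have x0 := sphere_neq0 xS.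
have Ju := jet2_line w oP (CkS_isCk (sd_u2 H)) x0.
have Jp := jet2_line w oP (CkS_isCk (sd_phi2 H)) x0.
rewrite (hext_sphere _ xS) in Ju; rewrite (hext_sphere _ xS) in Jp.
have J := jet2B (jet2D (jet2Z D (jet2_ln (sd_u_gt0 H xS) Ju))
  (jet2_ln (sd_phi_gt0 H xS) Jp)) (jet2_cst (D * ln (u x) + ln (phi x))).
by apply: (eq_jet2_coef J); rewrite ?subr0 ?subrr.
Qed.

(** Here [a = m0 / M0], [b = M0 / m0], [y] is [u] times the total weight and [q] is the logarithmic
    derivative of [phi]. The term [d K] cancels, and [K eps] stays on the left. *)
Lemma gradient_arith (R : realType) (d K a y eps q b : R) :
  d * K * a <= d * K * y -> (d + eps) * K + q <= d * (K * (1 - y / 2)) ->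
  - b <= q -> K * (eps + d * (a / 2)) <= b.
Proof. by nra. Qed.

Lemma gradient_estimate (R : realType) n P k l (eps m0 M0 : R)
  (phi u : 'rV[R]_n.+1 -> R) : solution_data P k l eps m0 M0 phi u ->
  exists K : R, [/\ 0 <= K, K * (eps + (k - l)%:R * (m0 / M0 / 2)) <= M0 / m0 &
    forall y f, sphere n y -> utan y f -> 'D_f (hom1 u) y <= K * u y].
Proof.
move=> H; have u2 := sd_u2 H; have oP := @open_punctured R n.+1.
have u1 : CkS 1 u by apply: isCk_le u2.
have [x [w [K [xS xw K0 Dw HK]]]] := log_gradient_max (sd_n H) u2 (sd_u_gt0 H).
exists K; split => //; have ux := sd_u_gt0 H xS; have /andP[lk _] := sd_kl H.
have [ww wx] := xw.
have [e [lam [xe le He]]] := principal_frame u2 xS.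
have [g [g0 glam g2 gkap gB]] := ratioL_matrix (sd_P H) (sd_kl H) (sd_adm H xS xe le).
have low := weight_lower H xS xe le g0 gkap.
have cmp := log_comparison lk u2 (sd_u_gt0 H) (fun y yS => sd_phi_gt0 H yS)
  (sd_adm H) (sd_sol H) xS xe xw le gB.
have JL := jet2_log_solution H xS xw.
have S1 : \sum_i g i * hess (hom1 u) x (e i) (e i) = 1.
  by rewrite -glam; apply: eq_bigr => i _; rewrite He eqxx mul1r.
have JS := eq_jet2_coef (jet2_sum (fun i => jet2Z (g i)
  (jet2_rotated_entry w (e i) (sd_u4 H) (sphere_neq0 xS)))) S1 erefl erefl.
(* The comparison is tight at [t = 0], so the first derivatives of its two sides coincide; this
   plays the part of the differentiated equation. *)
have [|b0 _] := jet2_min (jet2B (jet2Z (k - l)%:R (jet2B JS (jet2_cst 1))) JL).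
  by rewrite subrr mulr0 subrr; near=> t; rewrite subr_ge0; apply: cmp.
move: b0; rewrite subr0 => /eqP; rewrite subr_eq0 => /eqP.
rewrite -(derive_hom1_tangent u1 xS wx) Dw mulfK ?gt_eqF //.
have [Dphi _] := sphere_phi_derivatives H xS xw.
have Dphi' : - (M0 / m0) <= 'D_w (hext phi) x / phi x by have := Dphi; rewrite ler_norml => /andP[].
move: ('D_w (hext phi) x / phi x) Dphi' => q qM E.
have le3 : \sum_i g i * 'D_w ('D_(e i) ('D_(e i) (hom1 u))) x <=
    K * (1 - u x * ((\sum_i g i) / 2)).
  apply: le_trans (_ : \sum_i g i * (K * (hess (hom1 u) x (e i) (e i) -
      u x * (1 - dotv (e i) w ^+ 2))) <= _).
    apply: ler_sum => i _; rewrite ler_wpM2l //.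
    exact: gradient_third_order (sd_u4 H) K0 (sd_u_gt0 H) HK xS xe xw Dw.
  have -> : \sum_i g i * (K * (hess (hom1 u) x (e i) (e i) -
      u x * (1 - dotv (e i) w ^+ 2))) =
      K * (\sum_i g i * hess (hom1 u) x (e i) (e i) -
           u x * \sum_i g i * (1 - dotv (e i) w ^+ 2)).
    rewrite mulr_sumr -sumrB mulr_sumr; apply: eq_bigr => i _.
    by move: (hess _ _ _ _) (dotv _ _) => p r; ring.
  rewrite S1 ler_wpM2l // lerD2l lerN2 ler_pM2l //.
  apply: weighted_sum_bound => //.
  by rewrite -ww (parseval _ xS xe wx); apply: eq_bigr => i _; rewrite expr2.
set d := (k - l)%:R in E *; have d0 : 0 <= d by rewrite ler0n.
have : d * (\sum_i g i * 'D_w ('D_(e i) ('D_(e i) (hom1 u))) x) <=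
  d * (K * (1 - u x * ((\sum_i g i) / 2))) by rewrite ler_wpM2l.
rewrite E; set y := u x * _ in low *.
have -> : u x * ((\sum_i g i) / 2) = y / 2 by rewrite mulrA.
have low' : d * K * (m0 / M0) <= d * K * y by rewrite ler_wpM2l // mulr_ge0.
by move=> E'; exact: gradient_arith low' E' qM.
Unshelve. all: by end_near.
Qed.

(** * Harnack inequality *)

Lemma derive_hext_le (R : realType) n (u : 'rV[R]_n.+1 -> R) (K : R)
  (z w : 'rV[R]_n.+1) : CkS 1 u -> 0 <= K ->
  (forall y, sphere n y -> 0 < u y) ->
  (forall y f, sphere n y -> utan y f -> 'D_f (hom1 u) y <= K * u y) ->
  z != 0 -> 'D_w (hext u) z <= K * (eucl_norm w / eucl_norm z) * hext u z.
Proof.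
move=> u1 K0 u0 HK z0; have r0 : 0 < eucl_norm z by rewrite eucl_norm_gt0.
have oP := @open_punctured R n.+1; have h1 := CkS_isCk u1.
set y := (eucl_norm z)^-1 *: z; have yS : sphere n y by apply: sphere_normalize.
have y0 := sphere_neq0 yS.
have [vy vv] := tangential_part w yS; set v := w - _ in vy vv.
have -> : 'D_w (hext u) z = (eucl_norm z)^-1 * 'D_v (hext u) y.
  have -> : 'D_v (hext u) y = 'D_w (hext u) y.
    have wE : w = v + dotv w y *: y by rewrite /v subrK.
    rewrite [in RHS]wE (derive_dirD _ _ oP h1 y0) derive_dirZ; last exact: isCk_derivable h1 y0.
    by rewrite derive_hext_radial mulr0 addr0.
  rewrite /y (@derive_homogeneous R _ _ z w (eucl_norm z)^-1 1) ?invr_gt0 //.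
  - by rewrite div1r invrK mulKf // gt_eqF.
  - by move=> y' _; rewrite mul1r hextZ // invr_gt0.
  - exact: isCk_derivable h1 z0.
rewrite -(derive_hom1_tangent u1 yS vy).
have vw : eucl_norm v <= eucl_norm w.
  by rewrite ler_sqrt ?dotv_ge0 // vv gerBl sqr_ge0.
have -> : hext u z = u y by [].
have -> : K * (eucl_norm w / eucl_norm z) * u y =
    (eucl_norm z)^-1 * (K * eucl_norm w * u y).
  by move: (eucl_norm z)^-1 (u y) (eucl_norm w) => p q r; ring.
rewrite ler_pM2l ?invr_gt0 //; apply: le_trans (derive_tangent_le u1 HK yS vy) _.
by rewrite ler_wpM2r ?(ltW (u0 _ yS)) // ler_wpM2l.
Qed.

(** A chord replaces the geodesic, since [hext u] is constant on rays. When [x . y >= 0], the chord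
    has length at most [sqrt 2] and stays at distance at least [1 / sqrt 2] from the origin, so the
    logarithmic derivative along it is at most [2 K]. *)
Lemma harnack_acute (R : realType) n (u : 'rV[R]_n.+1 -> R) (K : R)
  (x y : 'rV[R]_n.+1) : CkS 1 u -> 0 <= K ->
  (forall y, sphere n y -> 0 < u y) ->
  (forall y f, sphere n y -> utan y f -> 'D_f (hom1 u) y <= K * u y) ->
  sphere n x -> sphere n y -> 0 <= dotv x y -> ln (u x) - ln (u y) <= 2 * K.
Proof.
move=> u1 K0 u0 HK xS yS xy0.
have [w wE] : exists w : 'rV[R]_n.+1, w = x - y by exists (x - y).
have xx : dotv x x = 1 := xS; have yy : dotv y y = 1 := yS.
have ww : dotv w w = 2 - 2 * dotv x y.
  by rewrite wE !(dotvDl, dotvDr, dotvNl, dotvNr) xx yy (dotvC y x); ring.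
have yw : dotv y w = dotv x y - 1 by rewrite wE dotvDr dotvNr yy dotvC.
have zz s : dotv (y + s *: w) (y + s *: w) =
    1 - 2 * (s * (1 - s)) * (1 - dotv x y).
  rewrite !(dotvDl, dotvDr, dotvZl, dotvZr) ww yy (dotvC w y) yw.
  by ring.
have zw s : dotv w w <= 4 * dotv (y + s *: w) (y + s *: w).
  rewrite ww zz; have := dotv_ge0 w; rewrite ww; have := sqr_ge0 (s - 1 / 2).
  by move: (dotv x y) xy0 => a; nra.
have zpos s : 0 < dotv (y + s *: w) (y + s *: w).
  rewrite zz; have := dotv_ge0 w; rewrite ww; have := sqr_ge0 (s - 1 / 2).
  by move: (dotv x y) xy0 => a; nra.
have z0 s : y + s *: w != 0 by rewrite -dotv_gt0.
have hpos (s : R) : 0 < hext u (y + s *: w) by apply: u0; apply: sphere_normalize.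
have d (s : R) : is_derive s 1 (fun s => ln (hext u (y + s *: w)))
    ((hext u (y + s *: w))^-1 * 'D_w (hext u) (y + s *: w)).
  apply: (@is_derive1_comp R (@ln R) (fun s => hext u (y + s *: w))).
    exact: is_derive1_ln.
  by apply: is_derive_line; exact: isCk_derivable (CkS_isCk u1) (z0 s).
have [|s _] := @MVT R _ _ 0 1 ltr01 (fun s _ => d s).
  by apply: derivable_within_continuous => s _; have [] := d s.
have yx : y + w = x by rewrite wE addrC subrK.
rewrite scale1r scale0r addr0 yx subr0 mulr1 (hext_sphere _ xS) (hext_sphere _ yS) => ->.
rewrite mulrC ler_pdivrMr //.
apply: le_trans (derive_hext_le w u1 K0 u0 HK (z0 s)) _.
rewrite ler_pM2r // [2 * K]mulrC ler_wpM2l // ler_pdivrMr ?eucl_norm_gt0 //.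
have -> : 2 * eucl_norm (y + s *: w) = Num.sqrt (4 * dotv (y + s *: w) (y + s *: w)).
  rewrite sqrtrM // (_ : 4 = 2 ^+ 2); last by ring.
  by rewrite sqrtr_sqr ger0_norm.
by rewrite ler_sqrt // mulr_ge0 // ltW.
Qed.

Lemma harnack (R : realType) n (u : 'rV[R]_n.+1 -> R) (K : R)
  (x y : 'rV[R]_n.+1) : (0 < n)%N -> CkS 1 u -> 0 <= K ->
  (forall y, sphere n y -> 0 < u y) ->
  (forall y f, sphere n y -> utan y f -> 'D_f (hom1 u) y <= K * u y) ->
  sphere n x -> sphere n y -> u x <= expR (4 * K) * u y.
Proof.
move=> n0 u1 K0 u0 HK xS yS.
(* Two acute steps cost [2 K] each. The intermediate point is a unit vector orthogonal to [x], with
   the sign that makes its product with [y] nonnegative. *)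
suff [z [zS xz zy]] : exists z, [/\ sphere n z, 0 <= dotv x z & 0 <= dotv z y].
  have h1 := harnack_acute u1 K0 u0 HK xS zS xz.
  have h2 := harnack_acute u1 K0 u0 HK zS yS zy.
  rewrite -[u x]lnK ?posrE ?u0 // -[u y]lnK ?posrE ?u0 // -expRD ler_expR; lra.
have [e [ee ex]] := tframe_exists xS; pose f := e (Ordinal n0).
have ff : dotv f f = 1 by rewrite ee eqxx.
have xf : dotv x f = 0 by rewrite dotvC; exact: ex.
have [fy|/ltW fy] := lerP 0 (dotv f y).
  by exists f; rewrite xf; split.
exists (- f); split; rewrite /sphere /= ?(dotvNl, dotvNr) ?opprK //.
  by rewrite xf oppr0.
by rewrite oppr_ge0.
Qed.

(** * Second-order estimate *)

Lemma hess_tangent_le (R : realType) n (u : 'rV[R]_n.+1 -> R) (L : R)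
  (x v : 'rV[R]_n.+1) : CkS 2 u ->
  (forall y f, sphere n y -> utan y f -> hess (hom1 u) y f f <= L) ->
  sphere n x -> dotv v x = 0 -> hess (hom1 u) x v v <= L * dotv v v.
Proof.
move=> u2 HL xS vx; have x0 := sphere_neq0 xS.
have oP := @open_punctured R n.+1; have U2 := isCk_hom1 u2.
have [v0|v0] := eqVneq v 0.
  have -> : dotv v v = 0 by apply/eqP; rewrite dotv_eq0 v0.
  by rewrite v0 mulr0 /hess derive0.
have N0 : 0 < eucl_norm v by rewrite eucl_norm_gt0.
have utv : utan x ((eucl_norm v)^-1 *: v).
  split; last by rewrite dotvZl vx mulr0.
  exact: (sphere_normalize v0).
have := HL _ _ xS utv; rewrite (hessZl _ _ _ oP U2 x0) (hessZr _ _ _ oP U2 x0).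
by rewrite mulrA -expr2 exprVn eucl_norm_sqr mulrC ler_pdivrMr // dotv_gt0.
Qed.

(** At [z = x + s e], homogeneity of degree [-1] contributes [rho = 1 / |z|], and the Hessian sees
    only the tangential part of [w], of squared length [1 - (w . rho z)^2]. *)
Lemma hessian_jet_bound (R : realType) n (u : 'rV[R]_n.+1 -> R) (L : R)
  (x w e : 'rV[R]_n.+1) : CkS 2 u ->
  (forall y f, sphere n y -> utan y f -> hess (hom1 u) y f f <= L) ->
  sphere n x -> utan x w -> utan x e ->
  forall s rho : R, rho = (Num.sqrt (1 + s ^+ 2))^-1 ->
  hess (hom1 u) (x + s *: e) w w <=
    L * (rho - dotv e w ^+ 2 * (s * rho * (s * rho) * rho)).
Proof.
move=> u2 HL xS [ww wx] xe s rho rhoE0.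
have z0 := line_neq0 s xS xe; have rE := eucl_norm_line s xS xe.
set z := x + s *: e in z0 rE *.
have r0 : 0 < eucl_norm z by rewrite eucl_norm_gt0.
have rhoE : rho = (eucl_norm z)^-1 by rewrite rE.
have rho0 : 0 < rho by rewrite rhoE invr_gt0.
have zS : sphere n (rho *: z) by rewrite rhoE; apply: sphere_normalize.
have wy : dotv w (rho *: z) = dotv e w * (s * rho).
  by rewrite dotvZr /z dotvDr dotvZr wx (dotvC w e); ring.
have [vz vv] := tangential_part w zS; set v := w - _ in vz vv.
rewrite ww wy in vv.
have zE : z = rho^-1 *: (rho *: z) by rewrite scalerA mulVf ?scale1r // gt_eqF.
rewrite zE hess_hom1Z ?invr_gt0 ?sphere_neq0 // invrK.
rewrite -(hess_hom1_mod_radial w (dotv w (rho *: z)) u2 (sphere_neq0 zS)) -/v.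
have -> : L * (rho - dotv e w ^+ 2 * (s * rho * (s * rho) * rho)) =
    rho * (L * dotv v v) by rewrite vv; ring.
by rewrite ler_pM2l //; apply: hess_tangent_le.
Qed.

(** At [0] the second derivative of [rho] is [-1] and that of [(s rho)^2 rho] is [2]; as the bound
    is attained there, its second derivative dominates that of [f]. *)
Lemma second_order_touching (R : realType) (f : R -> R) (L b D c : R) :
  jet2 f L b D ->
  (forall s rho : R, rho = (Num.sqrt (1 + s ^+ 2))^-1 ->
    f s <= L * (rho - c ^+ 2 * (s * rho * (s * rho) * rho))) ->
  D <= - L * (1 + 2 * c ^+ 2).
Proof.
move=> J bound; have Js := @jet2_sine R; have Jr := @jet2_rinv R.
have JB := jet2Z L (jet2B Jr (jet2Z (c ^+ 2) (jet2M (jet2M Js Js) Jr))).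
have [|_ +] := jet2_min (jet2B JB J); last by lra.
near=> t; apply: (@le_trans _ _ 0).
  by rewrite le_eqVlt; apply/orP; left; apply/eqP; ring.
by rewrite subr_ge0; apply: bound.
Unshelve. all: by end_near.
Qed.

(** Commuting the derivatives exhibits the left side as a second derivative along [e] of a function
    that [hessian_jet_bound] touches from above at [x]. *)
Lemma hessian_fourth_order (R : realType) n (u : 'rV[R]_n.+1 -> R)
  (x w e : 'rV[R]_n.+1) : CkS 4 u -> sphere n x -> utan x w -> utan x e ->
  (forall y f, sphere n y -> utan y f -> hess (hom1 u) y f f <= hess (hom1 u) x w w) ->
  'D_w ('D_w ('D_e ('D_e (hom1 u)))) x <=
  - hess (hom1 u) x w w * (1 + 2 * dotv e w ^+ 2).
Proof.
move=> u4 xS xw xe HL; have x0 := sphere_neq0 xS.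
have oP := @open_punctured R n.+1; have U4 := isCk_hom1 u4.
have u2 : CkS 2 u by apply: isCk_le u4.
rewrite (derive_commute4 _ _ oP U4 x0).
have J : jet2 (fun t => hess (hom1 u) (x + t *: e) w w) (hess (hom1 u) x w w)
    ('D_e ('D_w ('D_w (hom1 u))) x) ('D_e ('D_e ('D_w ('D_w (hom1 u)))) x).
  exact: jet2_line e oP (isCk_derive w (isCk_derive w U4)) x0.
exact: second_order_touching J (hessian_jet_bound u2 HL xS xw xe).
Qed.

(** The boolean tells whether the frame vector is the maximizing one. If so, the cross term [2 L]
    from the rotation exactly offsets the extra [-2 L] of the fourth-order bound. *)
Lemma fourth_order_arith (R : realType) (D L m : R) (b : bool) :
  (b -> m = L) -> D <= - L * (1 + 2 * b%:R ^+ 2) ->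
  D + 2 * b%:R * (b%:R * m) + m <= m - L.
Proof. by case: b => [->//|_]; rewrite ?mulr1n ?mulr0n; lra. Qed.

Lemma hessian_arith (R : realType) (d L G ux a b eps K h p q : R) :
  1 <= d -> 0 < ux -> ux < L -> 0 < a -> a <= ux * G -> a * b = 1 -> 0 < eps ->
  h = L - ux -> `|p| <= K -> `|q| <= b -> forall r, `|r| <= b ->
  (d + eps) * (h / ux - p ^+ 2) + (r - q ^+ 2) <= d * (1 - L * G) ->
  L <= ux * (b * (1 + (d + eps) * K ^+ 2 + b + b ^+ 2)).
Proof.
move=> d1 u0 uL a0 aG ab e0 -> pK qb r rb H.
have b0 : 0 < b by rewrite -(pmulr_rgt0 b a0) ab.
have p2 : p ^+ 2 <= K ^+ 2.
  by rewrite -[p ^+ 2]real_normK ?num_real // lerXn2r // nnegrE ?(le_trans _ pK).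
have q2 : q ^+ 2 <= b ^+ 2 by rewrite -[q ^+ 2]real_normK ?num_real // lerXn2r // nnegrE ?ltW.
have r1 : - b <= r by move: rb; rewrite ler_norml => /andP[].
have h0 : 0 <= (L - ux) / ux by rewrite divr_ge0 ?subr_ge0 // ltW.
have d0 : 0 < d by lra.
have de : 0 < d + eps by lra.
set X := (d + eps) * K ^+ 2 + b + b ^+ 2.
have X0 : 0 <= X.
  apply: addr_ge0; last exact: sqr_ge0.
  apply: addr_ge0; last exact: ltW.
  by apply: mulr_ge0; [exact: ltW|exact: sqr_ge0].
have H1 : d * (L * G) <= d + X.
  have := ler_wpM2l (ltW de) p2; have := mulr_ge0 (ltW de) h0; rewrite /X; lra.
have H2 : L * G <= 1 + X.
  rewrite -(ler_pM2l d0); apply: le_trans H1 _.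
  by rewrite mulrDr mulr1 lerD2l ler_peMl.
have L0 : 0 < L by apply: lt_trans uL.
have H3 : L * a <= ux * (1 + X).
  apply: le_trans (_ : L * (ux * G) <= _); first by rewrite ler_pM2l.
  by rewrite mulrCA ler_pM2l.
rewrite [X in _ * (_ * X)](_ : _ = 1 + X); last by rewrite /X; ring.
have -> : L = L * a * b by rewrite -mulrA ab mulr1.
by rewrite [leRHS](_ : _ = ux * (1 + X) * b) ?ler_pM2r //; ring.
Qed.

Lemma hessian_estimate (R : realType) n P k l (eps m0 M0 K : R)
  (phi u : 'rV[R]_n.+1 -> R) : solution_data P k l eps m0 M0 phi u -> 0 <= K ->
  (forall y f, sphere n y -> utan y f -> 'D_f (hom1 u) y <= K * u y) ->
  exists2 x, sphere n x & forall y f, sphere n y -> utan y f ->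
    hess (hom1 u) y f f <= u x *
      (M0 / m0 * (1 + ((k - l)%:R + eps) * K ^+ 2 + M0 / m0 + (M0 / m0) ^+ 2)).
Proof.
move=> H K0 HK; have u2 := sd_u2 H; have oP := @open_punctured R n.+1.
have u1 : CkS 1 u by apply: isCk_le u2.
have [x [w0 [xS xw0 HL]]] := hessian_max (sd_n H) u2.
exists x => // y f yS yf; apply: le_trans (HL y f yS yf) _ => {y f yS yf}.
have ux := sd_u_gt0 H xS; have /andP[lk _] := sd_kl H; have x0 := sphere_neq0 xS.
have U2 := isCk_hom1 u2.
have [e [lam [xe le He]]] := principal_frame u2 xS; have [ee ex] := xe.
have [w0w0 w0x] := xw0.
pose i1 := Ordinal (sd_n H).
have [i0 _ imax] := @arg_maxP _ _ _ i1 predT lam isT.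
have uei i : utan x (e i) by split; rewrite ?ee ?eqxx.
have lamE i : hess (hom1 u) x (e i) (e i) = lam i by rewrite He eqxx mul1r.
(* The maximizing direction realizes the largest eigenvalue and may be replaced by a vector of the
   principal frame, for which the mixed Hessian terms vanish. *)
have top : hess (hom1 u) x w0 w0 = lam i0.
  apply/le_anti/andP; split; last by rewrite -lamE; apply: HL.
  have -> : hess (hom1 u) x w0 w0 = \sum_i dotv (e i) w0 ^+ 2 * lam i.
    rewrite {1 2}(tframe_expand xS xe w0x) (hess_sum _ _ _ _ oP U2 x0).
    apply: eq_bigr => i _; rewrite (bigD1 i) //= big1 ?addr0.
      by rewrite lamE expr2.
    by move=> j ji; rewrite He eq_sym (negPf ji) mul0r mulr0.
  have -> : lam i0 = \sum_i dotv (e i) w0 ^+ 2 * lam i0.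
    rewrite -mulr_suml; suff -> : \sum_i dotv (e i) w0 ^+ 2 = 1 by rewrite mul1r.
    by rewrite -w0w0 (parseval _ xS xe w0x); apply: eq_bigr => i _; rewrite expr2.
  by apply: ler_sum => i _; rewrite ler_wpM2l ?sqr_ge0 //; apply: imax.
rewrite top; set w := e i0; have xw : utan x w := uei i0; have [ww wx] := xw.
have HL' y f : sphere n y -> utan y f -> hess (hom1 u) y f f <= hess (hom1 u) x w w.
  by move=> yS yf; rewrite /w lamE -top; apply: HL.
have [g [g0 glam g2 gkap gB]] := ratioL_matrix (sd_P H) (sd_kl H) (sd_adm H xS xe le).
have low := weight_lower H xS xe le g0 gkap.
have m00 := sd_m0 H; have mM := sd_m0_le_M0 H; have M00 := lt_le_trans m00 mM.
have b1 : 1 <= M0 / m0 by rewrite ler_pdivlMr ?mul1r.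
set b := M0 / m0 in b1 *.
(* If the top eigenvalue is at most [u], the bound holds because its factor is at least [1];
   otherwise the sign needed in [hessian_arith] is available. *)
have [Lu|Lu] := lerP (lam i0) (u x).
  apply: le_trans Lu _; rewrite ler_peMr ?ltW //.
  have : 0 <= ((k - l)%:R + eps) * K ^+ 2.
    by rewrite mulr_ge0 ?sqr_ge0 // addr_ge0 // ltW // (sd_eps H).
  by move: (_ * K ^+ 2) => Y; nra.
have cmp := log_comparison lk u2 (sd_u_gt0 H) (fun y yS => sd_phi_gt0 H yS)
  (sd_adm H) (sd_sol H) xS xe xw le gB.
have JL := jet2_log_solution H xS xw.
have S1 : \sum_i g i * hess (hom1 u) x (e i) (e i) = 1.
  by rewrite -glam; apply: eq_bigr => i _; rewrite lamE.
have JS := eq_jet2_coef (jet2_sum (fun i => jet2Z (g i)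
  (jet2_rotated_entry w (e i) (sd_u4 H) x0))) S1 erefl erefl.
have [|_] := jet2_min (jet2B (jet2Z (k - l)%:R (jet2B JS (jet2_cst 1))) JL).
  by rewrite subrr mulr0 subrr; near=> t; rewrite subr_ge0; apply: cmp.
rewrite subr0 subr_ge0 => cmp2.
have S2 : \sum_i g i * ('D_w ('D_w ('D_(e i) ('D_(e i) (hom1 u)))) x +
    2 * dotv (e i) w * hess (hom1 u) x (e i) w + hess (hom1 u) x (e i) (e i)) <=
    1 - lam i0 * \sum_i g i.
  have -> : 1 - lam i0 * \sum_i g i = \sum_i g i * (lam i - lam i0).
    rewrite -glam mulr_sumr -sumrB; apply: eq_bigr => i _.
    by rewrite mulrBr [lam i0 * _]mulrC.
  apply: ler_sum => i _; rewrite ler_wpM2l //.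
  have := hessian_fourth_order (sd_u4 H) xS xw (uei i) HL'.
  rewrite /w !lamE He ee.
  by apply: fourth_order_arith => /eqP ->.
have /= cmp3 := le_trans cmp2 (ler_wpM2l (ler0n R (k - l)) S2).
have [Dp DDp] := sphere_phi_derivatives H xS xw.
have hE : 'D_w ('D_w (hext u)) x = lam i0 - u x.
  have := hess_hom1 u2 xS wx wx; rewrite ww mul1r lamE => ->.
  by rewrite addrK.
have gradK : `|'D_w (hext u) x / u x| <= K.
  rewrite -(derive_hom1_tangent u1 xS wx) normrM normfV (gtr0_norm ux) ler_pdivrMr //.
  rewrite ler_norml HK // andbT lerNl.
  have xNw : utan x (- w) by split; rewrite !(dotvNl, dotvNr) ?opprK // wx oppr0.
  have := HK _ _ xS xNw; rewrite -scaleN1r derive_dirZ ?mulN1r //.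
  exact: isCk_derivable U2 x0.
apply: (hessian_arith _ ux Lu _ low _ (sd_eps H) hE gradK Dp DDp cmp3).
- by rewrite ler1n subn_gt0.
- by rewrite divr_gt0.
- by rewrite /b; field; rewrite !gt_eqF.
Unshelve. all: by end_near.
Qed.

(** * Two-sided bounds and the final constant *)

Lemma trace_gt0 (R : realType) n P (lam : 'I_n -> R) :
  0 < sigmaL P 1 lam -> 0 < \sum_i lam i.
Proof.
rewrite /sigmaL esym1 => pos.
pose N i : R := \sum_(S in PSets n P | i \in S) 1.
(* A transposition exchanges the [P]-subsets containing [i] with those containing [j], so all
   coordinates are counted equally often and the first symmetric function of [Lambda] is a
   nonnegative multiple of the trace. *)
have NE i j : N i = N j.
  rewrite /N (reindex (fun S : {set 'I_n} => tperm i j @: S)) /=; last first.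
    exists (fun S : {set 'I_n} => tperm i j @: S) => S _; rewrite -imset_comp;
    by rewrite (eq_imset (g := id)) ?imset_id // => k /=; rewrite tpermK.
  apply: eq_bigl => S; rewrite !inE card_imset; last exact: perm_inj.
  congr (_ && _); rewrite -{1}(tpermR i j) mem_imset //; exact: perm_inj.
have E : \sum_(S in PSets n P) LambdaP lam S = \sum_i N i * lam i.
  under [RHS]eq_bigr => i _ do rewrite mulr_suml.
  rewrite (exchange_big_dep (fun S => S \in PSets n P)) /=; last by move=> ? ? _ /andP[].
  apply: eq_bigr => S SP; apply: eq_big => i; first by rewrite SP.
  by rewrite mul1r.
have [c c0 cE] : exists2 c, 0 <= c & forall i, N i = c.
  case: (pickP 'I_n) => [i _|none]; last by exists 0 => // i; have := none i.
  by exists (N i) => //; apply: sumr_ge0.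
move: pos; rewrite E; under eq_bigr => i _ do rewrite cE.
rewrite -mulr_sumr => pos; rewrite ltNge; apply/negP => S0.
by have := mulr_ge0_le0 c0 S0; rewrite leNgt pos.
Qed.

Lemma hess_scale (R : realType) m (f : 'rV[R]_m -> R) (c : R) (x v w : 'rV[R]_m) :
  isCk 2 f punctured -> x != 0 ->
  hess (fun y => f y / c) x v w = hess f x v w / c.
Proof.
move=> f2 x0; rewrite /hess.
have sc (h : 'rV[R]_m -> R) (y a : 'rV[R]_m) : derivable h y a ->
    'D_a (fun z => h z / c) y = 'D_a h y / c.
  move=> dh; transitivity ('D_a (c^-1 \*: h) y).
    by apply: near_eq_derive; near=> z; rewrite mulrC.
  by rewrite (deriveZ c^-1 dh) [RHS]mulrC.
rewrite -sc; last exact: isCk_derivable (isCk_derive w f2) x0.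
apply: near_eq_derive; near=> y; apply: sc.
have y0 : y != 0 by near: y; apply: nbhs_punctured.
exact: isCk_derivable f2 y0.
Unshelve. all: by end_near.
Qed.

Lemma frame_coord_le1 (R : realType) n (x v : 'rV[R]_n.+1) e i :
  sphere n x -> tframe x e -> utan x v -> `|dotv (e i) v| <= 1.
Proof.
move=> xS xe [vv vx].
rewrite -(ler_pXn2r (n := 2)) ?nnegrE // expr1n real_normK ?num_real // -vv.
rewrite (parseval _ xS xe vx) (bigD1 i) //= -expr2 lerDl.
by apply: sumr_ge0 => j _; rewrite -expr2 sqr_ge0.
Qed.

(* The positivity of the trace turns the upper bound into a two-sided one. *)
Lemma hess_two_sided (R : realType) n P k (u : 'rV[R]_n.+1 -> R) (T : R)
  (x v w : 'rV[R]_n.+1) : (0 < k)%N -> CkS 2 u -> admissible P k u -> 0 <= T ->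
  (forall y f, sphere n y -> utan y f -> hess (hom1 u) y f f <= T) ->
  sphere n x -> utan x v -> utan x w ->
  `|hess (hom1 u) x v w| <= n%:R * (n%:R * T).
Proof.
move=> k0 u2 adm T0 HT xS xv xw; have x0 := sphere_neq0 xS.
have [e [lam [xe le He]]] := principal_frame u2 xS; have [ee ex] := xe.
have lamT i : lam i <= T.
  have := HT x (e i) xS; rewrite He eqxx mul1r; apply.
  by split; rewrite ?ee ?eqxx.
have tr : 0 < \sum_i lam i.
  by apply: (@trace_gt0 R n P); apply: (adm x xS e xe lam le).
have lamN i : `|lam i| <= n%:R * T.
  have n1 : T <= n%:R * T by rewrite ler_peMl // ler1n (leq_ltn_trans _ (ltn_ord i)).
  rewrite ler_norml (le_trans (lamT i) n1) andbT.
  move: tr; rewrite (bigD1 i) //=.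
  have : \sum_(j | j != i) lam j <= \sum_(j : 'I_n) T.
    rewrite [leRHS](bigD1 i) //= ler_wpDl //.
    by apply: ler_sum => j _.
  by rewrite sumr_const card_ord -mulr_natl; lra.
have [vv vx] := xv; have [ww wx] := xw.
have -> : hess (hom1 u) x v w = \sum_i dotv (e i) v * dotv (e i) w * lam i.
  rewrite {1}(tframe_expand xS xe vx) {1}(tframe_expand xS xe wx).
  rewrite (hess_sum _ _ _ _ (@open_punctured R _) (isCk_hom1 u2) x0).
  apply: eq_bigr => i _; rewrite (bigD1 i) //= big1 ?addr0.
    by rewrite He eqxx mul1r.
  by move=> j ji; rewrite He eq_sym (negPf ji) mul0r mulr0.
apply: le_trans (ler_norm_sum _ _ _) _.
apply: le_trans (_ : \sum_(i < n) n%:R * T <= _); last first.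
  by rewrite sumr_const card_ord -[leLHS]mulr_natl.
apply: ler_sum => i _; rewrite !normrM -[leRHS]mul1r.
apply: ler_pM; rewrite ?mulr_ge0 //.
rewrite -[leRHS]mul1r; apply: ler_pM => //; apply: frame_coord_le1 xS xe _ => //.
Qed.

Lemma dotv_utan_le (R : realType) n (x v w : 'rV[R]_n.+1) :
  sphere n x -> utan x v -> utan x w -> `|dotv v w| <= n%:R.
Proof.
move=> xS xv xw; have [e xe] := tframe_exists xS; have [vv vx] := xv.
rewrite (parseval w xS xe vx); apply: le_trans (ler_norm_sum _ _ _) _.
apply: le_trans (_ : \sum_(i < n) 1 <= _); last first.
  by rewrite sumr_const card_ord.
apply: ler_sum => i _; rewrite normrM -[leRHS]mul1r.
by apply: ler_pM => //; apply: frame_coord_le1 xS xe _.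
Qed.

(** Here [a = M0 / m0] and [b] is its inverse. The last hypothesis bounds [K eps] by [a] and, after
    multiplication by [a], [K d] by [2 a^2]. Hence [(d + eps) K^2 = (K d) K + (K eps) K] is bounded
    however large [eps] is. *)
Lemma gradient_constants (R : realType) (d K a b eps : R) :
  1 <= d -> 0 < a -> a * b = 1 -> 0 <= K -> 0 < eps ->
  K * (eps + d * (b / 2)) <= a ->
  K <= 2 * a ^+ 2 /\ (d + eps) * K ^+ 2 <= 4 * a ^+ 4 + 2 * a ^+ 3.
Proof.
move=> d1 a0 ab K0 e0 H.
have b0 : 0 < b by rewrite -(pmulr_rgt0 b a0) ab.
have Ke : 0 <= K * eps by rewrite mulr_ge0 // ltW.
have Kdb0 : 0 <= K * d * b by rewrite !mulr_ge0 //; lra.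
have Ke1 : K * eps <= a by nra.
have Kdb : K * d * b <= 2 * a by nra.
have Kd : K * d <= 2 * a ^+ 2.
  have -> : K * d = a * (K * d * b) by rewrite -[LHS]mulr1 -ab; ring.
  by rewrite expr2 [leRHS]mulrCA ler_pM2l.
have K1 : K <= 2 * a ^+ 2.
  by apply: le_trans Kd; rewrite ler_peMr.
split => //.
have -> : (d + eps) * K ^+ 2 = K * d * K + K * eps * K by ring.
have -> : 4 * a ^+ 4 + 2 * a ^+ 3 = 2 * a ^+ 2 * (2 * a ^+ 2) + a * (2 * a ^+ 2) by ring.
apply: lerD; apply: ler_pM => //.
by rewrite mulr_ge0 //; lra.
Qed.

Theorem theorem5p4 (R : realType) (n P k l : nat) :
  (2 <= n)%N -> (1 < P <= n - 1)%N -> (l < k <= 'C(n, P))%N ->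
  (1 < k.+1 - l)%N ->
  forall m0 M0 : R, 0 < m0 ->
  exists C : R, 0 < C /\
    forall (eps : R) (phi u : 'rV[R]_n.+1 -> R),
      0 < eps ->
      CkS 2 phi -> (forall x, sphere n x -> 0 < phi x) ->
      (forall x, sphere n x -> m0 <= phi x) -> C2bound phi M0 ->
      CkS 4 u -> (forall x, sphere n x -> 0 < u x) ->
      admissible P k u ->
      solves P k l k.+1 (k.+1 - l) eps phi u ->
      forall x0, sphere n x0 -> (forall x, sphere n x -> u x0 <= u x) ->
      forall x v w, sphere n x -> utan x v -> utan x w ->
        `|hess (hext (fun y => u y / u x0)) x v w| <= C.
Proof.
move=> n2 /andP[P1 _] lkN _ m0 M0 m00; have /andP[lk _] := lkN.
(* [B] is the factor of [hessian_estimate] after [gradient_constants] has removed [eps], and [E]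
   below is the Harnack factor for [K <= 2 a^2]. *)
pose a := M0 / m0; pose B := a * (1 + (4 * a ^+ 4 + 2 * a ^+ 3) + a + a ^+ 2).
pose E := expR (4 * (2 * a ^+ 2)).
(* The constant is fixed before [phi], when the sign of [M0] is still unknown; the absolute value
   and the added [1] keep it positive. The summand [n%:R * E] pays for the passage from the Hessian
   of [U] back to that of [u]. *)
exists (`|n%:R * (n%:R * (E * B)) + n%:R * E| + 1).
split=> [|eps phi u e0 phi2 phi0 phi_ge phi_bound u4 u0 adm sol x0 x0S x0min x v w xS xv xw].
  by rewrite ltr_wpDl.
have H : solution_data P k l eps m0 M0 phi u by split => //; apply: ltnW.
have u2 := sd_u2 H; have u1 : CkS 1 u := isCk_le (@open_punctured R _) (leqnSn 1) u2.
have [K [K0 HKe HK]] := gradient_estimate H.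
have a1 : 1 <= a by rewrite ler_pdivlMr ?mul1r // (sd_m0_le_M0 H).
have M00 : 0 < M0 := lt_le_trans m00 (sd_m0_le_M0 H).
have d1 : 1 <= (k - l)%:R :> R by rewrite ler1n subn_gt0.
have ab : a * (m0 / M0) = 1 by rewrite /a; field; rewrite !gt_eqF.
have [K1 K2] := gradient_constants d1 (lt_le_trans ltr01 a1) ab K0 e0 HKe.
have ux0 := u0 _ x0S.
have har y : sphere n y -> u y <= E * u x0.
  move=> yS; apply: le_trans (harnack (ltnW n2) u1 K0 u0 HK yS x0S) _.
  by rewrite ler_pM2r // ler_expR ler_wpM2l.
have E0 : 0 < E := expR_gt0 _.
have [z zS HL] := hessian_estimate H K0 HK.
have B0 : 0 <= B.
  have a0 : 0 <= a := le_trans ler01 a1; apply: mulr_ge0 => //.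
  by do ?apply: addr_ge0 => //; do ?apply: mulr_ge0 => //; apply: exprn_ge0.
have HT y f : sphere n y -> utan y f -> hess (hom1 u) y f f <= E * u x0 * B.
  move=> yS yf; apply: le_trans (HL y f yS yf) _.
  have aK : a * (1 + ((k - l)%:R + eps) * K ^+ 2 + a + a ^+ 2) <= B.
    rewrite ler_wpM2l ?(le_trans ler01 a1) // lerD2r lerD2r lerD2l.
    exact: K2.
  apply: le_trans (_ : u z * B <= _); first by rewrite ler_wpM2l // ltW // u0.
  by rewrite ler_wpM2r // har.
have T0 : 0 <= E * u x0 * B by apply: mulr_ge0 => //; apply: mulr_ge0; apply: ltW.
have k0 : (0 < k)%N := leq_ltn_trans (leq0n l) lk.
have two := hess_two_sided k0 u2 adm T0 HT xS xv xw.
have -> : hext (fun y => u y / u x0) = (fun y => hext u y / u x0) by [].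
rewrite hess_scale ?sphere_neq0 // normrM normfV (gtr0_norm ux0) ler_pdivrMr //.
have [vv vx] := xv; have [ww wx] := xw.
have -> : hess (hext u) x v w = hess (hom1 u) x v w - dotv v w * u x.
  by rewrite (hess_hom1 u2 xS vx wx) addrK.
apply: le_trans (ler_normB _ _) _.
have dot : `|dotv v w * u x| <= n%:R * (E * u x0).
  rewrite normrM (gtr0_norm (u0 _ xS)); apply: ler_pM => //.
  - exact: ltW (u0 _ xS).
  - exact: dotv_utan_le xS xv xw.
  - exact: har.
apply: le_trans (lerD two dot) _.
have -> : n%:R * (n%:R * (E * u x0 * B)) + n%:R * (E * u x0) =
    (n%:R * (n%:R * (E * B)) + n%:R * E) * u x0 by ring.
rewrite ler_pM2r //; apply: le_trans (ler_norm _) _.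
by rewrite lerDl.
Qed.
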